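(* Let $\xi$ be a real random variable with $\mathbb{E} e^{\xi}=\tfrac12$, $\mathbb{E}\,\xi e^{\xi}=0$, $\mathbb{E} e^{(1+h)\xi}<\infty$ for some $h>0$, and $\mathbb{E} e^{-h\xi}<\infty$ for some $h>0$. Let $\mu_1$ be the associated critical Mandelbrot cascade measure on $[0,1]$. Then for any $\gamma\in(0,1/2)$ there is a random constant $C(\omega)$, finite almost surely, such that $$\mu_1(I)\le C(\omega)\left(\log\left(1+\frac1{|I|}\right)\right)^{-\gamma}$$ for all subintervals $I\subset[0,1]$. Moreover, one cannot take $\gamma>1/2$ in this statement, i.e. for $\gamma>1/2$ there is no almost surely finite random constant $C(\omega)$ for which the bound holds almost surely for all subintervals $I\subset[0,1]$.
   Context: Notation: $|I|$ is the length of $I$. $\Sigma_n=\{0,1\}^n$, $\Sigma=\bigcup_{n\ge1}\Sigma_n$. Let $(\xi_\sigma)_{\sigma\in\Sigma}$ be independent copies of $\xi$; for $\sigma=\sigma_1\cdots\sigma_n\in\Sigma_n$ put $X_\sigma=\xi_{\sigma_1}+\xi_{\sigma_1\sigma_2}+\cdots+\xi_{\sigma_1\sigma_2\cdots\sigma_n}$, and let $I_\sigma\subset[0,1]$ be the dyadic interval of length $2^{-n}$ with left endpoint $\sum_{k=1}^n\sigma_k2^{-k}$. Critical measure: let $\mu_{1,n}$ be the random measure on $[0,1]$ whose density with respect to Lebesgue measure is constant on each $I_\sigma$, $\sigma\in\Sigma_n$, and with $\mu_{1,n}(I_\sigma)=n^{1/2}e^{X_\sigma}$. It is known that $n^{1/2}\sum_{\sigma\in\Sigma_n}e^{X_\sigma}$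 converges in probability to a random variable $Y_1$ with $0<Y_1<\infty$ almost surely, and that $\mu_{1,n}$ converges weakly in probability, as $n\to\infty$, to a random finite measure $\mu_1$ on $[0,1]$. For every $n\ge1$, $(\mu_1(I_\sigma))_{\sigma\in\Sigma_n}$ has the same law as $(e^{X_\sigma}Y_1^{(\sigma)})_{\sigma\in\Sigma_n}$, where $(Y_1^{(\sigma)})_{\sigma\in\Sigma_n}$ are independent copies of $Y_1$, independent of $(X_\sigma)_{\sigma\in\Sigma_n}$. *)

(* Defs.v *)
From HB Require Import structures.
From mathcomp Require Import all_boot all_order all_algebra.
From mathcomp Require Import all_classical all_reals all_analysis.
From mathcomp Require Import measurable_realfun.

Set Implicit Arguments.
Unset Strict Implicit.
Unset Printing Implicit Defensive.

Import Order.TTheory GRing.Theory Num.Theory.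
Import numFieldNormedType.Exports.

Local Open Scope classical_set_scope.
Local Open Scope ring_scope.

Section probability_notions.
Context {d} {T : measurableType d} {R : realType} (P : probability T R).

Definition mutually_independent (I : eqType) (D : set I) (X : I -> {RV P >-> R}) :=
  forall (s : seq I) (A : I -> set R), uniq s -> (forall i, i \in s -> D i) ->
    (forall i, measurable (A i)) ->
    P (\big[setI/setT]_(i <- s) (X i @^-1` A i)) =
    (\prod_(i <- s) P (X i @^-1` A i))%E.

Definition same_law d' (T' : measurableType d') (P' : probability T' R)
    (X : {RV P >-> R}) (X' : {RV P' >-> R}) :=
  forall A : set R, measurable A -> P (X @^-1` A) = P' (X' @^-1` A).

Definition cvg_in_probability (Z : nat -> T -> R) (Y : T -> R) :=
  forall e : R, 0 < e ->
    (fun n => P [set w | e <= `|Z n w - Y w|]) @ \oo --> 0%E.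

End probability_notions.

Section cascade.
Context {d} {T : measurableType d} {R : realType} {P : probability T R}.
Variable xi : seq bool -> {RV P >-> R}.

(* A word sigma = sigma_1 ... sigma_n is the sequence [:: sigma_1; ...; sigma_n],
   and [xi [::]] is never used. *)
Definition branch_sum (s : seq bool) (w : T) : R :=
  \sum_(1 <= k < (size s).+1) xi (take k s) w.

Definition word_left (s : seq bool) : R :=
  \sum_(0 <= k < size s) (nth false s k)%:R * 2^-1 ^+ k.+1.

(* Half-open, so that the words of length [n] partition [0, 1[. *)
Definition word_itv (s : seq bool) : set R :=
  `[word_left s, word_left s + 2^-1 ^+ size s[.

Definition critical_mass (n : nat) (w : T) : R :=
  Num.sqrt n%:R * \sum_(s : n.-tuple bool) expR (branch_sum s w).

(* The factor [2 ^+ n] is the inverse length of [word_itv s], so that the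
   mass given to [word_itv s] is [Num.sqrt n%:R * expR (branch_sum s w)]. *)
Definition critical_density (n : nat) (w : T) (x : R) : R :=
  \sum_(s : n.-tuple bool)
    Num.sqrt n%:R * expR (branch_sum s w) * 2 ^+ n * \1_(word_itv s) x.

Definition critical_measure (n : nat) (w : T) (A : set (measurableTypeR R)) : \bar R :=
  (\int[lebesgue_measure]_(x in A) (critical_density n w x)%:E)%E.

Lemma critical_density_ge0 n w x : 0 <= critical_density n w x.
Proof.
by apply: sumr_ge0 => s _; rewrite !mulr_ge0 ?sqrtr_ge0 ?expR_ge0 ?exprn_ge0.
Qed.

Lemma measurable_critical_density n w (A : set R) :
  measurable_fun A (critical_density n w).
Proof.
apply: measurable_sum => s; apply: measurable_funM; first exact: measurable_cst.
by apply: measurable_indic; exact: measurable_itv.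
Qed.

Section critical_measure_is_measure.
Variables (n : nat) (w : T).

Let critical_measure0 : critical_measure n w set0 = 0%E.
Proof. by rewrite /critical_measure integral_set0. Qed.

Let critical_measure_ge0 A : (0 <= critical_measure n w A)%E.
Proof. by apply: integral_ge0 => x _; rewrite lee_fin critical_density_ge0. Qed.

Let critical_measure_sigma_additive :
  semi_sigma_additive (critical_measure n w).
Proof.
apply: (@semi_sigma_additive_nng_induced _ _ _ lebesgue_measure
  (fun x => (critical_density n w x)%:E)) => [|x].
  by apply/measurable_EFinP; exact: measurable_critical_density.
by rewrite lee_fin critical_density_ge0.
Qed.

HB.instance Definition _ := isMeasure.Build _ _ _ (critical_measure n w)
  critical_measure0 critical_measure_ge0 critical_measure_sigma_additive.

End critical_measure_is_measure.

End cascade.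

(* [Rintegral] is meaningful here because both measures are finite on [0, 1],
   where [f] is bounded. *)
Definition cvg_weakly_in_probability {d} {T : measurableType d} {R : realType}
    (P : probability T R)
    (nu : nat -> T -> {measure set (measurableTypeR R) -> \bar R})
    (mu : T -> {measure set (measurableTypeR R) -> \bar R}) :=
  forall f : R -> R, {within `[0, 1], continuous f} ->
    cvg_in_probability P
      (fun n w => \int[nu n w]_(x in `[0, 1]) f x)
      (fun w => \int[mu w]_(x in `[0, 1]) f x).

(* Singletons and the empty set are left out, as the bound is not
   meaningful for intervals of length [0]. *)
Definition log_modulus {d} {T : measurableType d} {R : realType}
    (P : probability T R)
    (mu : T -> {measure set (measurableTypeR R) -> \bar R}) (gamma : R) :=
  exists C : T -> \bar R,
    [/\ measurable_fun setT C,
        {ae P, forall w, C w \is a fin_num} &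
        {ae P, forall w, forall (a b : R) (ba bb : bool),
          0 <= a -> a < b -> b <= 1 ->
          (mu w [set` Interval (BSide ba a) (BSide bb b)] <=
           C w * (ln (1 + (b - a)^-1) `^ (- gamma))%:E)%E}].

(* Main.v *)
Require Import Defs.
From HB Require Import structures.
From mathcomp Require Import all_boot all_order all_algebra.
From mathcomp Require Import all_classical all_reals all_analysis.
From mathcomp Require Import measurable_realfun.
From mathcomp Require Import ring lra zify.

Set Implicit Arguments.
Unset Strict Implicit.
Unset Printing Implicit Defensive.

Import Order.TTheory GRing.Theory Num.Theory.
Import numFieldNormedType.Exports.

Local Open Scope classical_set_scope.
Local Open Scope ring_scope.

(* Let [W_m] be the total mass of [m] generations and let [M_(n, m)] be the
   largest mass that [n + m] generations give to a word of length [n], so that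
   the critical measure of order [N = n + m] gives at most
   [sqrt N * M_(n, m)] to dyadic intervals of length [2^-n].

   By the many-to-one formula everything is governed by the operator
   [step f x = E (2 exp xi * f (x - xi))], the transition operator of a centred
   random walk, and by its version [kstep] killed below [0]. Exponential
   barriers, which rely on [kappa t = E (2 exp ((1 + t) xi)) >= 1 + c t^2], show
   that the survival probability satisfies [kstep^n 1 x <= C (1 + x) / sqrt n].

   Upper bound: the first and second truncated moments
   [e^x E min (e^-x sqrt N W_m) 1] and [e^x E (min (e^-x sqrt N W_m) 1)^2] satisfy
   recursions in [m] that are dominated by [kstep]; averaging over [m] and
   iterating [n] further steps from height [a] gives
   [P (sqrt N M_(n, m) >= e^(a - s))
      <= e^(s - a) * (e^-s + e + C (1 + a) / sqrt n)]
   for arbitrarily large [m]. With [n = 2^j], [e^(a - s) = n^-gamma] and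
   [gamma < 1/2] the right-hand side is summable in [j], and Borel-Cantelli
   applies.

   Lower bound: as [sqrt m * W_m] stays away from [0] with positive probability,
   the recursion for the tail of [sqrt N W_m] gives
   [P (sqrt N W_m > e^x) >= C (min e^-x 1 - e)] for large [m], hence
   [P (sqrt N M_(n, m) <= e^x) <= E exp (- C (min (e^-x W_n) 1 - 2^n e))].
   Since [sqrt n * W_n] tends to [Y_1 > 0], for [gamma' > 1/2] the masses
   [sqrt N * M_(n, m)] exceed [n^-gamma'] with probability bounded below.

   Both estimates pass to [mu_1] by testing against tent functions centred at
   the dyadic points. *)

(** * Independence of sigma-algebras generated by disjoint families *)

(** The obstacle is that [sqrt N * W_N] has expectation [sqrt N] although it stays bounded in
    probability: its mean is carried by rare large values, so moments help only after truncation at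
    a level [e^x]. The level then becomes the state of a walk: a child sees the level [x - xi], and
    the weight [2 exp xi] is a probability density because [E exp xi = 1/2], under which [xi] is
    centred because [E xi exp xi = 0]. Tilted truncated moments are at most [e^x], hence at most [1]
    below [0], which is what allows killing there. Second moments are needed in the upper bound: the
    first truncated moment is only bounded by a multiple of [1 + x], the shape of a harmonic
    function, so iterating it over [n] steps gains nothing, whereas the averaged second moment is
    bounded and its iterates inherit the decay of the survival probability. The barriers control
    sums over time of the walk near [0], not its decay at each time; this forces the average over
    [m]. A sparse set of good [m] is enough, as the cascades converge in probability. The lower
    bound needs no independence between scales. *)

Section independence.
Context {d} {T : measurableType d} {R : realType} (P : probability T R).
Variables (I : eqType) (D : set I) (X : I -> {RV P >-> R}).
Hypothesis indX : mutually_independent D X.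

Definition cylinders (E : set I) : set (set T) :=
  [set C | exists s : seq I, exists A : I -> set R,
    [/\ uniq s, forall i, i \in s -> E i, forall i, measurable (A i) &
        C = \big[setI/setT]_(i <- s) (X i @^-1` A i)]].

(** A type, so that depending only on the variables indexed by [E] is expressed by [measurable_fun]
    on the same functions. *)
Definition sigma_gen (E : set I) := g_sigma_algebraType (cylinders E).

Lemma big_setIP (s : seq I) (F : I -> set T) w :
  (\big[setI/setT]_(i <- s) F i) w <-> (forall i, i \in s -> F i w).
Proof.
elim: s => [|i s IH]; first by rewrite big_nil.
rewrite big_cons; split => [[Fi /IH h] j|h].
  by rewrite inE => /orP[/eqP ->//|/h].
split; first by apply: h; rewrite mem_head.
by apply/IH => j js; apply: h; rewrite inE js orbT.
Qed.

Lemma measurable_cylinders E : cylinders E `<=` measurable.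
Proof.
move=> _ [s [A [_ _ mA ->]]]; apply: bigsetI_measurable => i _.
exact: measurable_funPTI.
Qed.

Lemma sigma_cylinders_measurable E : <<s cylinders E >> `<=` measurable.
Proof.
apply: smallest_sub; last exact: measurable_cylinders.
exact: sigma_algebra_measurable.
Qed.

Lemma setI_closed_cylinders E : setI_closed (cylinders E).
Proof.
move=> _ _ [s [A [us sE mA ->]]] [t [B [ut tE mB ->]]].
(* The two index lists may overlap, so they are merged, with [setT] as the condition coming from a
   list that misses the index. *)
exists (undup (s ++ t)), (fun i => (if i \in s then A i else setT) `&`
  (if i \in t then B i else setT)); split.
- exact: undup_uniq.
- by move=> i; rewrite mem_undup mem_cat => /orP[/sE|/tE].
- by move=> i; apply: measurableI; case: ifP.
- apply/seteqP; split => w.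
    move=> [/big_setIP hs /big_setIP ht]; apply/big_setIP => i _ /=.
    by split; case: ifP => // is_; [exact: hs|exact: ht].
  move=> /big_setIP h; split; apply/big_setIP => i is_ /=.
    by have [] := h i; rewrite ?mem_undup ?mem_cat ?is_.
  by have [] := h i; rewrite ?mem_undup ?mem_cat ?is_ ?orbT.
Qed.

Lemma cylinders_indep E F A B : E `<=` D -> F `<=` D -> E `&` F = set0 ->
  cylinders E A -> cylinders F B -> P (A `&` B) = (P A * P B)%E.
Proof.
move=> ED FD EF [s [A' [us sE mA ->]]] [t [B' [ut tF mB ->]]].
have st i : i \in t -> i \in s = false.
  move=> it; apply/negP => is_.
  by have : set0 i by rewrite -EF; split; [exact: sE|exact: tF].
pose C i := if i \in s then A' i else B' i.
have -> : \big[setI/setT]_(i <- s) (X i @^-1` A' i) =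
  \big[setI/setT]_(i <- s) (X i @^-1` C i).
  by rewrite big_seq [RHS]big_seq; apply: eq_bigr => i is_; rewrite /C is_.
have -> : \big[setI/setT]_(i <- t) (X i @^-1` B' i) =
  \big[setI/setT]_(i <- t) (X i @^-1` C i).
  by rewrite big_seq [RHS]big_seq; apply: eq_bigr => i it; rewrite /C st.
have mC i : measurable (C i) by rewrite /C; case: ifP.
rewrite -big_cat/= !indX// ?big_cat//=.
- by move=> i /tF /FD.
- by move=> i /sE /ED.
- rewrite cat_uniq us ut andbT/=; apply/hasPn => i it.
  by rewrite /= st.
- by move=> i; rewrite mem_cat => /orP[/sE/ED|/tF/FD].
Qed.

(** For fixed [B] both sides are finite measures in [A], so agreement on the cylinders, which are
    stable under intersection, extends to the generated sigma-algebra. [sigma_indep] repeats this in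
    [B]. *)
Lemma sigma_indep_half E F A B : E `<=` D -> F `<=` D -> E `&` F = set0 ->
  <<s cylinders E >> A -> cylinders F B -> P (A `&` B) = (P A * P B)%E.
Proof.
move=> ED FD EF sA cB.
have mB := measurable_cylinders cB.
have PBfin : P B \is a fin_num by exact: fin_num_measure.
pose m1 : {measure set T -> \bar R} := mrestr P mB.
pose m2 : {measure set T -> \bar R} := mscale (NngNum (fine_ge0 (measure_ge0 P B))) P.
have m1E C : m1 C = P (C `&` B) by [].
have m2E C : m2 C = (P C * P B)%E.
  by rewrite /m2/= /mscale/= fineK// muleC.
rewrite -m1E -m2E.
apply: (g_sigma_algebra_measure_unique (cylinders E) _ (fun=> setT) _ _ m1 m2) sA => //.
- exact: measurable_cylinders.
- by move=> _; exists [::], (fun=> setT); split => //; rewrite big_nil.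
- by apply/seteqP; split => // w _; exists 0%N.
- exact: setI_closed_cylinders.
- move=> C cC; rewrite m1E m2E.
  exact: cylinders_indep cC cB.
- move=> _; rewrite m1E setTI.
  by rewrite (le_lt_trans (probability_le1 _ _)) ?ltry.
Qed.

Lemma sigma_indep E F A B : E `<=` D -> F `<=` D -> E `&` F = set0 ->
  <<s cylinders E >> A -> <<s cylinders F >> B -> P (A `&` B) = (P A * P B)%E.
Proof.
move=> ED FD EF sA sB.
have mA := sigma_cylinders_measurable sA.
have PAfin : P A \is a fin_num by exact: fin_num_measure.
pose m1 : {measure set T -> \bar R} := mrestr P mA.
pose m2 : {measure set T -> \bar R} := mscale (NngNum (fine_ge0 (measure_ge0 P A))) P.
have m1E C : m1 C = P (C `&` A) by [].
have m2E C : m2 C = (P A * P C)%E.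
  by rewrite /m2/= /mscale/= fineK.
rewrite setIC -m1E -m2E.
apply: (g_sigma_algebra_measure_unique (cylinders F) _ (fun=> setT) _ _ m1 m2) sB => //.
- exact: measurable_cylinders.
- by move=> _; exists [::], (fun=> setT); split => //; rewrite big_nil.
- by apply/seteqP; split => // w _; exists 0%N.
- exact: setI_closed_cylinders.
- move=> C cC; rewrite m1E m2E setIC.
  exact: sigma_indep_half sA cC.
- move=> _; rewrite m1E setTI.
  by rewrite (le_lt_trans (probability_le1 _ _)) ?ltry.
Qed.

Lemma sigma_gen_measurable_fun E d' (Y : measurableType d') (U : T -> Y) :
  measurable_fun setT (U : sigma_gen E -> Y) -> measurable_fun setT U.
Proof.
move=> mU _ A mA; apply: (@sigma_cylinders_measurable E).
by have := mU measurableT A mA.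
Qed.

Lemma sigma_genS E F d' (Y : measurableType d') (U : T -> Y) : E `<=` F ->
  measurable_fun setT (U : sigma_gen E -> Y) ->
  measurable_fun setT (U : sigma_gen F -> Y).
Proof.
move=> EF mU _ A mA; have := mU measurableT A mA.
apply: sub_sigma_algebra2 => _ [s [B [us sE mB ->]]].
by exists s, B; split => // i /sE /EF.
Qed.

Lemma sigma_gen_proj (E : set I) i : E i ->
  measurable_fun setT (X i : sigma_gen E -> R).
Proof.
move=> Ei _ A mA; rewrite setTI; apply: sub_sigma_algebra.
exists [:: i], (fun=> A); split => //.
- by move=> j; rewrite inE => /eqP ->.
- by rewrite big_seq1.
Qed.

(** The joint law of [(U, V)] is the product of the marginal laws, after which Tonelli's theorem
    applies. *)
Lemma indep_integral E F (U V : T -> R) (Phi : R * R -> \bar R) :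
  E `<=` D -> F `<=` D -> E `&` F = set0 ->
  measurable_fun setT (U : sigma_gen E -> R) ->
  measurable_fun setT (V : sigma_gen F -> R) ->
  measurable_fun setT Phi -> (forall z, 0 <= Phi z)%E ->
  (\int[P]_w Phi (U w, V w) = \int[P]_w \int[P]_w' Phi (U w, V w'))%E.
Proof.
move=> ED FD EF mU mV mPhi Phi0.
have mU' := sigma_gen_measurable_fun mU.
have mV' := sigma_gen_measurable_fun mV.
pose U' : {mfun T >-> R} := HB.pack U (isMeasurableFun.Build _ _ _ _ _ mU').
pose V' : {mfun T >-> R} := HB.pack V (isMeasurableFun.Build _ _ _ _ _ mV').
have mUV : measurable_fun setT (fun w => (U w, V w)).
  exact: measurable_fun_pair.
pose UV : {mfun T >-> (R * R)%type} := HB.pack (fun w => (U w, V w))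
  (isMeasurableFun.Build _ _ _ _ _ mUV).
have E1 : (\int[P]_w Phi (U w, V w) = \int[distribution P UV]_z Phi z)%E.
  by rewrite ge0_integral_distribution.
have E2 : (\int[distribution P UV]_z Phi z =
    \int[distribution P U' \x distribution P V']_z Phi z)%E.
  apply: eq_measure_integral => A mA _.
  apply/esym; apply: product_measure_unique => // B C mB mC.
  rewrite /distribution /pushforward/= -(sigma_indep ED FD EF)//.
  - by have := mU measurableT _ mB; rewrite setTI.
  - by have := mV measurableT _ mC; rewrite setTI.
rewrite E1 E2 fubini_tonelli1//= ge0_integral_distribution//; first last.
- by move=> x; apply: integral_ge0.
- exact: measurable_fun_fubini_tonelli_F.
apply: eq_integral => w _ /=; rewrite /fubini_F.
by rewrite ge0_integral_distribution//; apply: measurableT_comp.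
Qed.

Lemma indep_integralM E F (f g : T -> R) :
  E `<=` D -> F `<=` D -> E `&` F = set0 ->
  measurable_fun setT (f : sigma_gen E -> R) ->
  measurable_fun setT (g : sigma_gen F -> R) ->
  (forall w, 0 <= f w) -> (forall w, 0 <= g w) ->
  (\int[P]_w (f w * g w)%:E = (\int[P]_w (f w)%:E) * \int[P]_w (g w)%:E)%E.
Proof.
move=> ED FD EF mf mg f0 g0.
have mf' := sigma_gen_measurable_fun mf.
have mg' := sigma_gen_measurable_fun mg.
(* [indep_integral] asks for an integrand that is nonnegative on the whole plane, hence the absolute
   values. *)
transitivity (\int[P]_w (`|f w| * `|g w|)%:E)%E.
  by apply: eq_integral => w _; rewrite !ger0_norm.
rewrite (indep_integral (Phi := fun z => (`|z.1| * `|z.2|)%:E) ED FD EF)//=.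
- transitivity (\int[P]_w ((f w)%:E * \int[P]_w' (g w')%:E))%E.
    apply: eq_integral => w _; rewrite -ge0_integralZl//.
    - by apply: eq_integral => w' _; rewrite !ger0_norm// EFinM.
    - exact/measurable_EFinP.
    - by move=> w' _; rewrite lee_fin.
    - by rewrite lee_fin.
  rewrite ge0_integralZr//.
  - exact/measurable_EFinP.
  - by move=> w _; rewrite lee_fin.
  - by apply: integral_ge0 => w _; rewrite lee_fin.
- by apply/measurable_EFinP; apply: measurable_funM;
    apply: measurableT_comp.
Qed.

End independence.

Lemma integral_cst_probability d (T : measurableType d) (R : realType)
  (P : probability T R) (c : \bar R) : (\int[P]_w c = c)%E.
Proof. by rewrite integral_cst//= probability_setT mule1. Qed.

(** * The many-to-one operator *)

Section step_operator.
Context {d} {Om : measurableType d} {R : realType} (P : probability Om R).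
Variable xi : {RV P >-> R}.
Implicit Types f g : R -> \bar R.

(* The class of functions to which Tonelli's theorem applies. *)
Definition nnm f := measurable_fun setT f /\ forall x, (0 <= f x)%E.

Definition step f (x : R) : \bar R :=
  (\int[P]_w ((2 * expR (xi w))%:E * f (x - xi w)%R))%E.

Definition kill f y : \bar R := if 0 <= y then f y else 0%E.

(** Killing tests the position after the jump; the starting point itself is not tested. *)
Definition kstep f := step (kill f).

(* [fun y => expR (- t * y)] is an eigenfunction of [step] for [kappa t]. *)
Definition kappa (t : R) : \bar R := (\int[P]_w (2 * expR ((1 + t) * xi w))%:E)%E.

Lemma nnm_cst (c : R) : 0 <= c -> nnm (fun=> c%:E).
Proof. by move=> c0; split => [|x]; [exact: measurable_cst|rewrite lee_fin]. Qed.

Lemma nnmD f g : nnm f -> nnm g -> nnm (fun x => f x + g x)%E.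
Proof.
move=> [mf f0] [mg g0]; split; last by move=> x; exact: adde_ge0.
exact: emeasurable_funD.
Qed.

Lemma nnmZ (c : R) f : 0 <= c -> nnm f -> nnm (fun x => c%:E * f x)%E.
Proof.
move=> c0 [mf f0]; split; last by move=> x; exact: mule_ge0.
exact: measurable_funeM.
Qed.

Lemma nnm_sum (I : Type) (s : seq I) (f : I -> R -> \bar R) :
  (forall i, nnm (f i)) -> nnm (fun x => \sum_(i <- s) f i x)%E.
Proof.
move=> nf; split; last by move=> x; apply: sume_ge0 => i _; have [] := nf i.
by apply: emeasurable_sum => i; have [] := nf i.
Qed.

Lemma nnm_EFin (f : R -> R) : measurable_fun setT f -> (forall x, 0 <= f x) ->
  nnm (fun x => (f x)%:E).
Proof. by move=> mf f0; split => [|x]; [exact/measurable_EFinP|rewrite lee_fin]. Qed.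

Lemma measurable_ge_bool (r : R) : measurable_fun setT (fun x : R => r <= x).
Proof. exact: measurable_fun_ler. Qed.

Lemma nnm_kill f : nnm f -> nnm (kill f).
Proof.
move=> [mf f0]; split; last by move=> x; rewrite /kill; case: ifP.
by apply: measurable_fun_ifT => //; exact: measurable_ge_bool.
Qed.

Let integrand f (x : R) w : \bar R := ((2 * expR (xi w))%:E * f (x - xi w)%R)%E.

Let integrand_ge0 f x w : nnm f -> (0 <= integrand f x w)%E.
Proof. by move=> [_ f0]; rewrite mule_ge0// lee_fin. Qed.

Lemma measurable_step_integrand2 f : nnm f ->
  measurable_fun setT (fun z : R * Om => integrand f z.1 z.2).
Proof.
move=> [mf f0]; apply: emeasurable_funM.
  apply/measurable_EFinP; apply: measurable_funM => //.
  apply: measurableT_comp; first exact: measurable_expR.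
  exact: measurableT_comp.
apply: measurableT_comp => //; apply: measurable_funB => //.
exact: measurableT_comp.
Qed.

Lemma measurable_step_integrand f x : nnm f ->
  measurable_fun setT (integrand f x).
Proof.
move=> nf; exact: (measurableT_comp (measurable_step_integrand2 nf)
  (pair1_measurable x)).
Qed.

Lemma nnm_step f : nnm f -> nnm (step f).
Proof.
move=> nf; split; last by move=> x; apply: integral_ge0 => w _; exact: integrand_ge0.
apply: (measurable_fun_fubini_tonelli_F
  (fun z : R * Om => integrand f z.1 z.2)).
  exact: measurable_step_integrand2.
by move=> z; exact: integrand_ge0.
Qed.

Lemma nnm_kstep f : nnm f -> nnm (kstep f).
Proof. by move=> nf; exact/nnm_step/nnm_kill. Qed.

Lemma nnm_iter_kstep f n : nnm f -> nnm (iter n kstep f).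
Proof. by move=> nf; elim: n => // n IH; exact: nnm_kstep. Qed.

Lemma le_step f g x : nnm f -> nnm g -> (forall y, f y <= g y)%E ->
  (step f x <= step g x)%E.
Proof.
move=> nf ng fg; apply: ge0_le_integral => //.
- by move=> w _; exact: integrand_ge0.
- exact: measurable_step_integrand.
- exact: measurable_step_integrand.
- by move=> w _; rewrite lee_wpmul2l ?lee_fin.
Qed.

Lemma le_kill f g (y : R) : ((0 <= y)%R -> f y <= g y)%E -> (kill f y <= kill g y)%E.
Proof. by rewrite /kill; case: ifP => // y0; exact. Qed.

Lemma le_kstep f g x : nnm f -> nnm g -> (forall y : R, (0 <= y)%R -> f y <= g y)%E ->
  (kstep f x <= kstep g x)%E.
Proof.
move=> nf ng fg; apply: le_step; [exact: nnm_kill..|].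
by move=> y; exact/le_kill/fg.
Qed.

Lemma stepD f g x : nnm f -> nnm g ->
  (step (fun y => f y + g y) x = step f x + step g x)%E.
Proof.
move=> nf ng; rewrite /step -ge0_integralD//.
- by apply: eq_integral => w _; rewrite ge0_muleDr//; [apply nf|apply ng].
- by move=> w _; exact: integrand_ge0.
- exact: measurable_step_integrand.
- by move=> w _; exact: integrand_ge0.
- exact: measurable_step_integrand.
Qed.

Lemma stepZ (c : R) f x : 0 <= c -> nnm f ->
  (step (fun y => c%:E * f y) x = c%:E * step f x)%E.
Proof.
move=> c0 nf; rewrite /step -ge0_integralZl//.
- by apply: eq_integral => w _; rewrite muleCA.
- exact: measurable_step_integrand.
- by move=> w _; exact: integrand_ge0.
Qed.

Lemma step_sum (I : Type) (s : seq I) (f : I -> R -> \bar R) x :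
  (forall i, nnm (f i)) ->
  (step (fun y => \sum_(i <- s) f i y) x = \sum_(i <- s) step (f i) x)%E.
Proof.
move=> nf; rewrite /step -ge0_integral_sum//.
- apply: eq_integral => w _; rewrite ge0_sume_distrr// => i _.
  by have [_ f0] := nf i.
- by move=> i; exact: measurable_step_integrand.
- by move=> i w _; exact: integrand_ge0.
Qed.

Lemma killD f g : kill (fun y => f y + g y)%E = (fun y => kill f y + kill g y)%E.
Proof. by apply/funext => y; rewrite /kill; case: ifP => //; rewrite adde0. Qed.

Lemma killZ (c : R) f : kill (fun y => c%:E * f y)%E = (fun y => c%:E * kill f y)%E.
Proof. by apply/funext => y; rewrite /kill; case: ifP => //; rewrite mule0. Qed.

Lemma kill_sum (I : Type) (s : seq I) (f : I -> R -> \bar R) :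
  kill (fun y => \sum_(i <- s) f i y)%E = (fun y => \sum_(i <- s) kill (f i) y)%E.
Proof.
apply/funext => y; rewrite /kill; case: ifP => // _.
by rewrite big1.
Qed.

Lemma kstepD f g x : nnm f -> nnm g ->
  (kstep (fun y => f y + g y) x = kstep f x + kstep g x)%E.
Proof. by move=> nf ng; rewrite /kstep killD stepD//; exact: nnm_kill. Qed.

Lemma kstepZ (c : R) f x : 0 <= c -> nnm f ->
  (kstep (fun y => c%:E * f y) x = c%:E * kstep f x)%E.
Proof. by move=> c0 nf; rewrite /kstep killZ stepZ//; exact: nnm_kill. Qed.

Lemma kstep_sum (I : Type) (s : seq I) (f : I -> R -> \bar R) x :
  (forall i, nnm (f i)) ->
  (kstep (fun y => \sum_(i <- s) f i y) x = \sum_(i <- s) kstep (f i) x)%E.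
Proof. by move=> nf; rewrite /kstep kill_sum step_sum// => i; exact: nnm_kill. Qed.

Lemma le_iter_kstep f g n x : nnm f -> nnm g -> 0 <= x ->
  (forall y : R, (0 <= y)%R -> f y <= g y)%E ->
  (iter n kstep f x <= iter n kstep g x)%E.
Proof.
move=> nf ng x0 fg; elim: n x x0 => [|n IH] x x0; first exact: fg.
by apply: le_kstep => //; exact: nnm_iter_kstep.
Qed.

Lemma iter_kstepD f g n x : nnm f -> nnm g ->
  (iter n kstep (fun y => f y + g y) x = iter n kstep f x + iter n kstep g x)%E.
Proof.
move=> nf ng; elim: n x => // n IH x; rewrite !iterS -kstepD; last 2 first.
  exact: nnm_iter_kstep.
  exact: nnm_iter_kstep.
by congr (kstep _ x); apply/funext.
Qed.

Lemma iter_kstepZ (c : R) f n x : 0 <= c -> nnm f ->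
  (iter n kstep (fun y => c%:E * f y) x = c%:E * iter n kstep f x)%E.
Proof.
move=> c0 nf; elim: n x => // n IH x; rewrite !iterS -kstepZ//; last first.
  exact: nnm_iter_kstep.
by congr (kstep _ x); apply/funext.
Qed.

Lemma iter_kstep_sum (I : Type) (s : seq I) (f : I -> R -> \bar R) n x :
  (forall i, nnm (f i)) ->
  (iter n kstep (fun y => \sum_(i <- s) f i y) x =
   \sum_(i <- s) iter n kstep (f i) x)%E.
Proof.
move=> nf; elim: n x => // n IH x; rewrite !iterS -kstep_sum//; last first.
  by move=> i; exact: nnm_iter_kstep.
by congr (kstep _ x); apply/funext.
Qed.

Lemma kappa_ge0 t : (0 <= kappa t)%E.
Proof. by apply: integral_ge0 => w _; rewrite lee_fin mulr_ge0// expR_ge0. Qed.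

Lemma nnm_expR t : nnm (fun y => (expR (t * y))%:E).
Proof.
apply: nnm_EFin => [|x]; last exact: expR_ge0.
by apply: measurableT_comp; [exact: measurable_expR|exact: measurable_funM].
Qed.

Lemma step_expR t x :
  step (fun y => (expR (t * y))%:E) x = ((expR (t * x))%:E * kappa (- t))%E.
Proof.
rewrite /step /kappa -ge0_integralZl//; last first.
- apply/measurable_EFinP; apply: measurable_funM => //.
  apply: measurableT_comp; first exact: measurable_expR.
  exact: measurable_funM.
apply: eq_integral => w _; rewrite -!EFinM; congr EFin.
rewrite -mulrA -expRD [RHS]mulrCA -expRD; congr (2 * expR _); ring.
Qed.

Hypothesis xi_mean : ('E_P[(fun w => expR (xi w))%R] = (2^-1)%:E)%E.

Lemma integral_expR_xi : (\int[P]_w (expR (xi w))%:E = (2^-1)%:E)%E.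
Proof. by move: xi_mean; rewrite unlock. Qed.

Lemma kappa0 : kappa 0 = 1%E.
Proof.
rewrite /kappa; under eq_integral do rewrite addr0 mul1r EFinM.
rewrite ge0_integralZl//.
  by rewrite integral_expR_xi -EFinM divff.
by apply/measurable_EFinP; apply: measurableT_comp; first exact: measurable_expR.
Qed.

Lemma step_cst (c : R) x : 0 <= c -> step (fun=> c%:E) x = c%:E.
Proof.
move=> c0; have := stepZ x c0 (nnm_expR 0).
rewrite step_expR mul0r expR0 mul1e oppr0 kappa0 mule1.
by apply: etrans; congr (step _ x); apply/funext => y; rewrite mul0r expR0 mule1.
Qed.

End step_operator.

(** * Quadratic growth of [kappa] at criticality *)

Section moments.
Context {d} {Om : measurableType d} {R : realType} (P : probability Om R).
Variable xi : {RV P >-> R}.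
Hypothesis xi_mean : ('E_P[(fun w => expR (xi w))%R] = (2^-1)%:E)%E.
Hypothesis xi_crit : ('E_P[(fun w => xi w * expR (xi w))%R] = 0)%E.

Let pos w := Num.max (xi w * expR (xi w)) 0.
Let neg w := Num.max (- (xi w * expR (xi w))) 0.
Let sq w := Num.max (xi w) 0 ^+ 2 * expR (xi w).

Let m_exp : measurable_fun setT (fun w => expR (xi w)).
Proof. by apply: measurableT_comp; first exact: measurable_expR. Qed.

Let m_xexp : measurable_fun setT (fun w => xi w * expR (xi w)).
Proof. exact: measurable_funM. Qed.

Let m_pos : measurable_fun setT pos. Proof. exact: measurable_maxr. Qed.

Let m_neg : measurable_fun setT neg.
Proof. by apply: measurable_maxr => //; exact: measurable_funN. Qed.

Let m_sq : measurable_fun setT sq.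
Proof.
apply: measurable_funM => //; apply: measurable_funX.
exact: measurable_maxr.
Qed.

Let pos_ge0 w : 0 <= pos w. Proof. by rewrite /pos le_max lexx orbT. Qed.
Let neg_ge0 w : 0 <= neg w. Proof. by rewrite /neg le_max lexx orbT. Qed.
Let sq_ge0 w : 0 <= sq w. Proof. by rewrite /sq mulr_ge0// ?sqr_ge0 ?expR_ge0. Qed.

Let neg_le1 w : neg w <= 1.
Proof.
rewrite /neg ge_max ler01 andbT -mulNr; have e0 := expR_gt0 (xi w).
rewrite -ler_pdivlMr// -expRN mul1r.
by apply: le_trans (expR_ge1Dx _); rewrite lerDr.
Qed.

Let Ipos := (\int[P]_w (pos w)%:E)%E.
Let Ineg := (\int[P]_w (neg w)%:E)%E.
Let Isq := (\int[P]_w (sq w)%:E)%E.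

Let Ineg_fin : Ineg \is a fin_num.
Proof.
rewrite ge0_fin_numE; last by apply: integral_ge0 => w _; rewrite lee_fin.
apply: (@le_lt_trans _ _ (\int[P]_w 1)%E).
  apply: ge0_le_integral => //; first by move=> w _; rewrite lee_fin.
    exact/measurable_EFinP.
  by move=> w _; rewrite lee_fin.
rewrite integral_cst_probability; exact: ltry.
Qed.

(** The expectation is a difference of two integrals; as [- u * exp u <= 1] the negative one is
    finite, so a vanishing difference does mean equality. *)
Let Ipos_eq : Ipos = Ineg.
Proof.
move: xi_crit; rewrite unlock integralE.
have -> : (\int[P]_x (fun w => (xi w * expR (xi w))%:E)^\+ x)%E = Ipos.
  by apply: eq_integral => w _; rewrite funeposE/= EFin_max.
have -> : (\int[P]_x (fun w => (xi w * expR (xi w))%:E)^\- x)%E = Ineg.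
  by apply: eq_integral => w _; rewrite funenegE/= EFin_max.
rewrite -/Ineg; move: Ineg_fin; case: Ineg => [n|//|//] _; case: Ipos => // r.
by rewrite -EFinB => -[/eqP]; rewrite subr_eq0 => /eqP ->.
Qed.

Let ae0 (f : Om -> R) : measurable_fun setT f -> (forall w, 0 <= f w) ->
  (\int[P]_w (f w)%:E = 0)%E -> {ae P, forall w, f w = 0}.
Proof.
move=> mf f0 If0.
have /ae_eq_integral_abs : measurable_fun setT (EFin \o f) by exact/measurable_EFinP.
move=> /(_ P measurableT)[+ _].
have -> : (\int[P]_x `|(EFin \o f) x| = \int[P]_x (f x)%:E)%E.
  by apply: eq_integral => w _; rewrite /= ger0_norm.
by move=> /(_ If0); apply: filterS => w /(_ I) [].
Qed.

(** Otherwise [xi <= 0] almost surely, criticality then forces [xi = 0] almost surely, and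
    [E exp xi] would be [1]. *)
Let Isq_gt0 : (0 < Isq)%E.
Proof.
rewrite lt_def integral_ge0 ?andbT; last by move=> w _; rewrite lee_fin.
apply/eqP => Isq0.
have sq0 := ae0 m_sq sq_ge0 Isq0.
have pos0 : {ae P, forall w, pos w = 0}.
  apply: filterS sq0 => w /eqP; rewrite /sq mulf_eq0 expf_eq0/=.
  rewrite (gt_eqF (expR_gt0 _)) orbF /pos => /eqP.
  case: (leP (xi w) 0) => [x0 _|x0 xw]; last by move: x0; rewrite xw ltxx.
  by apply/max_idPr; rewrite pmulr_lle0 ?expR_gt0.
have Ipos0 : Ipos = 0%E.
  rewrite /Ipos (ge0_ae_eq_integral (g := cst 0%E))//.
  - exact: integral0.
  - exact/measurable_EFinP.
  - by move=> w _; rewrite lee_fin.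
  - by apply: filterS pos0 => w -> _.
have neg0 : {ae P, forall w, neg w = 0} by apply: ae0 => //; rewrite -/Ineg -Ipos_eq.
have : (\int[P]_w (expR (xi w))%:E = \int[P]_w (cst 1%:E w))%E.
  apply: ge0_ae_eq_integral => //; first exact/measurable_EFinP.
  near=> w => _ /=; congr EFin.
  have p0 : pos w = 0 by near: w.
  have n0 : neg w = 0 by near: w.
  have : xi w * expR (xi w) = 0.
    apply/eqP; rewrite eq_le; apply/andP; split.
      by rewrite -p0 /pos le_max lexx.
    by rewrite -oppr_le0 -n0 /neg le_max lexx.
  by move=> /eqP; rewrite mulf_eq0 (gt_eqF (expR_gt0 _)) orbF => /eqP ->; rewrite expR0.
rewrite (integral_expR_xi xi_mean) integral_cst_probability => -[].
lra.
Unshelve. all: by end_near. Qed.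

(** The negative part is moved to the right so that every term is nonnegative and can be integrated
    separately. For [xi > 0] this is the square of [1 + t * xi / 2 <= exp (t * xi / 2)], whence the
    [1/4]; for [xi <= 0] the quadratic term vanishes. *)
Let exp_quad (t : R) w : 0 <= t ->
  expR (xi w) + t * pos w + t ^+ 2 / 4 * sq w <=
  expR ((1 + t) * xi w) + t * neg w.
Proof.
move=> t0.
have -> : pos w = xi w * expR (xi w) + neg w.
  rewrite /pos /neg; set u := xi w * _; rewrite /Num.max.
  by do 2 case: ifP; lra.
rewrite mulrDl mul1r expRD.
suff : 1 + t * xi w + t ^+ 2 / 4 * Num.max (xi w) 0 ^+ 2 <= expR (t * xi w).
  rewrite /sq => /(ler_wpM2l (expR_ge0 (xi w))); lra.
have [x0|x0] := leP (xi w) 0.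
  by rewrite expr0n mulr0 addr0 expR_ge1Dx.
have -> : t * xi w = t * xi w / 2 + t * xi w / 2 by lra.
have h : 1 + t * xi w / 2 <= expR (t * xi w / 2) by exact: expR_ge1Dx.
have tx0 : 0 <= t * xi w by rewrite mulr_ge0// ltW.
rewrite expRD; nra.
Qed.

Let lin2 (f g : Om -> R) (a : R) : 0 <= a ->
  measurable_fun setT f -> measurable_fun setT g ->
  (forall w, 0 <= f w) -> (forall w, 0 <= g w) ->
  (\int[P]_w (f w + a * g w)%:E = \int[P]_w (f w)%:E + a%:E * \int[P]_w (g w)%:E)%E.
Proof.
move=> a0 mf mg f0 g0; rewrite -ge0_integralZl//; last 2 first.
- exact/measurable_EFinP.
- by move=> w _; rewrite lee_fin.
rewrite -ge0_integralD//.
- by move=> w _; rewrite lee_fin.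
- exact/measurable_EFinP.
- by move=> w _; rewrite lee_fin mulr_ge0.
- by apply/measurable_EFinP; exact: measurable_funM.
Qed.

(** Integrating [exp_quad], the linear terms cancel by [Ipos_eq]. As [Isq] may be infinite, a finite
    positive lower bound of it is used. *)
Lemma kappa_quad : exists2 c : R, 0 < c &
  forall t, 0 <= t -> ((1 + c * t ^+ 2)%:E <= kappa xi t)%E.
Proof.
have [c c0 cI] : exists2 c : R, 0 < c & (c%:E <= Isq)%E.
  move: Isq_gt0; case: Isq => [r r0|_|//]; last by exists 1; rewrite ?leey.
  by exists r.
exists (c / 2) => [|t t0]; first by rewrite divr_gt0.
have : ((2^-1)%:E + t%:E * Ineg + (t ^+ 2 / 4)%:E * c%:E <=
        (2^-1)%:E * kappa xi t + t%:E * Ineg)%E.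
  apply: (@le_trans _ _ ((2^-1)%:E + t%:E * Ineg + (t ^+ 2 / 4)%:E * Isq)%E).
    by rewrite leeD2l// lee_wpmul2l// lee_fin divr_ge0// sqr_ge0.
  rewrite -{1}Ipos_eq -{1}(integral_expR_xi xi_mean) /kappa.
  have t4 : 0 <= t ^+ 2 / 4 by rewrite divr_ge0// sqr_ge0.
  have m1 : measurable_fun setT (fun w => 2 * expR ((1 + t) * xi w)).
    apply: measurable_funM => //; apply: measurableT_comp.
      exact: measurable_expR.
    exact: measurable_funM.
  rewrite /Ipos /Ineg /Isq.
  have e0 w : 0 <= expR (xi w) by exact: expR_ge0.
  have e2 w : 0 <= expR ((1 + t) * xi w) by exact: expR_ge0.
  rewrite -lin2// -lin2//; last 2 first.
  - by apply: measurable_funD => //; exact: measurable_funM.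
  - by move=> w; rewrite addr_ge0// mulr_ge0.
  have -> : ((2^-1)%:E * \int[P]_w (2 * expR ((1 + t) * xi w))%:E =
      \int[P]_w (expR ((1 + t) * xi w))%:E)%E.
    rewrite -ge0_integralZl//; last exact/measurable_EFinP.
    by apply: eq_integral => w _; rewrite -EFinM mulrA mulVf// mul1r.
  have m2 : measurable_fun setT (fun w => expR ((1 + t) * xi w)).
    apply: measurableT_comp; first exact: measurable_expR.
    exact: measurable_funM.
  rewrite -lin2//; apply: ge0_le_integral => //.
  - by move=> w _; rewrite lee_fin !addr_ge0// mulr_ge0.
  - by apply/measurable_EFinP; do ?[apply: measurable_funD => //]; exact: measurable_funM.
  - by apply/measurable_EFinP; do ?[apply: measurable_funD => //]; exact: measurable_funM.
  by move=> w _; rewrite lee_fin; exact: exp_quad.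
rewrite -(fineK Ineg_fin); case: (kappa xi t) (kappa_ge0 xi t) => [r r0|_ _|//].
  rewrite -!EFinM -!EFinD !lee_fin; lra.
by rewrite leey.
Qed.

(** The exponential at exponent [1 + h] is dominated by the sum of those at [1] and [1 + h0]. The
    bound [h <= 1] later gives [dl <= 1/2] for [dl = h / 2]. *)
Lemma kappa_fin : (exists2 h : R, 0 < h &
    ('E_P[(fun w => expR ((1 + h) * xi w))%R] < +oo)%E) ->
  exists2 h : R, 0 < h <= 1 & kappa xi h \is a fin_num.
Proof.
move=> [h0 h0_gt0 hfin].
exists (Num.min h0 1); first by rewrite lt_min h0_gt0 ltr01/= ge_min lexx orbT.
rewrite ge0_fin_numE ?kappa_ge0//.
have m1 t : measurable_fun setT (fun w => expR ((1 + t) * xi w)).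
  apply: measurableT_comp; [exact: measurable_expR|exact: measurable_funM].
apply: (@le_lt_trans _ _ (2%:E * (\int[P]_w (expR (xi w))%:E +
    \int[P]_w (expR ((1 + h0) * xi w))%:E))%E).
  rewrite -ge0_integralD//; [|exact/measurable_EFinP..].
  rewrite -ge0_integralZl//; last 2 first.
    by apply: emeasurable_funD; exact/measurable_EFinP.
    by move=> w _; rewrite -EFinD lee_fin addr_ge0// expR_ge0.
  apply: ge0_le_integral => //.
  - by apply/measurable_EFinP; exact: measurable_funM.
  - by apply: measurable_funeM; apply: emeasurable_funD; exact/measurable_EFinP.
  move=> w _; rewrite -EFinD -EFinM lee_fin ler_pM2l//.
  have [x0|x0] := leP (xi w) 0.
    rewrite ler_wpDr ?expR_ge0// ler_expR mulrDl mul1r gerDl.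
    by rewrite mulr_ge0_le0// le_min ltW//=.
  rewrite ler_wpDl ?expR_ge0// ler_expR ler_pM2r// lerD2l.
  by rewrite ge_min lexx.
rewrite (integral_expR_xi xi_mean); move: hfin; rewrite unlock.
have : (0 <= \int[P]_w (expR ((1 + h0) * xi w))%:E)%E.
  by apply: integral_ge0 => w _; rewrite lee_fin expR_ge0.
case: (\int[P]_w (expR ((1 + h0) * xi w))%:E)%E => [r _ _|//|//].
by rewrite -EFinD -EFinM ltry.
Qed.

End moments.

(** * Barriers and survival of the killed walk *)

Section barrier_estimates.
Context {d} {Om : measurableType d} {R : realType} (P : probability Om R).
Variable xi : {RV P >-> R}.
Hypothesis xi_mean : ('E_P[(fun w => expR (xi w))%R] = (2^-1)%:E)%E.
Variables (dl c kh : R).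
Hypothesis dl_gt0 : 0 < dl.
Hypothesis c_gt0 : 0 < c.
Hypothesis kappa_dl2 : kappa xi (2 * dl) = kh%:E.
Hypothesis kappa_ge : forall t, 0 <= t -> ((1 + c * t ^+ 2)%:E <= kappa xi t)%E.

Local Notation T := (kstep xi).

(** Half of the guaranteed excess: [kappa dl >= 1 + 2 * gain]. One half pays for the jumps below
    [0], the other remains as strict superharmonicity. *)
Definition gain := c * dl ^+ 2 / 2.

Lemma gain_gt0 : 0 < gain.
Proof. by rewrite /gain divr_gt0// mulr_gt0// exprn_gt0. Qed.

Lemma kh_ge1 : 1 <= kh.
Proof.
have := kappa_ge (t := 2 * dl); rewrite kappa_dl2 lee_fin => h.
apply: le_trans (h _); first by rewrite lerDl mulr_ge0 ?sqr_ge0// ltW.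
by rewrite mulr_ge0// ltW.
Qed.

Lemma step_expRN (t x : R) :
  step xi (fun y => (expR (- t * y))%:E) x = ((expR (- t * x))%:E * kappa xi t)%E.
Proof. by rewrite step_expR opprK. Qed.

Lemma expR_dl2 (y : R) : expR (- (2 * dl) * y) = expR (- dl * y) ^+ 2.
Proof. by rewrite -expRM_natl; congr expR; ring. Qed.

Lemma expR_dl_le1 (x : R) : 0 <= x -> expR (- dl * x) <= 1.
Proof.
move=> x0; rewrite -[leRHS]expR0 ler_expR mulNr oppr_le0.
by rewrite mulr_ge0// ltW.
Qed.

Lemma expR_dl2_le (x : R) : 0 <= x -> expR (- (2 * dl) * x) <= expR (- dl * x).
Proof.
move=> x0; rewrite expR_dl2 expr2 ler_piMl ?expR_ge0//.
exact: expR_dl_le1.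
Qed.

(** The quotient bounds the overshoot of the exponential below [0], up to a multiple of its square;
    the added [1] keeps [cap - expR (- dl * y)] nonnegative for [y >= 0]. *)
Definition cap := kh / gain + 1.

Lemma cap_ge1 : 1 <= cap.
Proof.
by rewrite /cap lerDr divr_ge0 ?(ltW gain_gt0)// (le_trans _ kh_ge1).
Qed.

Definition bar (y : R) := Num.max (cap - expR (- dl * y)) 0.

Lemma nnm_bar : nnm (fun y => (bar y)%:E).
Proof.
apply: nnm_EFin => [|x]; last by rewrite /bar le_max lexx orbT.
apply: measurable_maxr => //; apply: measurable_funB => //.
by apply: measurableT_comp; [exact: measurable_expR|exact: measurable_funM].
Qed.

Lemma barE x : 0 <= x -> bar x = cap - expR (- dl * x).
Proof.
move=> x0; rewrite /bar; apply/max_idPl; rewrite subr_ge0.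
exact: le_trans (expR_dl_le1 x0) cap_ge1.
Qed.

Lemma bar_le (x : R) : bar x <= cap.
Proof.
rewrite /bar ge_max gerBl expR_ge0/=; exact: le_trans cap_ge1.
Qed.

(* [exp (- dl y)] is subharmonic for the step with gain at least [2 * gain], so
   [cap - exp (- dl y)] is strictly superharmonic; [cap] is large enough to
   absorb the jumps below [0]. *)
Lemma bar_super x : 0 <= x ->
  (T (fun y => (bar y)%:E) x + (gain * expR (- dl * x))%:E <= (bar x)%:E)%E.
Proof.
move=> x0; have g0 := gain_gt0; have k1 := kh_ge1.
have eta0 : 0 <= gain / kh by rewrite divr_ge0 ?ltW// (lt_le_trans ltr01).
have : (step xi (fun y => kill (fun y => (bar y)%:E) y + (expR (- dl * y))%:E) x <=
  step xi (fun y => cap%:E + (gain / kh)%:E * (expR (- (2 * dl) * y))%:E) x)%E.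
  apply: le_step.
  - by apply: nnmD; [exact/nnm_kill/nnm_bar|exact: nnm_expR].
  - apply: nnmD; first exact/nnm_cst/(le_trans ler01 cap_ge1).
    by apply: nnmZ => //; exact: nnm_expR.
  move=> y; rewrite /kill; case: ifPn => y0.
    by rewrite barE// -EFinD -EFinM -EFinD lee_fin subrK lerDl mulr_ge0 ?expR_ge0.
  rewrite add0e -EFinM -EFinD lee_fin expR_dl2 /cap.
  set z := expR _.
  have -> : kh / gain = (gain / kh)^-1 by exact/esym/invf_div.
  set e := gain / kh; have e0 : 0 < e by rewrite divr_gt0// (lt_le_trans ltr01).
  (* Completing the square gives [z <= e^-1 + e * z ^+ 2], which is all that a position below [0]
     requires. *)
  have : 0 <= (e * z - 2^-1) ^+ 2 by exact: sqr_ge0.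
  have : e * e^-1 = 1 by rewrite mulfV// gt_eqF.
  move=> ee sq; rewrite -(ler_pM2l e0) !mulrDr ee; nra.
rewrite stepD; [|exact/nnm_kill/nnm_bar|exact: nnm_expR].
rewrite stepD; [|exact/nnm_cst/(le_trans ler01 cap_ge1)|]; last first.
  by apply: nnmZ => //; exact: nnm_expR.
rewrite step_expRN step_cst//; last exact: (le_trans ler01 cap_ge1).
rewrite stepZ//; last exact: nnm_expR.
rewrite step_expRN kappa_dl2 -/(kstep xi _ x) barE// => h.
have e0 := expR_ge0 (- dl * x).
have : (T (fun y => (bar y)%:E) x + (expR (- dl * x) * (1 + 2 * gain))%:E <=
    (cap + gain * expR (- dl * x))%:E)%E.
  apply: (le_trans (leeD2l _ _) (le_trans h _)).
    rewrite EFinM lee_wpmul2l ?lee_fin//.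
    apply: le_trans (kappa_ge (ltW dl_gt0)); rewrite lee_fin /gain.
    by rewrite mulrCA divff// mulr1.
  rewrite -!EFinM -EFinD lee_fin lerD2l.
  rewrite (_ : _ * (_ * kh) = gain * expR (- (2 * dl) * x)); last first.
    by field; rewrite gt_eqF// (lt_le_trans ltr01).
  by rewrite ler_wpM2l ?(ltW g0)//; exact: expR_dl2_le.
rewrite -leeBrDr// -EFinB => h2; rewrite -leeBrDr// -EFinB.
by apply: (le_trans h2); rewrite lee_fin; lra.
Qed.

Definition surv n : R -> \bar R := iter n T (fun=> 1%E).
(** Survival weighted by the final height: a smooth substitute for the probability of being alive
    and close to [0] at time [n]. *)
Definition green n : R -> \bar R := iter n T (fun y => (expR (- dl * y))%:E).

Lemma nnm_surv n : nnm (surv n).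
Proof. by apply: nnm_iter_kstep; exact: nnm_cst. Qed.

Lemma nnm_green n : nnm (green n).
Proof. by apply: nnm_iter_kstep; exact: nnm_expR. Qed.

Lemma surv_le1 n x : (surv n x <= 1)%E.
Proof.
elim: n x => [//|n IH] x; rewrite /surv iterS -/(surv n).
rewrite -(step_cst xi_mean x ler01); apply: le_step.
- exact/nnm_kill/nnm_surv.
- exact: nnm_cst.
- by move=> y; rewrite /kill; case: ifP.
Qed.

(** Iterating [bar_super] telescopes: each step spends [gain] times the current [green] out of the
    bounded potential [bar]. *)
Lemma sum_green_le n x : 0 <= x ->
  (\sum_(0 <= k < n) green k x <= (cap / gain)%:E)%E.
Proof.
move=> x0; have g0 := gain_gt0.
have : (iter n T (fun y => (bar y)%:E) x + gain%:E * \sum_(0 <= k < n) green k x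
   <= (bar x)%:E)%E.
  elim: n => [|n IH]; first by rewrite big_nil mule0 adde0.
  apply: le_trans IH; rewrite big_nat_recr//= ge0_muleDr//; last 2 first.
  - by apply: sume_ge0 => k _; have [_] := nnm_green k.
  - by have [_] := nnm_green n.
  rewrite addeCA addeC leeD2r//.
  rewrite -iter_kstepZ//; [|exact: ltW|exact: nnm_expR].
  rewrite -iterS iterSr -iter_kstepD; last 2 first.
  - exact/nnm_kstep/nnm_bar.
  - by apply: nnmZ; [exact: ltW|exact: nnm_expR].
  apply: le_iter_kstep => //.
  - apply: nnmD; first exact/nnm_kstep/nnm_bar.
    by apply: nnmZ; [exact: ltW|exact: nnm_expR].
  - exact: nnm_bar.
  - by move=> y y0; rewrite -EFinM; exact: bar_super.
move=> h; rewrite -(@lee_pmul2l _ gain%:E)//.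
rewrite -EFinM mulrCA divff ?gt_eqF// mulr1.
apply: le_trans (le_trans h _); last by rewrite lee_fin bar_le.
by rewrite leeDr//; have [_] := nnm_iter_kstep xi n nnm_bar.
Qed.

(** Markov property at time [j]: only surviving walks contribute afterwards, and each contributes at
    most the bound of [sum_green_le]. *)
Lemma sum_green_shift_le j n x : 0 <= x ->
  (\sum_(0 <= k < n) green (j + k) x <= (cap / gain)%:E * surv j x)%E.
Proof.
move=> x0; have g0 := gain_gt0.
have B0 : 0 <= cap / gain by rewrite divr_ge0 ?ltW// (lt_le_trans ltr01 cap_ge1).
have -> : (\sum_(0 <= k < n) green (j + k) x =
  iter j T (fun y => \sum_(0 <= k < n) green k y) x)%E.
  rewrite iter_kstep_sum; last by move=> i; exact: nnm_green.
  by apply: eq_bigr => i _; rewrite /green iterD.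
rewrite /surv -iter_kstepZ//.
apply: le_iter_kstep => //.
- by apply: nnm_sum => i; exact: nnm_green.
- by apply: nnmZ => //; exact: nnm_cst.
- by move=> y y0; rewrite mule1; exact: sum_green_le.
Qed.

End barrier_estimates.

(** * Summation inequalities for the time average *)

Section real_sums.
Variable R : realType.
Implicit Types f g h q : nat -> R.

Lemma sum_inv_sqrt n : \sum_(0 <= j < n) (Num.sqrt j.+1%:R)^-1 <= 2 * Num.sqrt n%:R :> R.
Proof.
elim: n => [|n IH]; first by rewrite big_nil sqrtr0 mulr0.
rewrite big_nat_recr//=; apply: le_trans (lerD IH (lexx _)) _.
have s1 : 0 < Num.sqrt n.+1%:R :> R by rewrite sqrtr_gt0.
have s0 : 0 <= Num.sqrt n%:R :> R by exact: sqrtr_ge0.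
have e1 : Num.sqrt n.+1%:R ^+ 2 = n%:R + 1 :> R by rewrite sqr_sqrtr// natr1.
have e0 : Num.sqrt n%:R ^+ 2 = n%:R :> R by rewrite sqr_sqrtr.
rewrite -(ler_pM2l s1) mulrDr mulfV ?gt_eqF//; nra.
Qed.

(** A fourth root replaces the logarithm to keep the estimates algebraic; for sums up to [K ^ 4] it
    is simply [K]. *)
Lemma sum_inv_le n : \sum_(0 <= j < n) j.+1%:R^-1 <= 4 * Num.sqrt (Num.sqrt n%:R) :> R.
Proof.
elim: n => [|n IH]; first by rewrite big_nil !sqrtr0 mulr0.
rewrite big_nat_recr//=; apply: le_trans (lerD IH (lexx _)) _.
set b := Num.sqrt (Num.sqrt n.+1%:R); set a := Num.sqrt (Num.sqrt n%:R).
have b0 : 0 < b by rewrite !sqrtr_gt0.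
have a0 : 0 <= a by exact: sqrtr_ge0.
have b4 : b ^+ 4 = n%:R + 1.
  by rewrite (exprM b 2 2) sqr_sqrtr ?sqrtr_ge0// sqr_sqrtr// natr1.
have a4 : a ^+ 4 = n%:R.
  by rewrite (exprM a 2 2) sqr_sqrtr ?sqrtr_ge0// sqr_sqrtr.
have ab : a <= b by rewrite ler_wsqrtr// ler_wsqrtr// ler_nat.
have b1 : 1 <= b.
  rewrite leNgt; apply/negP => b1.
  have : b ^+ 4 < 1 by rewrite exprn_ilt1// ltW.
  by rewrite b4 gtrDr ltNge ler0n.
have -> : n.+1%:R = b ^+ 4 by rewrite b4 natr1.
have key : 1 <= (b - a) * (4 * b ^+ 3).
  rewrite [leLHS](_ : 1 = (b - a) * (b ^+ 3 + b ^+ 2 * a + b * a ^+ 2 + a ^+ 3)); last first.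
    have -> : 1 = b ^+ 4 - a ^+ 4 by rewrite b4 a4 addrAC subrr add0r.
    ring.
  rewrite ler_wpM2l ?subr_ge0//.
  have h1 : b ^+ 2 * a <= b ^+ 2 * b by rewrite ler_wpM2l ?sqr_ge0.
  have h2 : b * a ^+ 2 <= b * b ^+ 2 by rewrite ler_wpM2l ?(ltW b0)// lerXn2r ?nnegrE ?(ltW b0).
  have h3 : a ^+ 3 <= b ^+ 3 by rewrite lerXn2r ?nnegrE ?(ltW b0).
  have e1 : b ^+ 2 * b = b ^+ 3 by rewrite -exprSr.
  have e2 : b * b ^+ 2 = b ^+ 3 by rewrite -exprS.
  lra.
rewrite -lerBrDl -mulrBr -[X in X <= _]mul1r ler_pdivrMr ?exprn_gt0//.
rewrite (_ : 4 * (b - a) * b ^+ 4 = ((b - a) * (4 * b ^+ 3)) * b); last by ring.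
apply: (le_trans key); rewrite ler_peMr//; exact: le_trans ler01 key.
Qed.

Lemma sum_cauchy f h n :
  \sum_(0 <= m < n) \sum_(0 <= k < m.+1) f (m - k)%N * h k =
  \sum_(0 <= k < n) h k * \sum_(0 <= i < n - k) f i.
Proof.
elim: n => [|n IH]; first by rewrite !big_nil.
rewrite big_nat_recr//= IH.
under [RHS]eq_big_nat => k /andP[_ kn].
  rewrite subSn// big_nat_recr//= mulrDr (mulrC _ (f _)).
  over.
rewrite big_split/= [X in _ = X + _]big_nat_recr//= subnn.
by rewrite (big_geq (leqnn 0)) mulr0 addr0.
Qed.

Lemma sum_layers g n :
  \sum_(0 <= j < n) \sum_(0 <= i < n - j) g (j + i)%N =
  \sum_(0 <= k < n) k.+1%:R * g k.
Proof.
elim: n => [|n IH]; first by rewrite !big_nil.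
rewrite [RHS]big_nat_recr//= -IH.
under eq_big_nat => j /andP[_ jn].
  rewrite subSn// big_nat_recr//= subnKC//.
  over.
rewrite big_split/= [X in X + _ = _]big_nat_recr//= subnn.
rewrite [X in _ + X + _](big_geq (leqnn 0)) addr0; congr (_ + _).
by rewrite big_const_nat subn0 iter_addr addr0 mulr_natl.
Qed.

(** In [n + m = (m - k).+1 - 1 + (n + k)] the first term cancels the weight and leaves the main term
    [G * K ^ 4]. In the last one the weights sum to at most [4 * K], and the sum of [k * g k] is at
    most a sum of tails of [g], each controlled by [q]. Thus [A] enters only at order [K ^ 3]. *)
Lemma sum_conv_le g q (G A : R) (n K : nat) : 0 <= G -> 0 <= A ->
  (forall k, 0 <= g k) -> (forall j, q j <= A / Num.sqrt j.+1%:R) -> q 0 <= 1 ->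
  (forall j m, \sum_(0 <= k < m) g (j + k)%N <= G * q j) ->
  \sum_(0 <= m < K ^ 4) (n + m)%:R * \sum_(0 <= k < m.+1) (m - k).+1%:R^-1 * g k
  <= G * (K%:R ^+ 4 + 4 * K%:R * (n%:R + 2 * A * K%:R ^+ 2)).
Proof.
move=> G0 A0 g0 qA q1 gq; set M := (K ^ 4)%N.
have MK : Num.sqrt (M%:R : R) = K%:R ^+ 2.
  by rewrite /M natrX (exprM _ 2 2) sqrtr_sqr ger0_norm// exprn_ge0.
have MKK : Num.sqrt (Num.sqrt (M%:R : R)) = K%:R.
  by rewrite MK sqrtr_sqr ger0_norm.
have gG m : \sum_(0 <= k < m) g k <= G.
  by have := gq 0 m; move=> /le_trans; apply; rewrite ler_piMr.
have step1 m k : (k < m.+1)%N ->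
    (n + m)%:R * ((m - k).+1%:R^-1 * g k) <=
    g k + (m - k).+1%:R^-1 * ((n + k)%:R * g k).
  move=> km; have d0 : 0 < (m - k).+1%:R :> R by rewrite ltr0n.
  have -> : (n + m)%:R = (m - k).+1%:R - 1 + (n + k)%:R :> R.
    rewrite -natr1 addrK -natrD; congr (_%:R).
    by rewrite addnCA subnK.
  rewrite mulrDl mulrCA [X in _ + X]mulrCA; apply: lerD => //.
  rewrite mulrA ler_piMl// mulrBr mulVf ?gt_eqF// mulr1 gerBl.
apply: (@le_trans _ _ (\sum_(0 <= m < M) (\sum_(0 <= k < m.+1) g k +
   \sum_(0 <= k < m.+1) (m - k).+1%:R^-1 * ((n + k)%:R * g k)))).
  apply: ler_sum_nat => m _; rewrite mulr_sumr -big_split/=.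
  by apply: ler_sum_nat => k /andP[_ km]; exact: step1.
rewrite big_split/= mulrDr; apply: lerD.
  apply: (@le_trans _ _ (\sum_(0 <= m < M) G)).
    by apply: ler_sum_nat => m _; exact: gG.
  by rewrite big_const_nat subn0 iter_addr addr0 -[G *+ _]mulr_natr /M natrX.
rewrite (sum_cauchy (fun i => i.+1%:R^-1) (fun k => (n + k)%:R * g k)).
apply: (@le_trans _ _ (\sum_(0 <= k < M) ((n + k)%:R * g k) * (4 * K%:R))).
  apply: ler_sum_nat => k _; rewrite ler_wpM2l ?mulr_ge0//.
  apply: le_trans (sum_inv_le _) _; rewrite ler_wpM2l// -MKK.
  by rewrite ler_wsqrtr// ler_wsqrtr// ler_nat leq_subr.
rewrite -mulr_suml [leRHS](_ : _ =
  (n%:R * G + G * (2 * A * K%:R ^+ 2)) * (4 * K%:R)); last by ring.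
rewrite ler_wpM2r ?mulr_ge0//.
under eq_bigr do rewrite natrD mulrDl.
rewrite big_split/= -mulr_sumr; apply: lerD; first by rewrite ler_wpM2l.
apply: (@le_trans _ _ (\sum_(0 <= k < M) k.+1%:R * g k)).
  by apply: ler_sum_nat => k _; rewrite ler_wpM2r// ler_nat.
rewrite -sum_layers; apply: (@le_trans _ _ (\sum_(0 <= j < M) G * (A / Num.sqrt j.+1%:R))).
  apply: ler_sum_nat => j _; apply: le_trans (gq _ _) _.
  by rewrite ler_wpM2l.
rewrite -mulr_sumr ler_wpM2l// -mulr_sumr [leRHS]mulrAC mulrC ler_wpM2r//.
by rewrite -MK sum_inv_sqrt.
Qed.

End real_sums.

(** * Square-root decay of the survival probability *)

Section survival.
Context {d} {Om : measurableType d} {R : realType} (P : probability Om R).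
Variable xi : {RV P >-> R}.
Hypothesis xi_mean : ('E_P[(fun w => expR (xi w))%R] = (2^-1)%:E)%E.
Variables (dl c kh : R).
Hypothesis dl_gt0 : 0 < dl.
Hypothesis c_gt0 : 0 < c.
Hypothesis kappa_dl2 : kappa xi (2 * dl) = kh%:E.
Hypothesis kappa_ge : forall t, 0 <= t -> ((1 + c * t ^+ 2)%:E <= kappa xi t)%E.

Local Notation T := (kstep xi).
Local Notation gain := (gain dl c).
Local Notation cap := (cap dl c kh).
Local Notation bar := (bar dl c kh).
Local Notation surv := (surv xi).

Let gain0 : 0 < gain. Proof. exact: gain_gt0. Qed.
Let kh1 : 1 <= kh. Proof. exact: (kh_ge1 dl_gt0 c_gt0 kappa_dl2). Qed.
Let cap1 : 1 <= cap. Proof. exact: (cap_ge1 dl_gt0 c_gt0 kappa_dl2). Qed.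
Let cap0 : 0 <= cap. Proof. exact: le_trans cap1. Qed.
Let kh0 : 0 <= kh. Proof. exact: le_trans kh1. Qed.

Section fixed_rate.
Variable th : R.
Hypothesis th_gt0 : 0 < th.
Hypothesis th_le : th <= dl.

(** Chosen so that [th * slope * gain = th / dl * kh]: the gain of [bar] cancels the overshoot term
    of [hat_super]. *)
Let slope := kh / (dl * gain).
Let al := (1 + c * th ^+ 2)^-1.
(** A bounded version of [th * y], linear functions being harmonic for a centred walk. *)
Let hat (y : R) := Num.max (1 - expR (- th * y)) 0.
Let super y := hat y + th * slope * bar y.

Let al_gt0 : 0 < al.
Proof. by rewrite invr_gt0 ltr_pwDl// mulr_ge0 ?sqr_ge0// ltW. Qed.

Let al_le1 : al <= 1.
Proof. by rewrite invf_le1 ?lerDl ?ltr_pwDl// mulr_ge0 ?sqr_ge0// ltW. Qed.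

Let slope0 : 0 <= slope.
Proof. by rewrite /slope divr_ge0// mulr_ge0// ltW. Qed.

Let nnm_hat : nnm (fun y => (hat y)%:E).
Proof.
apply: nnm_EFin => [|x]; last by rewrite /hat le_max lexx orbT.
apply: measurable_maxr => //; apply: measurable_funB => //.
by apply: measurableT_comp; [exact: measurable_expR|exact: measurable_funM].
Qed.

Let hatE x : 0 <= x -> hat x = 1 - expR (- th * x).
Proof.
move=> x0; rewrite /hat; apply/max_idPl; rewrite subr_ge0 -[leRHS]expR0 ler_expR.
by rewrite mulNr oppr_le0 mulr_ge0// ltW.
Qed.

Let nnm_super : nnm (fun y => (super y)%:E).
Proof.
have -> : (fun y => (super y)%:E) = (fun y => (hat y)%:E + (th * slope)%:E * (bar y)%:E)%E.
  by apply/funext => y; rewrite -EFinM -EFinD.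
by apply: nnmD => //; apply: nnmZ; [rewrite mulr_ge0// ltW|exact: nnm_bar].
Qed.

(* A jump below [0] is overestimated by at most [th / dl * exp (- 2 dl y)]. *)
Let expR_neg_le y : y < 0 -> expR (- th * y) <= 1 + th / dl * expR (- (2 * dl) * y).
Proof.
move=> y0; have u0 : 0 < - y by rewrite oppr_gt0.
have h1 : 1 - th * (- y) <= expR (- (th * (- y))).
  by apply: le_trans (expR_ge1Dx _).
have -> : expR (- th * y) = (expR (- (th * (- y))))^-1.
  by rewrite -expRN opprK mulNr mulrN.
have e0 := expR_gt0 (- (th * (- y))).
set a := expR _ in h1 e0 *.
have h2 : a^-1 <= expR (- dl * y).
  by rewrite /a -expRN opprK ler_expR mulNr -mulrN ler_wpM2r// ltW.
have h3 : dl * (- y) <= expR (- dl * y).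
  by rewrite mulrN -mulNr; apply: le_trans (expR_ge1Dx _); rewrite lerDr.
rewrite (expR_dl2 dl); set z := expR (- dl * y) in h2 h3 *.
have z0 : 0 < z by exact: expR_gt0.
have h4 : a^-1 - 1 <= th * - y * a^-1.
  have aa : a^-1 * a = 1 by rewrite mulVf// gt_eqF.
  rewrite -(ler_pM2r e0).
  have -> : (a^-1 - 1) * a = 1 - a by rewrite mulrBl aa mul1r.
  have -> : th * - y * a^-1 * a = th * - y by rewrite -mulrA aa mulr1.
  lra.
rewrite -lerBlDl; apply: (le_trans h4).
have h5 : th * - y * a^-1 <= th * (- y) * z.
  by rewrite ler_wpM2l// mulr_ge0// ltW.
apply: (le_trans h5).
rewrite -(ler_pM2l dl_gt0) (_ : dl * (th / dl * z ^+ 2) = th * z ^+ 2); last first.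
  by field; rewrite gt_eqF.
have -> : dl * (th * - y * z) = th * z * (dl * - y) by ring.
by rewrite expr2 (mulrA th z z) ler_wpM2l// mulr_ge0// ltW.
Qed.

Let hat_super x : 0 <= x ->
  (T (fun y => (hat y)%:E) x + ((1 + c * th ^+ 2) * expR (- th * x))%:E <=
   (1 + th / dl * kh * expR (- dl * x))%:E)%E.
Proof.
move=> x0; have q0 : 0 <= th / dl by rewrite divr_ge0// ltW.
have : (step xi (fun y => kill (fun y => (hat y)%:E) y + (expR (- th * y))%:E) x <=
  step xi (fun y => 1%:E + (th / dl)%:E * (expR (- (2 * dl) * y))%:E) x)%E.
  apply: le_step.
  - by apply: nnmD; [exact/nnm_kill|exact: nnm_expR].
  - by apply: nnmD; [exact: nnm_cst|apply: nnmZ => //; exact: nnm_expR].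
  move=> y; rewrite /kill; case: ifPn => y0.
    by rewrite hatE// -EFinD -EFinM -EFinD lee_fin subrK lerDl mulr_ge0 ?expR_ge0.
  rewrite add0e -EFinM -EFinD lee_fin; apply: expR_neg_le.
  by rewrite ltNge.
rewrite stepD; [|exact/nnm_kill|exact: nnm_expR].
rewrite stepD; [|exact: nnm_cst|by apply: nnmZ => //; exact: nnm_expR].
rewrite step_expRN step_cst// stepZ//; last exact: nnm_expR.
rewrite step_expRN kappa_dl2 -/(kstep xi _ x) => h.
apply: (le_trans (leeD2l _ _) (le_trans h _)).
  by rewrite mulrC EFinM lee_wpmul2l ?lee_fin ?expR_ge0 ?kappa_ge// ltW.
rewrite -!EFinM -EFinD lee_fin lerD2l -mulrA ler_wpM2l// mulrC ler_wpM2l//.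
exact: expR_dl2_le.
Qed.

(** This makes [super] dominate the probability of surviving up to an independent geometric time
    whose continuation probability is [al]. *)
Let super_super x : 0 <= x ->
  ((1 - al)%:E + al%:E * T (fun y => (super y)%:E) x <= (super x)%:E)%E.
Proof.
move=> x0.
have ts0 : 0 <= th * slope by rewrite mulr_ge0// ltW.
have -> : T (fun y => (super y)%:E) x =
    (T (fun y => (hat y)%:E) x + (th * slope)%:E * T (fun y => (bar y)%:E) x)%E.
  rewrite -kstepZ//; last exact: nnm_bar.
  rewrite -kstepD//; last by apply: nnmZ => //; exact: nnm_bar.
have h1 := hat_super x0.
have h2 := bar_super xi_mean dl_gt0 c_gt0 kappa_dl2 kappa_ge x0.
move: h1; rewrite -leeBrDr// -EFinB => h1.
move: h2; rewrite -leeBrDr// -EFinB => h2.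
have ts0' : (0 <= (th * slope)%:E)%E by rewrite lee_fin.
have := leeD h1 (lee_wpmul2l ts0' h2); rewrite -EFinM -EFinD => h3.
have al0' : (0 <= al%:E)%E by rewrite lee_fin ltW.
apply: (le_trans (leeD2l _ (lee_wpmul2l al0' h3))).
rewrite -EFinM -EFinD lee_fin /super hatE//.
set e := expR (- dl * x); set f := expR (- th * x).
have e0 : 0 < e := expR_gt0 _.
have b0 : 0 <= bar x by have [_] := nnm_bar dl c kh; move/(_ x); rewrite lee_fin.
have E1 : th * slope * (gain * e) = th / dl * kh * e.
  by rewrite /slope; field; rewrite !gt_eqF.
have E2 : al * (1 + c * th ^+ 2) = 1.
  by rewrite mulVf// gt_eqF// ltr_pwDl// mulr_ge0 ?sqr_ge0// ltW.
have -> : al * (1 + th / dl * kh * e - (1 + c * th ^+ 2) * f +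
    th * slope * (bar x - gain * e)) =
    al - al * (1 + c * th ^+ 2) * f + al * (th * slope * bar x).
  by rewrite [_ * (bar x - _)]mulrBr E1; ring.
rewrite E2 mul1r.
have : al * (th * slope * bar x) <= th * slope * bar x.
  by apply: ler_piMl => //; exact: mulr_ge0.
lra.
Qed.

(** The geometric time is at most [n] with probability [1 - al ^+ n.+1], and survival up to it is
    then implied by survival up to [n]. *)
Let al_surv n x : 0 <= x -> ((1 - al ^+ n.+1)%:E * surv n x <= (super x)%:E)%E.
Proof.
have al1 k : 0 <= 1 - al ^+ k by rewrite subr_ge0 exprn_ile1// ltW.
have Tsuper0 y : (0 <= al%:E * T (fun y => (super y)%:E) y)%E.
  apply: mule_ge0; first by rewrite lee_fin ltW.
  by have [_ h] := nnm_kstep xi nnm_super; exact: h.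
elim: n x => [|n IH] x x0.
  have -> : surv 0%N x = 1%E by [].
  apply: le_trans (super_super x0). by rewrite mule1 expr1 leeDl.
have -> : 1 - al ^+ n.+2 = (1 - al) + al * (1 - al ^+ n.+1).
  by rewrite [al ^+ n.+2]exprS; ring.
have s0 : (0 <= surv n.+1 x)%E by have [_] := nnm_surv xi n.+1.
apply: le_trans (super_super x0).
rewrite EFinD ge0_muleDl ?lee_fin ?subr_ge0//; last first.
  by rewrite mulr_ge0// ltW.
apply: leeD.
  by rewrite -[leRHS]mule1 lee_wpmul2l ?lee_fin ?subr_ge0// surv_le1.
rewrite EFinM -muleA lee_wpmul2l ?lee_fin//; first exact: ltW.
rewrite /surv iterS -/(surv n) -kstepZ//; last exact: nnm_surv.
apply: le_kstep => //.
by apply: nnmZ => //; exact: nnm_surv.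
Qed.

Lemma surv_rate n x : 0 <= x ->
  ((1 - ((1 + c * th ^+ 2)^-1) ^+ n.+1)%:E * surv n x <=
   (th * (x + kh / (dl * gain) * cap))%:E)%E.
Proof.
move=> x0; apply: le_trans (al_surv n x0) _; rewrite lee_fin /super mulrDr.
apply: lerD; last first.
  rewrite mulrA; apply: ler_wpM2l; last exact: bar_le dl_gt0 c_gt0 kappa_dl2 kappa_ge _.
  by apply: mulr_ge0; [exact: ltW|exact: slope0].
rewrite hatE//; have := expR_ge1Dx (- th * x); lra.
Qed.

End fixed_rate.

(** [surv_rate] is used with [th = dl / sqrt n.+1]: by Bernoulli's inequality the factor in front of
    [surv n x] then stays above the constant [p], while the right-hand side is of order
    [(1 + x) / sqrt n.+1]. *)
Lemma surv_le : exists2 C : R, 0 < C & forall n x, 0 <= x ->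
  (surv n x <= (C * (1 + x) / Num.sqrt n.+1%:R)%:E)%E.
Proof.
pose u := c * dl ^+ 2; have u0 : 0 < u by rewrite mulr_gt0// exprn_gt0.
pose p := 1 - (1 + u)^-1.
have p0 : 0 < p by rewrite subr_gt0 invf_lt1 ?ltrDl// addr_gt0.
pose D := 1 + kh / (dl * gain) * cap.
have D1 : 1 <= D by rewrite lerDl mulr_ge0// divr_ge0// mulr_ge0// ltW.
exists (dl / p * D) => [|n x x0]; first by rewrite mulr_gt0 ?divr_gt0// (lt_le_trans ltr01).
set s := Num.sqrt n.+1%:R; have s0 : 0 < s by rewrite sqrtr_gt0.
have s1 : 1 <= s by rewrite -[leLHS]sqrtr1 ler_wsqrtr// ler1n.
have s2 : s ^+ 2 = n.+1%:R by rewrite sqr_sqrtr.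
have th0 : 0 < dl / s by rewrite divr_gt0.
have thl : dl / s <= dl by rewrite ler_pdivrMr// ler_peMr// ltW.
have := surv_rate th0 thl n x0.
have bern : 1 + u <= (1 + c * (dl / s) ^+ 2) ^+ n.+1.
  have v0 : 0 <= c * (dl / s) ^+ 2 by rewrite mulr_ge0 ?sqr_ge0// ltW.
  set v := c * (dl / s) ^+ 2 in v0 *.
  have nv : n.+1%:R * v = u.
    by rewrite -s2 /v /u expr_div_n; field; rewrite gt_eqF.
  rewrite -nv; elim: n.+1 => [|m IH]; first by rewrite mul0r addr0 expr0.
  rewrite exprS -natr1; have : 0 <= m%:R * v by rewrite mulr_ge0.
  move: IH; set z := (1 + v) ^+ m; set t := m%:R => IH tv; nra.
have pS : p <= 1 - ((1 + c * (dl / s) ^+ 2)^-1) ^+ n.+1.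
  rewrite /p lerD2l lerN2 exprVn lef_pV2// ?posrE ?addr_gt0//.
  by apply: lt_le_trans bern; rewrite addr_gt0.
have sv0 : (0 <= surv n x)%E by have [_] := nnm_surv xi n.
move=> h; rewrite -(@lee_pmul2l _ p%:E)//.
apply: le_trans (lee_wpmul2r sv0 _) (le_trans h _); first by rewrite lee_fin.
rewrite -EFinM lee_fin.
rewrite (_ : p * _ = dl / s * (D * (1 + x))); last first.
  by field; rewrite !gt_eqF.
rewrite ler_wpM2l ?(ltW th0)// /D mulrDl mul1r.
set q := kh / _ * _.
have q0 : 0 <= q by rewrite mulr_ge0// divr_ge0// mulr_ge0// ltW.
nra.
Qed.

End survival.

(** * Averaging over the number of generations *)

Section time_average.
Context {d} {Om : measurableType d} {R : realType} (P : probability Om R).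
Variable xi : {RV P >-> R}.
Hypothesis xi_mean : ('E_P[(fun w => expR (xi w))%R] = (2^-1)%:E)%E.
Variables (dl c kh : R).
Hypothesis dl_gt0 : 0 < dl.
Hypothesis c_gt0 : 0 < c.
Hypothesis kappa_dl2 : kappa xi (2 * dl) = kh%:E.
Hypothesis kappa_ge : forall t, 0 <= t -> ((1 + c * t ^+ 2)%:E <= kappa xi t)%E.

Local Notation T := (kstep xi).
Local Notation gain := (gain dl c).
Local Notation cap := (cap dl c kh).
Local Notation surv := (surv xi).
Local Notation green := (green xi dl).

Let gain0 : 0 < gain. Proof. exact: gain_gt0. Qed.
Let kh1 : 1 <= kh. Proof. exact: (kh_ge1 dl_gt0 c_gt0 kappa_dl2). Qed.
Let cap1 : 1 <= cap. Proof. exact: (cap_ge1 dl_gt0 c_gt0 kappa_dl2). Qed.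
Let cap0 : 0 <= cap. Proof. exact: le_trans cap1. Qed.

(** The second moment recursion has a source of order [expR (- dl * x)] over the number of
    generations, the square of a first moment decaying like its inverse square root. [conv]
    accumulates these sources along the killed walk. *)
Definition conv m x : \bar R :=
  (\sum_(0 <= k < m.+1) (((m - k).+1%:R)^-1)%:E * green k x)%E.

Lemma nnm_conv m : nnm (conv m).
Proof.
apply: nnm_sum => k; apply: nnmZ; last exact: nnm_green.
by rewrite invr_ge0.
Qed.

Lemma green_fin k x : 0 <= x -> green k x = (fine (green k x))%:E.
Proof.
move=> x0; rewrite fineK// ge0_fin_numE; last by have [_] := nnm_green xi dl k.
apply: le_lt_trans (ltry (cap / gain)).
have := sum_green_le xi_mean dl_gt0 c_gt0 kappa_dl2 kappa_ge k.+1 x0.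
rewrite big_nat_recr//=; apply: le_trans.
by rewrite leeDr// sume_ge0// => i _; have [_] := nnm_green xi dl i.
Qed.

Lemma surv_fin k x : surv k x = (fine (surv k x))%:E.
Proof.
rewrite fineK// ge0_fin_numE; last by have [_] := nnm_surv xi k.
by apply: le_lt_trans (ltry 1); exact: surv_le1.
Qed.

Lemma conv_sum : exists2 C : R, 0 < C & forall K n x, 0 <= x ->
  (\sum_(0 <= m < K ^ 4) (n + m)%:R%:E * conv m x <=
   (C * (K%:R ^+ 4 + K%:R * n%:R + K%:R ^+ 3 * expR x))%:E)%E.
Proof.
have [C C0 HC] := surv_le xi_mean dl_gt0 c_gt0 kappa_dl2 kappa_ge.
have G0 : 0 <= cap / gain by rewrite divr_ge0// ltW.
exists (cap / gain * (4 + 8 * C)) => [|K n x x0].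
  apply: mulr_gt0; last by rewrite addr_gt0// mulr_gt0.
  by rewrite divr_gt0// (lt_le_trans ltr01).
pose g k := fine (green k x); pose q k := fine (surv k x).
have -> : (\sum_(0 <= m < K ^ 4) (n + m)%:R%:E * conv m x)%E =
   (\sum_(0 <= m < K ^ 4) (n + m)%:R *
     \sum_(0 <= k < m.+1) (m - k).+1%:R^-1 * g k)%:E.
  rewrite -sumEFin; apply: eq_bigr => m _; rewrite EFinM; congr (_ * _)%E.
  by rewrite -sumEFin; apply: eq_bigr => k _; rewrite green_fin.
rewrite lee_fin.
apply: le_trans (@sum_conv_le _ g q (cap / gain) (C * (1 + x)) n K _ _ _ _ _ _) _.
- by [].
- by rewrite mulr_ge0 ?(ltW C0)// addr_ge0.
- by move=> k; rewrite /g fine_ge0//; have [_] := nnm_green xi dl k.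
- by move=> j; rewrite -lee_fin /q -surv_fin; exact: HC.
- by rewrite -lee_fin /q -surv_fin; exact: surv_le1.
- move=> j m; rewrite -lee_fin EFinM /q -surv_fin.
  apply: le_trans (sum_green_shift_le xi_mean dl_gt0 c_gt0 kappa_dl2 kappa_ge j m x0).
  by rewrite -sumEFin lee_sum// => k _; rewrite [leRHS]green_fin.
rewrite -[leRHS]mulrA ler_wpM2l//.
have K0 : 0 <= K%:R :> R by [].
have n0 : 0 <= n%:R :> R by [].
have K3 : 0 <= K%:R ^+ 3 :> R by rewrite exprn_ge0.
have K4 : 0 <= K%:R ^+ 4 :> R by rewrite exprn_ge0.
have Kn : 0 <= K%:R * n%:R :> R by rewrite mulr_ge0.
have xe : K%:R ^+ 3 * (1 + x) <= K%:R ^+ 3 * expR x.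
  by rewrite ler_wpM2l// expR_ge1Dx.
have xe0 : 0 <= K%:R ^+ 3 * (1 + x) by rewrite mulr_ge0// addr_ge0.
rewrite (_ : 4 * K%:R * _ = 4 * (K%:R * n%:R) + 8 * C * (K%:R ^+ 3 * (1 + x))); last by ring.
move: xe xe0 K4 Kn; set a := _ ^+ 4; set b := _ * n%:R; set u := _ * (1 + x).
set v := _ * expR x => uv u0 a0 b0.
have : C * u <= C * v by rewrite ler_wpM2l// ltW.
have : 0 <= C * a by rewrite mulr_ge0// ltW.
have : 0 <= C * b by rewrite mulr_ge0// ltW.
lra.
Qed.

(** This serves the term [K ^ 3 * expR x] of [conv_sum]. The growth [2 ^+ n] is harmless because [n]
    is fixed while [K] tends to infinity. *)
Lemma iter_kstep_expR n a :
  (iter n T (fun y => (expR y)%:E) a <= (2 ^+ n * expR a)%:E)%E.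
Proof.
have E : (fun y : R => (expR y)%:E) = (fun y => (expR (1 * y))%:E).
  by apply/funext => y; rewrite mul1r.
have nE : nnm (fun y : R => (expR y)%:E) by rewrite E; exact: nnm_expR.
elim: n a => [|n IH] a; first by rewrite expr0 mul1r.
rewrite iterS; apply: (@le_trans _ _ (step xi (fun y => (2 ^+ n)%:E * (expR y)%:E) a)%E).
  apply: le_step.
  - exact/nnm_kill/nnm_iter_kstep.
  - by apply: nnmZ => //; exact: exprn_ge0.
  move=> y; rewrite /kill; case: ifP => _; last by rewrite -EFinM lee_fin mulr_ge0 ?expR_ge0.
  by rewrite -EFinM.
rewrite stepZ//.
rewrite E step_expR; have -> : kappa xi (- 1) = 2%:E.
  rewrite /kappa; under eq_integral do rewrite subrr mul0r expR0 mulr1.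
  exact: integral_cst_probability.
by rewrite -!EFinM lee_fin mul1r exprSr; lra.
Qed.

(** With heights raised by [s], the walk is killed only where the original height is below [- s],
    hence where truncated moments are below [expR (- s)], whereas [f] is still used only at
    nonnegative original heights. *)
Definition shift s (f : R -> \bar R) y := kill f (y - s).

Lemma nnm_shift s f : nnm f -> nnm (shift s f).
Proof.
move=> /nnm_kill [mf f0]; split => [|x]; last exact: f0.
by apply: measurableT_comp => //; exact: measurable_funB.
Qed.

(** If every [m >= m0] failed, summing over [m < K ^ 4] would contradict [conv_sum]: the terms
    [C * K ^ 4 * S], with [S] the survival probability, agree on both sides, and [K ^ 4 * e]
    outgrows the rest. *)
Lemma conv_average : exists2 C : R, 0 < C &
  forall n m0 s a e, 0 <= s -> 0 <= a -> 0 < e -> exists2 m, (m0 <= m)%N &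
  ((n + m)%:R%:E * iter n T (shift s (conv m)) a <= C%:E * surv n a + e%:E)%E.
Proof.
have [C C0 HC] := conv_sum.
exists C => // n m0 s a e s0 a0 e0; apply: contrapT => no.
have big m : (m0 <= m)%N ->
    (C%:E * surv n a + e%:E <= (n + m)%:R%:E * iter n T (shift s (conv m)) a)%E.
  by move=> mm; rewrite leNgt; apply/negP => /ltW h; apply: no; exists m.
pose S := fine (surv n a).
have S0 : 0 <= S by rewrite fine_ge0//; have [_] := nnm_surv xi n.
have nc m : nnm (shift s (conv m)) by exact/nnm_shift/nnm_conv.
have upper K : (\sum_(0 <= m < K ^ 4) (n + m)%:R%:E * iter n T (shift s (conv m)) a <=
    (C * K%:R ^+ 4 * S + C * (K%:R * n%:R) * S + C * K%:R ^+ 3 * (2 ^+ n * expR a))%:E)%E.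
  under eq_bigr do rewrite -iter_kstepZ//.
  rewrite -iter_kstep_sum; last by move=> m; exact: nnmZ.
  pose k1 := C * K%:R ^+ 4 + C * (K%:R * n%:R); pose k2 := C * K%:R ^+ 3.
  have k10 : 0 <= k1 by rewrite addr_ge0// mulr_ge0 ?exprn_ge0 ?mulr_ge0// ltW.
  have k20 : 0 <= k2 by rewrite mulr_ge0 ?exprn_ge0// ltW.
  have nE : nnm (fun y : R => (expR y)%:E).
    by apply: nnm_EFin => [|y]; [exact: measurable_expR|exact: expR_ge0].
  apply: (@le_trans _ _ (iter n T (fun y => k1%:E * 1%:E + k2%:E * (expR y)%:E) a)%E).
    apply: le_iter_kstep => //.
    - by apply: nnm_sum => m; exact: nnmZ.
    - by apply: nnmD; apply: nnmZ => //; exact: nnm_cst.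
    move=> y y0; rewrite /shift /kill; have [ys|ys] := boolP (0 <= y - s); last first.
      rewrite big1; last by move=> m _; rewrite /= mule0.
      by apply: adde_ge0; apply: mule_ge0; rewrite lee_fin ?expR_ge0.
    apply: le_trans (HC K n _ ys) _; rewrite -!EFinM -EFinD lee_fin mulr1 /k1 /k2.
    rewrite [leRHS](_ : _ = C * (K%:R ^+ 4 + K%:R * n%:R + K%:R ^+ 3 * expR y)); last by ring.
    rewrite ler_wpM2l ?(ltW C0)// lerD2l ler_wpM2l ?exprn_ge0//.
    by rewrite ler_expR gerBl.
  rewrite iter_kstepD; [|by apply: nnmZ => //; exact: nnm_cst|exact: nnmZ].
  rewrite !iter_kstepZ//.
  rewrite -/(surv n) surv_fin -/S.
  apply: (@le_trans _ _ (k1%:E * S%:E + k2%:E * (2 ^+ n * expR a)%:E)%E).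
    by rewrite leeD2l// lee_wpmul2l// iter_kstep_expR.
  by rewrite -!EFinM -EFinD lee_fin /k1 /k2 mulrDl.
have low K : (m0 <= K ^ 4)%N ->
    ((K%:R ^+ 4 - m0%:R) * (C * S + e) <=
     C * K%:R ^+ 4 * S + C * (K%:R * n%:R) * S + C * K%:R ^+ 3 * (2 ^+ n * expR a)).
  move=> mK; rewrite -lee_fin; apply: le_trans (upper K).
  rewrite (big_cat_nat (n := m0))//=.
  apply: (@le_trans _ _ (\sum_(m0 <= m < K ^ 4) (C * S + e)%:E)%E); last first.
    apply: (@le_trans _ _ (\sum_(m0 <= i < K ^ 4) (n + i)%:R%:E * iter n T (shift s (conv i)) a)%E).
      rewrite big_nat [leRHS]big_nat; apply: lee_sum => i /andP[mi _].
      by rewrite EFinD EFinM /S -surv_fin; exact: big.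
    rewrite leeDr// sume_ge0// => i _; rewrite mule_ge0//.
    by have [_] := nnm_iter_kstep xi n (nc i).
  rewrite sumEFin lee_fin big_const_nat iter_addr addr0 -[leRHS]mulr_natl.
  by rewrite natrB// natrX.
(* [X] gathers the coefficients of all terms of lower order, each of these terms being rounded up to
   order [K ^ 3]. *)
pose X := C * n%:R * S + C * (2 ^+ n * expR a) + m0%:R * (C * S + e) + 1.
have X1 : 1 <= X.
  have : 0 <= C * n%:R * S by rewrite !mulr_ge0// ltW.
  have : 0 <= C * (2 ^+ n * expR a) by rewrite !mulr_ge0 ?exprn_ge0 ?expR_ge0// ltW.
  have : 0 <= m0%:R * (C * S + e) by rewrite mulr_ge0// addr_ge0 ?mulr_ge0// ltW.
  rewrite /X; lra.
have [K [K1 mK KX]] : exists K, [/\ (0 < K)%N, (m0 <= K ^ 4)%N & X / e < K%:R].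
  exists (Num.truncn (X / e) + m0).+1; split => //.
    apply: leq_trans (leq_pexp2l _ (isT : 1 <= 4)%N) => //; rewrite expn1.
    by rewrite -addnS (leq_trans (leqnSn _))// leq_addl.
  apply: lt_le_trans (truncnS_gt _) _.
  by rewrite ler_nat ltnS leq_addr.
have := low K mK; rewrite leNgt => /negP; apply.
have KR : 1 <= K%:R :> R by rewrite ler1n.
have Ke : X < K%:R * e by rewrite -ltr_pdivrMr.
set k := K%:R : R in KR Ke *.
have k3 : 1 <= k ^+ 3 by exact: exprn_ege1.
have kk3 : k <= k ^+ 3 by rewrite exprSr ler_peMl ?exprn_ege1// (le_trans ler01).
rewrite mulrBl mulrDr -addrA (_ : k ^+ 4 * (C * S) = C * k ^+ 4 * S); last by ring.
rewrite -addrA ltrD2l.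
have : k ^+ 3 * X < k ^+ 3 * (k * e) by rewrite ltr_pM2l// (lt_le_trans ltr01).
have : C * (k * n%:R) * S <= k ^+ 3 * (C * n%:R * S).
  rewrite (_ : C * (k * n%:R) * S = k * (C * n%:R * S)); last by ring.
  by rewrite ler_wpM2r// !mulr_ge0// ltW.
have : m0%:R * (C * S + e) <= k ^+ 3 * (m0%:R * (C * S + e)).
  by rewrite ler_peMl// mulr_ge0// addr_ge0 ?mulr_ge0// ltW.
have -> : k ^+ 3 * (k * e) = k ^+ 4 * e by ring.
rewrite /X !mulrDr mulr1 [k ^+ 3 * (C * (2 ^+ n * expR a))]mulrCA mulrA.
lra.
Qed.

End time_average.

(** * Bounds derived from the moment and tail recursions *)

Section recursions.
Context {d} {Om : measurableType d} {R : realType} (P : probability Om R).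
Variable xi : {RV P >-> R}.
Hypothesis xi_mean : ('E_P[(fun w => expR (xi w))%R] = (2^-1)%:E)%E.
Variables (dl c kh : R).
Hypothesis dl_gt0 : 0 < dl.
Hypothesis dl_le : dl <= 2^-1.
Hypothesis c_gt0 : 0 < c.
Hypothesis kappa_dl2 : kappa xi (2 * dl) = kh%:E.
Hypothesis kappa_ge : forall t, 0 <= t -> ((1 + c * t ^+ 2)%:E <= kappa xi t)%E.

Local Notation T := (kstep xi).
Local Notation gain := (gain dl c).
Local Notation cap := (cap dl c kh).
Local Notation bar := (bar dl c kh).
Local Notation surv := (surv xi).
Local Notation conv := (conv xi dl).

Let gain0 : 0 < gain. Proof. exact: gain_gt0. Qed.
Let kh1 : 1 <= kh. Proof. exact: (kh_ge1 dl_gt0 c_gt0 kappa_dl2). Qed.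
Let cap1 : 1 <= cap. Proof. exact: (cap_ge1 dl_gt0 c_gt0 kappa_dl2). Qed.
Let cap0 : 0 <= cap. Proof. exact: le_trans cap1. Qed.
Let kh0 : 0 <= kh. Proof. exact: le_trans kh1. Qed.

(** As [drift * gain = kh], the gain of [drift * bar] pays exactly for jumps below [0] costing
    [expR (- (2 * dl) * y)]. *)
Let drift := kh / gain.

Let drift0 : 0 <= drift. Proof. by rewrite divr_ge0// ltW. Qed.

Let bar0 x : 0 <= bar x.
Proof. by have [_ h] := nnm_bar dl c kh; have := h x; rewrite lee_fin. Qed.

(* Values below the barrier are at most [exp y], hence at most
   [exp (- 2 dl y)], whose step is absorbed by the gain of [bar]. *)
Lemma step_killed_le f g x : nnm f -> nnm g -> 0 <= x ->
  (forall y, f y <= (expR y)%:E)%E ->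
  (forall y : R, (0 <= y)%R -> f y <= (drift * bar y)%:E + g y)%E ->
  (step xi f x <= (drift * bar x)%:E + T g x)%E.
Proof.
move=> nf ng x0 fe fg.
have nb : nnm (fun y => (drift * bar y)%:E).
  apply: (nnmZ drift0 (nnm_bar dl c kh)).
have : (step xi f x <= step xi (fun y => kill (fun y => (drift * bar y)%:E + g y) y
    + (expR (- (2 * dl) * y))%:E) x)%E.
  apply: le_step => //.
    by apply: nnmD; [exact/nnm_kill/nnmD|exact: nnm_expR].
  move=> y; rewrite /kill; case: ifPn => y0.
    by apply: le_trans (fg _ y0) _; rewrite leeDl// lee_fin expR_ge0.
  rewrite add0e; apply: le_trans (fe y) _; rewrite lee_fin ler_expR.
  have : y < 0 by rewrite ltNge.
  move: dl_gt0 => d0 y1; nra.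
rewrite stepD; [|exact/nnm_kill/nnmD|exact: nnm_expR].
rewrite -/(kstep xi _ x) kstepD// step_expRN kappa_dl2 => h; apply: (le_trans h).
rewrite addeAC; apply: leeD => //.
under [X in kstep _ X]eq_fun do rewrite EFinM.
rewrite kstepZ//; last exact: nnm_bar.
have h2 := bar_super xi_mean dl_gt0 c_gt0 kappa_dl2 kappa_ge x0.
apply: (@le_trans _ _ (drift%:E * (T (fun y => (bar y)%:E) x + (gain * expR (- dl * x))%:E))%E).
  have Tb0 : (0 <= T (fun y => (bar y)%:E) x)%E.
    by have [_ h3] := nnm_kstep xi (nnm_bar dl c kh); exact: h3.
  have ge0 : 0 <= gain * expR (- dl * x) by rewrite mulr_ge0 ?expR_ge0// ltW.
  rewrite (ge0_muleDr _ Tb0); last by rewrite lee_fin.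
  rewrite leeD2l// -!EFinM lee_fin /drift mulrA divfK ?gt_eqF// mulrC ler_wpM2l//.
  exact: expR_dl2_le.
by rewrite (EFinM drift) lee_wpmul2l// lee_fin.
Qed.

(** Below [0] the unkilled recursion is absorbed by [drift * bar]; above, it is that of [surv]. The
    bound is on [step xi (h m)] because this is the factor squared in the second moment
    recursion. *)
Lemma first_moment_bound (h : nat -> R -> \bar R) (B : R) : 0 <= B ->
  (forall m, nnm (h m)) -> (forall m x, h m x <= (expR x)%:E)%E ->
  (forall x, h 0%N x <= B%:E)%E -> (forall m x, h m.+1 x <= step xi (h m) x)%E ->
  forall m x, 0 <= x -> (step xi (h m) x <= (drift * cap)%:E + B%:E * surv m.+1 x)%E.
Proof.
move=> B0 nh he h0 hS.
have nB m : nnm (fun y => B%:E * surv m y)%E by apply: nnmZ => //; exact: nnm_surv.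
have key m x : 0 <= x -> (h m x <= (drift * bar x)%:E + B%:E * surv m x)%E.
  elim: m x => [|m IH] x x0.
    apply: le_trans (h0 x) _; rewrite [surv 0%N x](_ : _ = 1%E)// mule1.
    by rewrite leeDr// lee_fin mulr_ge0.
  apply: le_trans (hS _ _) _; rewrite [surv m.+1 x](_ : _ = T (surv m) x)//.
  rewrite -kstepZ//; last exact: nnm_surv.
  exact: step_killed_le.
move=> m x x0; have := step_killed_le (nh m) (nB m) x0 (he m) (key m).
rewrite kstepZ//; last exact: nnm_surv.
move=> /le_trans; apply; rewrite leeD2r// lee_fin ler_wpM2l//.
exact: bar_le dl_gt0 c_gt0 kappa_dl2 kappa_ge _.
Qed.

Lemma convS m x : conv m.+1 x = (T (conv m) x + ((m.+2%:R)^-1 * expR (- dl * x))%:E)%E.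
Proof.
rewrite /conv kstep_sum; last first.
  by move=> k; apply: nnmZ; [rewrite invr_ge0|exact: nnm_green].
rewrite big_nat_recl//= addeC; congr (_ + _)%E.
apply: eq_bigr => k _; rewrite kstepZ ?invr_ge0//; last exact: nnm_green.
Qed.

(** [1 + x <= 4 * expR (x / 4)], whose square costs [16] and half of the exponential; [dl <= 1/2]
    leaves enough decay. *)
Lemma sqr_expR_le (x : R) : 0 <= x -> expR (- x) * (1 + x) ^+ 2 <= 16 * expR (- dl * x).
Proof.
move=> x0.
have h : 1 + x / 4 <= expR (x / 4) by exact: expR_ge1Dx.
have e : expR (- x) * expR (x / 4) ^+ 2 <= expR (- dl * x).
  rewrite expr2 -!expRD ler_expR; move: dl_le; nra.
apply: le_trans (_ : 16 * (expR (- x) * expR (x / 4) ^+ 2) <= _); last by rewrite ler_wpM2l.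
rewrite [leRHS]mulrCA ler_wpM2l ?expR_ge0//; nra.
Qed.

(** By [first_moment_bound] and [surv_le] the first moment is at most
    [A * (1 + x) * sqrt (N / m.+2)], its constant part being absorbed because [m.+2 <= N]. The
    square, weighted by [expR (- x) / 2], is at most a multiple of [N] times the source term of
    [convS]. *)
Lemma second_moment_bound : exists2 C : R, 0 < C &
  forall N (h D : nat -> R -> \bar R),
  (forall m, nnm (h m)) -> (forall m x, h m x <= (expR x)%:E)%E ->
  (forall x, h 0%N x <= (Num.sqrt N%:R)%:E)%E ->
  (forall m x, h m.+1 x <= step xi (h m) x)%E ->
  (forall m, nnm (D m)) -> (forall m x, D m x <= (expR x)%:E)%E ->
  (forall x, D 0%N x <= (N%:R * expR (- x))%:E)%E ->
  (forall m x, D m.+1 x <= step xi (D m) x +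
     (expR (- x) / 2)%:E * (step xi (h m) x * step xi (h m) x))%E ->
  forall m x, (m < N)%N -> 0 <= x -> (D m x <= C%:E + (C * N%:R)%:E * conv m x)%E.
Proof.
have [C C0 HC] := surv_le xi_mean dl_gt0 c_gt0 kappa_dl2 kappa_ge.
pose A := drift * cap + C; have A0 : 0 < A by rewrite ltr_wpDl// mulr_ge0.
pose C1 := 1 + 8 * A ^+ 2.
have C10 : 0 < C1 by rewrite ltr_pwDl// mulr_ge0// sqr_ge0.
exists (drift * cap + C1) => [|N h D nh he h0 hS nD De D0 DS m x mN x0].
  by rewrite ltr_wpDl// mulr_ge0.
have hb := first_moment_bound (sqrtr_ge0 _) nh he h0 hS.
have nN k : nnm (fun y => (C1 * N%:R)%:E * conv k y)%E.
  by apply: nnmZ; [rewrite mulr_ge0// ltW|exact: nnm_conv].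
have C1N : 0 <= C1 * N%:R by rewrite mulr_ge0// ltW.
suff key : (D m x <= (drift * bar x)%:E + (C1 * N%:R)%:E * conv m x)%E.
  apply: le_trans key _; apply: leeD.
    rewrite lee_fin ler_wpDr ?(ltW C10)// ler_wpM2l//.
    exact: bar_le dl_gt0 c_gt0 kappa_dl2 kappa_ge _.
  rewrite lee_wpmul2r ?lee_fin//; first by have [_] := nnm_conv xi dl m.
  by rewrite ler_wpM2r// lerDr mulr_ge0.
elim: m x mN x0 => [|m IH] x mN x0.
  apply: le_trans (D0 x) _; rewrite [conv 0%N x](_ : _ = (expR (- dl * x))%:E); last first.
    by rewrite /conv big_nat1 subnn invr1 mul1e.
  rewrite -EFinM -EFinD lee_fin; apply: ler_wpDl; first exact: mulr_ge0.
  rewrite mulrAC mulrC ler_wpM2r//.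
  apply: (@le_trans _ _ (1 * expR (- dl * x))).
    by rewrite mul1r ler_expR; move: dl_le x0; nra.
  by rewrite ler_wpM2r ?expR_ge0// lerDl mulr_ge0// sqr_ge0.
have mN' : (m < N)%N by exact: ltnW.
have s0 : 0 < Num.sqrt m.+2%:R :> R by rewrite sqrtr_gt0.
have sN : Num.sqrt m.+2%:R <= Num.sqrt N%:R :> R by rewrite ler_wsqrtr// ler_nat.
pose r := A * (1 + x) * (Num.sqrt N%:R / Num.sqrt m.+2%:R).
have x1 : 1 <= 1 + x by rewrite lerDl.
have q1 : 1 <= Num.sqrt N%:R / Num.sqrt m.+2%:R :> R by rewrite ler_pdivlMr// mul1r.
have Hr : (step xi (h m) x <= r%:E)%E.
  apply: (le_trans (hb m x x0)).
  apply: (@le_trans _ _ ((drift * cap)%:E +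
      (Num.sqrt N%:R)%:E * (C * (1 + x) / Num.sqrt m.+2%:R)%:E)%E).
    by rewrite leeD2l// lee_wpmul2l ?lee_fin ?sqrtr_ge0// HC.
  rewrite -EFinM -EFinD lee_fin /r /A [leRHS]mulrAC mulrDl mulrDl; apply: lerD.
    rewrite -mulrA; apply: ler_peMr; first exact: mulr_ge0.
    by rewrite -[leLHS]mul1r; apply: ler_pM.
  rewrite le_eqVlt; apply/orP; left; apply/eqP; ring.
have H0 : (0 <= step xi (h m) x)%E by have [_ h1] := nnm_step xi (nh m).
have HH : (step xi (h m) x * step xi (h m) x <= (r ^+ 2)%:E)%E.
  by rewrite expr2 EFinM; exact: lee_pmul.
have Tc0 : (0 <= T (conv m) x)%E.
  by have [_ h1] := nnm_kstep xi (nnm_conv xi dl m); exact: h1.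
apply: le_trans (DS m x) _; rewrite convS (ge0_muleDr _ Tc0); last first.
  by rewrite lee_fin mulr_ge0 ?expR_ge0// invr_ge0.
rewrite addeA; apply: leeD.
  rewrite -kstepZ//; last exact: nnm_conv.
  apply: step_killed_le => // y y0; exact: IH.
have e0 : (0 <= (expR (- x) / 2)%:E)%E by rewrite lee_fin divr_ge0// expR_ge0.
apply: (le_trans (lee_wpmul2l e0 HH)); rewrite -!EFinM lee_fin.
have r2 : r ^+ 2 = A ^+ 2 * (1 + x) ^+ 2 * (N%:R / m.+2%:R).
  by rewrite /r !exprMn exprVn !sqr_sqrtr.
have NM : 0 <= A ^+ 2 * (N%:R / m.+2%:R) by rewrite mulr_ge0 ?sqr_ge0// divr_ge0.
have NM2 : 0 <= N%:R * ((m.+2%:R)^-1 * expR (- dl * x)) :> R.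
  by rewrite !mulr_ge0 ?expR_ge0 ?invr_ge0.
have := ler_wpM2l NM (sqr_expR_le x0); rewrite r2.
rewrite (_ : _ * (16 * _) = 16 * A ^+ 2 * (N%:R * ((m.+2%:R)^-1 * expR (- dl * x)))); last by ring.
set V := N%:R * _ in NM2 *.
move=> k.
rewrite [leRHS](_ : _ = V + 8 * A ^+ 2 * V); last by rewrite /C1 /V; ring.
rewrite [leLHS](_ : _ = 2^-1 *
  (A ^+ 2 * (N%:R / m.+2%:R) * (expR (- x) * (1 + x) ^+ 2))); last by ring.
move: k; rewrite -[16 * _ * V]mulrA -[8 * _ * V]mulrA.
set a := A ^+ 2 * V; set u := A ^+ 2 * _ * _; move: NM2; move: V a u.
move=> V a u V0 ua; lra.
Qed.

(** The recursion of [B] is compared with a killed walk started at [a] in raised heights. A killed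
    walk contributes at most [expR (- s)], a constant that [step] preserves; a surviving one picks
    up the bound on [D m], whose unbounded part is handled by [conv_average]. *)
Lemma maximum_bound : exists2 C : R, 0 < C &
  forall (n : nat) (a s e : R) (m0 : nat), (0 < n)%N -> 0 <= a -> 0 <= s -> 0 < e ->
  exists2 m, (m0 <= m)%N & forall (h D B : nat -> R -> \bar R),
  (forall m, nnm (h m)) -> (forall m x, h m x <= (expR x)%:E)%E ->
  (forall x, h 0%N x <= (Num.sqrt (n + m)%:R)%:E)%E ->
  (forall m x, h m.+1 x <= step xi (h m) x)%E ->
  (forall m, nnm (D m)) -> (forall m x, D m x <= (expR x)%:E)%E ->
  (forall x, D 0%N x <= ((n + m)%:R * expR (- x))%:E)%E ->
  (forall m x, D m.+1 x <= step xi (D m) x +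
     (expR (- x) / 2)%:E * (step xi (h m) x * step xi (h m) x))%E ->
  (forall j, nnm (B j)) -> (forall j x, B j x <= (expR x)%:E)%E ->
  (forall x, B 0%N x <= D m x)%E ->
  (forall j x, B j.+1 x <= step xi (B j) x)%E ->
  (B n (a - s)%R <= (expR (- s) + e)%:E + C%:E * surv n a)%E.
Proof.
have [C1 C10 H1] := second_moment_bound.
have [C2 C20 H2] := conv_average xi_mean dl_gt0 c_gt0 kappa_dl2 kappa_ge.
(* The extra [1] covers raised heights between [0] and [s], where [D m] is at most [1]. *)
pose C3 := C1 + 1; have C30 : 0 < C3 by rewrite addr_gt0.
exists (C3 + C1 * C2) => [|n a s e m0 n0 a0 s0 e0].
  by rewrite addr_gt0// mulr_gt0.
have [m mm Hm] := H2 n m0 s a (e / C1) s0 a0 (divr_gt0 e0 C10).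
exists m => // h D B nh he h0 hS nD De D0 DS nB Be B0 BS.
have mN : (m < n + m)%N by rewrite -addn1 addnC leq_add2r.
have Dm := H1 (n + m)%N h D nh he h0 hS nD De D0 DS m _ mN.
have ns : nnm (shift s (conv m)) by exact/nnm_shift/nnm_conv.
pose K := C1 * (n + m)%:R.
have K0 : 0 <= K by rewrite mulr_ge0// ltW.
have C30' := ltW C30.
have nK : nnm (fun y => K%:E * shift s (conv m) y)%E by exact: nnmZ.
have n1 : nnm (fun y : R => C3%:E * 1%:E)%E by apply: nnmZ => //; exact: nnm_cst.
pose th y := (C3%:E * 1%:E + K%:E * shift s (conv m) y)%E.
have nth : nnm th by exact: nnmD.
have key j y : 0 <= y -> (B j (y - s)%R <= (expR (- s))%:E + iter j T th y)%E.
  elim: j y => [|j IH] y y0.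
    apply: le_trans (B0 _) _; rewrite /= /th; have [ys|ys] := leP 0 (y - s).
      apply: le_trans (Dm _ ys) _; rewrite /shift /kill ys addeA leeD2r//.
      rewrite -EFinM mulr1 -EFinD lee_fin /C3; have := expR_ge0 (- s); lra.
    apply: le_trans (De _ _) _; rewrite addeA.
    apply: (@le_trans _ _ ((expR (- s))%:E + C3%:E * 1)%E); last first.
      by rewrite leeDl// mule_ge0//; have [_ h1] := ns.
    rewrite -EFinM mulr1 -EFinD lee_fin /C3.
    have : expR (y - s) <= 1 by rewrite -[leRHS]expR0 ler_expR ltW.
    by have := expR_ge0 (- s); move: C10; lra.
  apply: le_trans (BS _ _) _.
  have -> : step xi (B j) (y - s) = step xi (fun z => B j (z - s)%R) y.
    by apply: eq_integral => w _; rewrite addrAC.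
  rewrite iterS -(step_cst xi_mean y (expR_ge0 (- s))) -stepD; last 2 first.
  - exact/nnm_cst/expR_ge0.
  - exact/nnm_kill/nnm_iter_kstep.
  apply: le_step.
  - have [mB B0'] := nB j; split => // ; apply: measurableT_comp => //.
    exact: measurable_funB.
  - by apply: nnmD; [exact/nnm_cst/expR_ge0|exact/nnm_kill/nnm_iter_kstep].
  move=> z; rewrite /kill; case: ifPn => z0; first exact: IH.
  rewrite adde0; apply: le_trans (Be _ _) _; rewrite lee_fin ler_expR.
  by rewrite gerDr ltW// ltNge.
apply: le_trans (key n a a0) _; rewrite EFinD -addeA leeD2l//.
rewrite /th iter_kstepD// !iter_kstepZ//.
have S0 : (0 <= surv n a)%E by have [_ h1] := nnm_surv xi n; exact: h1.
have I0 : (0 <= iter n T (shift s (conv m)) a)%E.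
  by have [_ h1] := nnm_iter_kstep xi n ns; exact: h1.
rewrite (EFinD C3) ge0_muleDl ?lee_fin ?mulr_ge0 ?(ltW C10) ?(ltW C20)//.
rewrite addeCA leeD2l// /K EFinM -muleA.
have C10e : (0 <= C1%:E)%E by rewrite lee_fin ltW.
apply: le_trans (lee_wpmul2l C10e Hm) _.
rewrite ge0_muleDr ?mule_ge0 ?lee_fin ?divr_ge0 ?(ltW C20) ?(ltW e0) ?(ltW C10)//.
rewrite muleA -!EFinM (_ : C1 * (e / C1) = e) 1?addeC//.
by field; rewrite gt_eqF.
Qed.

(** * Lower bound for the tail of the total mass *)

Section lower.
Variable p : R.
Hypothesis p_gt0 : 0 < p.

(** The choice gives [eta * kh <= gain]. For [z = expR (- dl * y)] at least [Z], the term
    [eta * z ^+ 2] is at least [1 + z]; for [z < Z] the second entry of [cc] yields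
    [cc * (1 + z) <= p * expR y]. The first entry of [cc] serves the quadratic loss in
    [tail_lower_bound]. *)
Let eta := gain / (kh + gain).
Let Z := 2 / eta.
Let cc := Num.min (gain / 4) (p * expR (- (ln Z / dl)) / (1 + Z)).

Let eta0 : 0 < eta. Proof. by rewrite divr_gt0// ltr_pwDr. Qed.
Let eta1 : eta <= 1.
Proof. by rewrite ler_pdivrMr ?ltr_pwDr// mul1r lerDr. Qed.
Let Z0 : 0 < Z. Proof. by rewrite divr_gt0. Qed.
Let cc0 : 0 < cc.
Proof.
by rewrite lt_min divr_gt0//= divr_gt0 ?mulr_gt0 ?expR_gt0// addr_gt0.
Qed.
Let cc_gain : cc <= gain / 4. Proof. by rewrite ge_min lexx. Qed.

(** Below [0] all that is known of the tail is the lower bound [p], which becomes [p * expR y] after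
    tilting; hence the minimum. *)
Let low (y : R) := if 0 <= y then cc * (1 + expR (- dl * y)) else
  Num.min (cc * (1 + expR (- dl * y))) (p * expR y).

Let nnm_low : nnm (fun y => (low y)%:E).
Proof.
have m1 : measurable_fun setT (fun y : R => cc * (1 + expR (- dl * y))).
  apply: measurable_funM => //; apply: measurable_funD => //.
  by apply: measurableT_comp; [exact: measurable_expR|exact: measurable_funM].
apply: nnm_EFin => [|x].
  have m2 : measurable_fun setT (fun y : R => p * expR y).
    by apply: measurable_funM => //; exact: measurable_expR.
  apply: measurable_fun_ifT m1 (measurable_minr m1 m2).
  exact: measurable_ge_bool.
have h : 0 <= cc * (1 + expR (- dl * x)).
  by rewrite mulr_ge0 ?(ltW cc0)// addr_ge0// expR_ge0.
by rewrite /low; case: ifP => // _; rewrite le_min h mulr_ge0 ?expR_ge0// ltW.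
Qed.

Let low_pointwise y :
  cc * (1 + expR (- dl * y)) <= low y + cc * eta * expR (- (2 * dl) * y).
Proof.
have e2 : 0 <= cc * eta * expR (- (2 * dl) * y).
  exact: mulr_ge0 (mulr_ge0 (ltW cc0) (ltW eta0)) (expR_ge0 _).
rewrite /low; case: ifPn => y0; first by rewrite lerDl.
set z := expR (- dl * y).
have z1 : 1 <= z.
  by rewrite -[leLHS]expR0 ler_expR mulNr oppr_ge0 pmulr_rle0// ltW// ltNge.
have [zZ|zZ] := leP Z z.
  rewrite (expR_dl2 dl) -/z -mulrA ler_wpDl//.
    rewrite le_min !mulr_ge0 ?expR_ge0 ?addr_ge0 ?(ltW cc0) ?(ltW p_gt0)//.
    exact: le_trans z1.
  rewrite ler_wpM2l ?(ltW cc0)//.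
  have : 2 <= eta * z by rewrite mulrC -ler_pdivrMr.
  nra.
have pz : cc * (1 + z) <= p * expR y.
  have : expR (- (ln Z / dl)) <= expR y.
    have h : - dl * y < ln Z.
      by rewrite -[ltLHS]expRK ltr_ln// posrE expR_gt0.
    by rewrite ler_expR -mulNr ler_pdivrMr//; move: h; lra.
  move=> h; apply: (@le_trans _ _ (p * expR (- (ln Z / dl)))); last first.
    by rewrite ler_wpM2l// ltW.
  rewrite -ler_pdivlMr; last by rewrite addr_gt0// (lt_le_trans ltr01).
  apply: (@le_trans _ _ (p * expR (- (ln Z / dl)) / (1 + Z))).
    by rewrite /cc ge_min lexx orbT.
  rewrite ler_wpM2l ?mulr_ge0 ?expR_ge0 ?(ltW p_gt0)//.
  rewrite lef_pV2 ?posrE ?addr_gt0 ?(lt_le_trans ltr01 z1)//.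
  by rewrite lerD2l ltW.
by rewrite (min_idPl pz) lerDl.
Qed.

Let step_low x : 0 <= x ->
  ((cc * (1 + (1 + gain) * expR (- dl * x)))%:E <= step xi (fun y => (low y)%:E) x)%E.
Proof.
move=> x0; have cc0' := ltW cc0; have ce0 : 0 <= cc * eta by rewrite mulr_ge0 ?ltW.
have : (step xi (fun y => cc%:E * (1%:E + (expR (- dl * y))%:E)) x <=
   step xi (fun y => (low y)%:E + (cc * eta)%:E * (expR (- (2 * dl) * y))%:E) x)%E.
  apply: le_step.
  - by apply: nnmZ => //; apply: nnmD; [exact: nnm_cst|exact: nnm_expR].
  - by apply: nnmD => //; apply: nnmZ => //; exact: nnm_expR.
  by move=> y; rewrite -EFinD -!EFinM -EFinD lee_fin.
have n1 : nnm (fun y : R => 1%:E + (expR (- dl * y))%:E)%E.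
  by apply: nnmD; [exact: nnm_cst|exact: nnm_expR].
rewrite stepZ// stepD; [|exact: nnm_cst|exact: nnm_expR].
rewrite stepD//; last by apply: nnmZ => //; exact: nnm_expR.
rewrite stepZ//; last exact: nnm_expR.
rewrite !step_expRN step_cst// kappa_dl2 => h.
have e0 := expR_ge0 (- dl * x).
have h2 : ((cc * (1 + (1 + 2 * gain) * expR (- dl * x)))%:E <=
    step xi (fun y => (low y)%:E) x + (cc * gain * expR (- dl * x))%:E)%E.
  apply: (@le_trans _ _ (cc%:E * (1 + (expR (- dl * x))%:E * kappa xi dl))%E).
    rewrite EFinM lee_wpmul2l ?lee_fin// EFinD leeD2l// mulrC EFinM.
    rewrite lee_wpmul2l ?lee_fin//.
    apply: le_trans (kappa_ge (ltW dl_gt0)); rewrite lee_fin /gain.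
    by rewrite mulrCA divff// mulr1.
  apply: (le_trans h); rewrite leeD2l// -!EFinM lee_fin.
  have : eta * kh <= gain.
    by rewrite /eta mulrAC ler_pdivrMr ?ltr_pwDr// ler_wpM2l ?ltW// ltrDl.
  have := expR_dl2_le dl_gt0 x0; have := expR_ge0 (- (2 * dl) * x).
  set u := expR _; set v := expR (- dl * x) => u0 uv ek.
  have : u * (eta * kh) <= v * gain.
    by apply: ler_pM => //; rewrite mulr_ge0// ltW.
  move=> /(ler_wpM2l cc0'); rewrite (_ : cc * eta * (u * kh) = cc * (u * (eta * kh))); last by ring.
  by rewrite -mulrA (mulrC gain).
move: h2; rewrite -leeBlDr// -EFinB; apply: le_trans.
by rewrite lee_fin; move: e0; set v := expR _; nra.
Qed.

(** Tilted by [expR x], the recursion is [step] minus a quadratic loss, for which the gain in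
    [step_low] pays. The comparison starts with no information at positive heights; this costs
    [2 * cc] times the survival probability, which [expR (- x)] and a large [j] reduce below
    [cc * e]. *)
Lemma tail_lower_bound : exists2 C : R, 0 < C &
  forall e : R, 0 < e -> exists j0 : nat, forall G : nat -> R -> R,
  (forall j, measurable_fun setT (G j)) ->
  (forall j x, 0 <= G j x <= 1) ->
  (forall j x, x <= 0 -> p <= G j x) ->
  (forall j x, exists2 v : R, (\int[P]_w (G j (x - xi w))%:E = v%:E)%E &
     1 - (1 - v) ^+ 2 <= G j.+1 x) ->
  forall j x, (j0 <= j)%N -> C * (Num.min (expR (- x)) 1 - e) <= G j x.
Proof.
have [Cs Cs0 HC] := surv_le xi_mean dl_gt0 c_gt0 kappa_dl2 kappa_ge.
have cc0' := ltW cc0.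
have Z1 : 1 <= Z by rewrite ler_pdivlMr// mul1r; move: eta1; lra.
have ccp : cc <= p.
  apply: (@le_trans _ _ (p * expR (- (ln Z / dl)) / (1 + Z))).
    by rewrite /cc ge_min lexx orbT.
  rewrite ler_pdivrMr ?addr_gt0// ler_wpM2l ?(ltW p_gt0)//.
  apply: (@le_trans _ _ 1); last by rewrite lerDl ltW.
  rewrite -[leRHS]expR0 ler_expR oppr_le0 divr_ge0 ?(ltW dl_gt0)//.
  exact: ln_ge0.
exists cc => // e e0.
pose j0 := Num.truncn ((2 * Cs / e) ^+ 2).
exists j0 => G mG G01 Gp GS.
have G0 j x : 0 <= G j x by have /andP[] := G01 j x.
have G1 j x : G j x <= 1 by have /andP[] := G01 j x.
have neG j : nnm (fun y => (expR y * G j y)%:E).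
  apply: nnm_EFin => [|y]; last by rewrite mulr_ge0 ?expR_ge0.
  by apply: measurable_funM => //; exact: measurable_expR.
have c20 : 0 <= 2 * cc by rewrite mulr_ge0.
have nks j : nnm (kill (fun y => (2 * cc)%:E * surv j y)%E).
  by apply/nnm_kill/nnmZ => //; exact: nnm_surv.
have key j x : 0 <= x ->
    ((cc * (1 + expR (- dl * x)))%:E <= (expR x * G j x)%:E + (2 * cc)%:E * surv j x)%E.
  elim: j x => [|j IH] x x0.
    rewrite [surv 0%N x](_ : _ = 1%E)// mule1 -EFinD lee_fin ler_wpDl//.
      by rewrite mulr_ge0 ?expR_ge0.
    by rewrite mulrC ler_wpM2r//; have := expR_dl_le1 dl_gt0 x0; lra.
  have [v vE vG] := GS j x.
  have v0 : 0 <= v.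
    by rewrite -lee_fin -vE integral_ge0// => w _; rewrite lee_fin.
  have v1 : v <= 1.
    rewrite -lee_fin -vE -(integral_cst_probability P 1%E).
    apply: ge0_le_integral => //.
    - by move=> w _; rewrite lee_fin.
    - apply/measurable_EFinP; apply: measurableT_comp => //.
      exact: measurable_funB.
    - by move=> w _; rewrite lee_fin.
  have stepG : step xi (fun y => (expR y * G j y)%:E) x = (2 * expR x * v)%:E.
    rewrite EFinM -vE -ge0_integralZl//.
    - apply: eq_integral => w _; rewrite -!EFinM; congr EFin.
      by rewrite mulrA; congr (_ * _); rewrite -mulrA -expRD addrC subrK.
    - apply/measurable_EFinP; apply: measurableT_comp => //.
      exact: measurable_funB.
    - by move=> w _; rewrite lee_fin.
  have : (step xi (fun y => (low y)%:E) x <= step xi (fun y => (expR y * G j y)%:E +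
      kill (fun y => (2 * cc)%:E * surv j y) y)%E x)%E.
    apply: le_step => //; first exact: nnmD.
    move=> y; rewrite /kill /low; case: ifPn => y0; first exact: IH.
    rewrite adde0 lee_fin ge_min; apply/orP; right.
    by rewrite mulrC ler_wpM2l ?expR_ge0// Gp// ltW// ltNge.
  rewrite stepD// stepG -/(kstep xi _ x) kstepZ//; last exact: nnm_surv.
  have -> : T (surv j) x = surv j.+1 x by [].
  have sf : surv j.+1 x = (fine (surv j.+1 x))%:E by exact: surv_fin.
  rewrite sf; set S := fine _ => h; have := le_trans (step_low x0) h.
  rewrite -!EFinM -!EFinD !lee_fin => h2.
  have E0 := expR_gt0 x.
  have : 1 - (1 - v) ^+ 2 <= G j.+1 x by [].
  move=> /(ler_wpM2l (ltW E0)) h3; apply: le_trans (lerD h3 (lexx _)).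
  have u1 := expR_dl_le1 dl_gt0 x0; have u0 := expR_ge0 (- dl * x).
  set u := expR (- dl * x) in h2 u1 u0 *.
  have S0 : 0 <= 2 * cc * S.
    by rewrite mulr_ge0// fine_ge0//; have [_ h4] := nnm_surv xi j.+1; exact: h4.
  (* If the linear part is small, the loss is quadratic in [cc] and covered since [cc <= gain / 4];
     if it is large, the half of it left by [v <= 1] already exceeds the target. *)
  have [kb|kb] := leP (2 * expR x * v) (4 * cc).
    have Eu : 1 <= expR x * u.
      rewrite /u -expRD -[leLHS]expR0 ler_expR; move: dl_le x0; nra.
    have loss : expR x * v ^+ 2 <= cc * gain * u.
      rewrite -(ler_pM2l E0).
      have -> : expR x * (expR x * v ^+ 2) = (2 * expR x * v) ^+ 2 / 4 by field.
      have k0 : 0 <= 2 * expR x * v by rewrite !mulr_ge0// expR_ge0.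
      have : (2 * expR x * v) ^+ 2 <= (4 * cc) ^+ 2 by rewrite lerXn2r ?nnegrE// mulr_ge0.
      have : cc * cc <= cc * (gain / 4) by rewrite ler_wpM2l.
      have : cc * gain * 1 <= cc * gain * (expR x * u).
        by rewrite ler_wpM2l// mulr_ge0// ltW.
      set Q := (2 * expR x * v) ^+ 2; lra.
    move: h2 loss; lra.
  have : expR x * v * v <= expR x * v * 1 by rewrite ler_wpM2l// mulr_ge0// ltW.
  move: kb; set q := expR x * v; have -> : 2 * expR x * v = 2 * q by rewrite /q mulrA.
  have -> : expR x * (1 - (1 - v) ^+ 2) = 2 * q - q * v by rewrite /q; ring.
  have : cc * u <= cc * 1 by rewrite ler_wpM2l.
  lra.
move=> j x jj.
have [x0|x0] := leP x 0.
  apply: le_trans (Gp j x x0); apply: le_trans ccp.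
  rewrite -[leRHS]mulr1 ler_wpM2l// lerBlDr; apply: (@le_trans _ _ 1).
    by rewrite ge_min lexx orbT.
  by rewrite lerDl ltW.
have sj : surv j x = (fine (surv j x))%:E by exact: surv_fin.
have := key j x (ltW x0); have := HC j x (ltW x0); rewrite sj.
set S := fine _; rewrite -EFinM -EFinD !lee_fin => hS hk.
have s0 : 0 < Num.sqrt j.+1%:R :> R by rewrite sqrtr_gt0.
have se : 2 * Cs / Num.sqrt j.+1%:R <= e.
  rewrite ler_pdivrMr// (mulrC e) -ler_pdivrMr//.
  have q0 : 0 <= 2 * Cs / e by rewrite divr_ge0 ?mulr_ge0 ?ltW.
  rewrite -(ger0_norm q0) -sqrtr_sqr ler_wsqrtr//; apply: ltW.
  by apply: lt_le_trans (truncnS_gt _) _; rewrite ler_nat ltnS.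
have E0 := expR_gt0 (- x).
have ex : expR (- x) * (1 + x) <= 1.
  by rewrite expRN mulrC ler_pdivrMr ?expR_gt0// mul1r expR_ge1Dx.
have hS2 : 2 * (expR (- x) * S) <= e.
  apply: le_trans se.
  apply: (@le_trans _ _ (2 * (expR (- x) * (Cs * (1 + x) / Num.sqrt j.+1%:R)))).
    by rewrite ler_wpM2l// ler_wpM2l// ltW.
  rewrite [leLHS](_ : _ = 2 * Cs / Num.sqrt j.+1%:R * (expR (- x) * (1 + x))); last by ring.
  by rewrite ler_piMr// divr_ge0 ?mulr_ge0 ?ltW.
have hm : Num.min (expR (- x)) 1 <= expR (- x) by rewrite ge_min lexx.
have hG : G j x = expR (- x) * (expR x * G j x) by rewrite mulrA -expRD addNr expR0 mul1r.
have hk2 : cc <= expR x * G j x + 2 * cc * S.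
  by apply: le_trans hk; rewrite ler_peMr// lerDl expR_ge0.
rewrite hG; move: hk2; set W := expR x * G j x.
move=> /(ler_wpM2l (ltW E0)) hk3.
have h1 := ler_wpM2l cc0' hS2; have h2 := ler_wpM2l cc0' hm.
set a := expR (- x) in hk3 h1 h2 *.
rewrite (_ : a * (W + 2 * cc * S) = a * W + cc * (2 * (a * S))) in hk3; last by ring.
rewrite mulrBr; move: h1 h2 hk3; rewrite (mulrC a cc); lra.
Qed.

End lower.

End recursions.

(** * The branching tree *)

Section law_transfer.
Context {d0} {Om0 : measurableType d0} {d} {Om : measurableType d} {R : realType}.
Context (P0 : probability Om0 R) (P : probability Om R).

Lemma same_law_integral (X : {RV P >-> R}) (xi : {RV P0 >-> R}) (phi : R -> \bar R) :
  same_law X xi -> measurable_fun setT phi -> (forall y, 0 <= phi y)%E ->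
  (\int[P]_w phi (X w) = \int[P0]_w phi (xi w))%E.
Proof.
move=> Xxi mphi phi0.
rewrite -(@ge0_integral_distribution _ _ _ _ _ P X)//.
rewrite -(@ge0_integral_distribution _ _ _ _ _ P0 xi)//.
by apply: eq_measure_integral => A mA _; exact: Xxi.
Qed.

End law_transfer.

Section tree.
Context {d0} {Om0 : measurableType d0} {d} {Om : measurableType d} {R : realType}.
Context {P0 : probability Om0 R} {P : probability Om R}.
Variables (xi : {RV P0 >-> R}) (Xi : seq bool -> {RV P >-> R}).
Hypothesis Xi_law : forall s, s <> [::] -> same_law (Xi s) xi.
Hypothesis Xi_indep : mutually_independent [set s | s <> [::]] Xi.

Definition subtree (t : seq bool) : set (seq bool) := [set u | exists v, u = t ++ v].

(* Proper descendants, as the mass below [t] does not depend on [Xi t]. *)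
Definition below (t : seq bool) : set (seq bool) :=
  [set u | exists b v, u = t ++ b :: v].

Local Notation sig := (sigma_gen Xi).

Lemma rcons_neq0 (s : seq bool) i : rcons s i <> [::].
Proof. by case: s. Qed.

Lemma subtree_neq0 s i : subtree (rcons s i) `<=` [set u | u <> [::]].
Proof. by move=> _ [v ->] /=; case: s. Qed.

Lemma below_neq0 t : below t `<=` [set u | u <> [::]].
Proof. by move=> _ [b [v ->]] /=; case: t. Qed.

Lemma below_sub t : below t `<=` subtree t.
Proof. by move=> _ [b [v ->]]; exists (b :: v). Qed.

Lemma subtree_below s i : subtree (rcons s i) `<=` below s.
Proof. by move=> _ [v ->]; exists i, v; rewrite cat_rcons. Qed.

Lemma disjoint_siblings s : subtree (rcons s false) `&` subtree (rcons s true) = set0.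
Proof.
apply/seteqP; split => // u [[v ->] [v' /eqP]].
by rewrite !cat_rcons eqseq_cat// eqxx.
Qed.

Lemma disjoint_node t : [set t] `&` below t = set0.
Proof.
apply/seteqP; split => // u /= [-> [b [v /(congr1 size)/eqP]]].
by rewrite size_cat/= -[X in X == _]addn0 eqn_add2l.
Qed.

Definition observable (E : set (seq bool)) (V : Om -> R) :=
  measurable_fun setT (V : sig E -> R).

Lemma observable_measurable E V : observable E V -> measurable_fun setT V.
Proof. exact: sigma_gen_measurable_fun. Qed.

Lemma observableS E F V : E `<=` F -> observable E V -> observable F V.
Proof. exact: sigma_genS. Qed.

Lemma observable_comp E V (f : R -> R) : measurable_fun setT f ->
  observable E V -> observable E (f \o V).
Proof. by move=> mf mV; exact: measurableT_comp. Qed.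

(* The contribution to its parent of a child [t] whose own total is [V]. *)
Definition weighted t (V : Om -> R) w := expR (Xi t w) * V w.

Lemma observable_weighted t V : observable (below t) V ->
  observable (subtree t) (weighted t V).
Proof.
move=> mV; apply: measurable_funM; last exact: (observableS (@below_sub t)).
apply: measurableT_comp; first exact: measurable_expR.
by apply: sigma_gen_proj; exists [::]; rewrite cats0.
Qed.

Lemma weighted_integral s i V (phi : R -> \bar R) : observable (below (rcons s i)) V ->
  measurable_fun setT phi -> (forall y, 0 <= phi y)%E ->
  (\int[P]_w phi (weighted (rcons s i) V w) =
   \int[P0]_w0 \int[P]_w phi (expR (xi w0) * V w)%R)%E.
Proof.
set t := rcons s i => mV mphi phi0.
have mF : measurable_fun setT (fun z : R * R => phi (expR z.1 * z.2)).
  apply: measurableT_comp => //; apply: measurable_funM => //.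
  by apply: measurableT_comp; first exact: measurable_expR.
rewrite /weighted (indep_integral Xi_indep (E := [set t]) (F := below t)
  (U := Xi t) (V := V) (Phi := fun z : R * R => phi (expR z.1 * z.2)))//=.
- apply: (same_law_integral (phi := fun y => (\int[P]_w phi (expR y * V w)%R)%E)).
  + exact/Xi_law/rcons_neq0.
  + apply: (measurable_fun_fubini_tonelli_F (m2 := P)
      (fun z : R * Om => phi (expR z.1 * V z.2))) => //.
    apply: measurableT_comp => //; apply: measurable_funM.
      by apply: measurableT_comp; first exact: measurable_expR.
    by apply: measurableT_comp => //; exact: observable_measurable mV.
  + by move=> y; apply: integral_ge0.
- by move=> u ->; exact: rcons_neq0.
- exact: below_neq0.
- exact: disjoint_node.
- exact: sigma_gen_proj.
Qed.

Section siblings.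
Variables (s : seq bool) (V0 V1 : Om -> R).
Hypothesis mV0 : observable (below (rcons s false)) V0.
Hypothesis mV1 : observable (below (rcons s true)) V1.
Let A0 := weighted (rcons s false) V0.
Let A1 := weighted (rcons s true) V1.

Lemma siblings_integral (Phi : R * R -> \bar R) :
  measurable_fun setT Phi -> (forall z, 0 <= Phi z)%E ->
  (\int[P]_w Phi (A0 w, A1 w) = \int[P]_w \int[P]_w' Phi (A0 w, A1 w'))%E.
Proof.
move=> mPhi Phi0; apply: (indep_integral Xi_indep (E := subtree (rcons s false))
  (F := subtree (rcons s true))) => //.
- exact: subtree_neq0.
- exact: subtree_neq0.
- exact: disjoint_siblings.
- exact: observable_weighted.
- exact: observable_weighted.
Qed.

Lemma siblings_integralM (f g : R -> R) : measurable_fun setT f ->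
  measurable_fun setT g -> (forall y, 0 <= f y) -> (forall y, 0 <= g y) ->
  (\int[P]_w (f (A0 w) * g (A1 w))%:E =
   (\int[P]_w (f (A0 w))%:E) * (\int[P]_w (g (A1 w))%:E))%E.
Proof.
move=> mf mg f0 g0; apply: (indep_integralM Xi_indep (E := subtree (rcons s false))
  (F := subtree (rcons s true)) (f := f \o A0) (g := g \o A1)) => //.
- exact: subtree_neq0.
- exact: subtree_neq0.
- exact: disjoint_siblings.
- by apply: observable_comp => //; exact: observable_weighted.
- by apply: observable_comp => //; exact: observable_weighted.
- by move=> w; exact: f0.
- by move=> w; exact: g0.
Qed.

Lemma observable_op (op : R * R -> R) : measurable_fun setT op ->
  observable (below s) (fun w => op (A0 w, A1 w)).
Proof.
move=> mop; apply: measurableT_comp => //; apply: measurable_fun_pair.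
  exact: (observableS (@subtree_below s false) (observable_weighted mV0)).
exact: (observableS (@subtree_below s true) (observable_weighted mV1)).
Qed.

End siblings.

(** Self-similarity of the tree: the law of [V s] does not depend on the node, in the form in which
    it is applied under integrals. *)
Definition law_invariant (V : seq bool -> Om -> R) :=
  forall (phi : R -> \bar R) s s', measurable_fun setT phi -> (forall y, 0 <= phi y)%E ->
  (\int[P]_w phi (V s w) = \int[P]_w phi (V s' w))%E.

(** The children are independent and their laws do not depend on the parent, so under the iterated
    integral they can be exchanged one at a time. *)
Lemma law_invariant_op (V : seq bool -> Om -> R) (op : R * R -> R) :
  (forall s, observable (below s) (V s)) -> measurable_fun setT op ->
  law_invariant V ->
  law_invariant (fun s w => op (weighted (rcons s false) (V (rcons s false)) w,
                                weighted (rcons s true) (V (rcons s true)) w)).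
Proof.
move=> oV mop IV phi s s' mphi phi0.
have kid (psi : R -> \bar R) i t t' : measurable_fun setT psi -> (forall y, 0 <= psi y)%E ->
    (\int[P]_w psi (weighted (rcons t i) (V (rcons t i)) w) =
     \int[P]_w psi (weighted (rcons t' i) (V (rcons t' i)) w))%E.
  move=> mpsi psi0.
  apply: etrans (weighted_integral (oV (rcons t i)) mpsi psi0) _.
  apply: etrans _ (esym (weighted_integral (oV (rcons t' i)) mpsi psi0)).
  apply: eq_integral => w _.
  apply: (IV (fun v => psi (expR (xi w) * v)%R)) => //.
  by apply: measurableT_comp => //; exact: measurable_funM.
have mPhi : measurable_fun setT (fun z : R * R => phi (op z)).
  exact: measurableT_comp.
have mV t i : measurable_fun setT (weighted (rcons t i) (V (rcons t i))).
  exact: (observable_measurable (observable_weighted (oV _))).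
have sib t := siblings_integral (oV (rcons t false)) (oV (rcons t true)) mPhi (fun z => phi0 (op z)).
apply: etrans (sib s) _; apply: etrans _ (esym (sib s')).
transitivity (\int[P]_w \int[P]_w' phi (op (weighted (rcons s false) (V (rcons s false)) w,
    weighted (rcons s' true) (V (rcons s' true)) w')))%E.
  apply: eq_integral => w _.
  apply: (kid (fun y => phi (op (weighted (rcons s false) (V (rcons s false)) w, y)))) => //.
  by apply: (measurableT_comp mPhi); exact: measurable_fun_pair.
apply: (kid (fun y => \int[P]_w' phi (op (y, weighted (rcons s' true) (V (rcons s' true)) w'))))%E.
- apply: (measurable_fun_fubini_tonelli_F (m2 := P)
    (fun z : R * Om => phi (op (z.1, weighted (rcons s' true) (V (rcons s' true)) z.2)))) => //.
  apply: (measurableT_comp mPhi); apply: measurable_fun_pair => //.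
  exact: measurableT_comp.
- by move=> y; apply: integral_ge0.
Qed.

Fixpoint W m s w : R := if m is m'.+1 then
    weighted (rcons s false) (W m' (rcons s false)) w +
    weighted (rcons s true) (W m' (rcons s true)) w
  else 1.

(* The largest of the masses that [n + m] generations below [s] give to the
   words of length [n]. *)
Fixpoint M n m s w : R := if n is n'.+1 then
    Num.max (weighted (rcons s false) (M n' m (rcons s false)) w)
            (weighted (rcons s true) (M n' m (rcons s true)) w)
  else W m s w.

Let addp (z : R * R) := z.1 + z.2.
Let maxp (z : R * R) := Num.max z.1 z.2.
Let m_addp : measurable_fun setT addp. Proof. exact: measurable_funD. Qed.
Let m_maxp : measurable_fun setT maxp. Proof. exact: measurable_maxr. Qed.

Lemma observable_W m s : observable (below s) (W m s).
Proof.
elim: m s => [|m IH] s; first exact: measurable_cst.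
exact: (observable_op (IH _) (IH _) m_addp).
Qed.

Lemma observable_M n m s : observable (below s) (M n m s).
Proof.
elim: n s => [|n IH] s; first exact: observable_W.
exact: (observable_op (IH _) (IH _) m_maxp).
Qed.

Lemma law_invariant_W m : law_invariant (W m).
Proof.
elim: m => [//|m IH].
by apply: (law_invariant_op (V := W m) (op := addp)) => // s; exact: observable_W.
Qed.

Lemma law_invariant_M n m : law_invariant (M n m).
Proof.
elim: n => [|n IH]; first exact: law_invariant_W.
by apply: (law_invariant_op (V := M n m) (op := maxp)) => // s; exact: observable_M.
Qed.

Lemma W_ge0 m s w : 0 <= W m s w.
Proof. by elim: m s => //= m IH s; rewrite addr_ge0// mulr_ge0 ?expR_ge0. Qed.

Lemma M_ge0 n m s w : 0 <= M n m s w.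
Proof.
elim: n s => [|n IH] s /=; first exact: W_ge0.
by rewrite le_max mulr_ge0 ?expR_ge0.
Qed.

End tree.

(** * Truncated moments on the tree *)

Section tree_expectations.
Context {d0} {Om0 : measurableType d0} {d} {Om : measurableType d} {R : realType}.
Context {P0 : probability Om0 R} {P : probability Om R}.
Variables (xi : {RV P0 >-> R}) (Xi : seq bool -> {RV P >-> R}).
Hypothesis Xi_law : forall s, s <> [::] -> same_law (Xi s) xi.
Hypothesis Xi_indep : mutually_independent [set s | s <> [::]] Xi.

Local Notation W := (W Xi).
Local Notation M := (M Xi).
Local Notation observable := (observable Xi).
Local Notation weighted := (weighted Xi).

Definition avg (f : R -> \bar R) (x : R) : \bar R := (\int[P0]_w f (x - xi w)%R)%E.

Definition shape (k : R -> R) := measurable_fun setT k /\ forall y, 0 <= k y.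

Definition ex (k : R -> R) (V : Om -> R) (x : R) : \bar R :=
  (\int[P]_w (k (expR (- x) * V w))%:E)%E.

Lemma nnm_ex k (V : Om -> R) : shape k -> measurable_fun setT V -> nnm (ex k V).
Proof.
move=> [mk k0] mV; split; last by move=> x; apply: integral_ge0 => w _; rewrite lee_fin.
apply: (measurable_fun_fubini_tonelli_F (m2 := P)
  (fun z : R * Om => (k (expR (- z.1) * V z.2))%:E)).
  apply/measurable_EFinP; apply: measurableT_comp => //; apply: measurable_funM.
    apply: measurableT_comp; first exact: measurable_expR.
    exact: measurableT_comp.
  exact: measurableT_comp.
by move=> z; rewrite lee_fin.
Qed.

Lemma ex_measurable k (V : Om -> R) x : shape k -> measurable_fun setT V ->
  measurable_fun setT (fun w => (k (expR (- x) * V w))%:E).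
Proof.
move=> [mk k0] mV; apply/measurable_EFinP; apply: measurableT_comp => //.
exact: measurable_funM.
Qed.

Lemma ex_law_invariant k V x s s' : shape k -> law_invariant (P := P) V ->
  ex k (V s) x = ex k (V s') x.
Proof.
move=> [mk k0] IV; apply: (IV (fun v => (k (expR (- x) * v))%:E)) => //; last first.
  by move=> y; rewrite lee_fin.
by apply/measurable_EFinP; apply: measurableT_comp => //; exact: measurable_funM.
Qed.

Lemma le_avg f g (x : R) : nnm f -> nnm g -> (forall y, f y <= g y)%E ->
  (avg f x <= avg g x)%E.
Proof.
move=> [mf f0] [mg g0] fg; apply: ge0_le_integral => //.
  by apply: measurableT_comp => //; exact: measurable_funB.
by apply: measurableT_comp => //; exact: measurable_funB.
Qed.

Lemma avg_ge0 f (x : R) : nnm f -> (0 <= avg f x)%E.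
Proof. by move=> [_ f0]; exact: integral_ge0. Qed.

(** The many-to-one formula for one generation: the factor [2] counts the children, and the tilt
    absorbs the weight [expR (xi w)]. *)
Lemma step_exp f (x : R) : nnm f ->
  (step xi (fun y => (expR y)%:E * f y) x = (2 * expR x)%:E * avg f x)%E.
Proof.
move=> [mf f0]; rewrite /step /avg -ge0_integralZl//; last first.
  by apply: measurableT_comp => //; exact: measurable_funB.
apply: eq_integral => w _; rewrite muleA -EFinM -mulrA -expRD.
by rewrite [_ + (x - _)]addrC subrK.
Qed.

Lemma ex_weighted k s i V (x : R) : shape k -> observable (below (rcons s i)) V ->
  ex k (weighted (rcons s i) V) x = avg (ex k V) x.
Proof.
move=> [mk k0] mV.
have mphi : measurable_fun setT (fun v => (k (expR (- x) * v))%:E).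
  by apply/measurable_EFinP; apply: measurableT_comp => //; exact: measurable_funM.
have phi0 y : (0 <= (k (expR (- x) * y))%:E)%E by rewrite lee_fin.
apply: etrans (weighted_integral Xi_law Xi_indep mV mphi phi0) _.
apply: eq_integral => w _; apply: eq_integral => w' _.
by rewrite mulrA -expRD opprB [- x + _]addrC.
Qed.

Lemma ex_siblings k k' s V0 V1 (x : R) : shape k -> shape k' ->
  observable (below (rcons s false)) V0 -> observable (below (rcons s true)) V1 ->
  (\int[P]_w (k (expR (- x) * weighted (rcons s false) V0 w) *
              k' (expR (- x) * weighted (rcons s true) V1 w))%:E =
   avg (ex k V0) x * avg (ex k' V1) x)%E.
Proof.
move=> sk sk' mV0 mV1.
rewrite (siblings_integralM Xi_indep mV0 mV1 (f := fun v => k (expR (- x) * v))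
  (g := fun v => k' (expR (- x) * v))).
- by congr (_ * _)%E; exact: ex_weighted.
- by apply: measurableT_comp; [apply sk|exact: measurable_funM].
- by apply: measurableT_comp; [apply sk'|exact: measurable_funM].
- by move=> y; apply sk.
- by move=> y; apply sk'.
Qed.

(** The truncation at [1]; the maximum with [0] makes it nonnegative at negative arguments too, as
    [shape] demands. *)
Definition clip (y : R) := Num.max (Num.min y 1) 0.

Lemma clip01 y : 0 <= clip y <= 1.
Proof. by rewrite /clip le_max lexx orbT/= ge_max ler01 andbT ge_min lexx orbT. Qed.

Lemma clip_le y : 0 <= y -> clip y <= y.
Proof. by move=> y0; rewrite /clip ge_max y0 andbT ge_min lexx. Qed.

Lemma clip1 y : 1 <= y -> clip y = 1.
Proof. by move=> y1; rewrite /clip (min_idPr y1); apply/max_idPl. Qed.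

Lemma clipD a b : 0 <= a -> 0 <= b -> clip (a + b) <= clip a + clip b.
Proof.
move=> a0 b0; rewrite /clip !(max_idPl (_ : 0 <= Num.min _ 1)).
  by rewrite /Num.min; do ![case: ifP]; lra.
all: by rewrite le_min ler01 ?andbT ?addr_ge0.
Qed.

Lemma clip_max a b : clip (Num.max a b) ^+ 2 <= clip a ^+ 2 + clip b ^+ 2.
Proof.
have [_|_] := leP a b; first by rewrite lerDr sqr_ge0.
by rewrite lerDl sqr_ge0.
Qed.

Lemma shape_clip n : shape (fun y => clip y ^+ n).
Proof.
split => [|y]; last by rewrite exprn_ge0//; have /andP[] := clip01 y.
apply: measurable_funX; apply: measurable_maxr => //.
exact: measurable_minr.
Qed.

Lemma weightedZ s (r : R) V w : r * weighted s V w = weighted s (fun w => r * V w) w.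
Proof. by rewrite /weighted mulrCA. Qed.

Section scaled.
Variable r : R.
Hypothesis r0 : 0 <= r.
Let rW m s w := r * W m s w.
Let rM n m s w := r * M n m s w.

Let oW m s : observable (below s) (rW m s).
Proof. by apply: measurable_funM => //; exact: observable_W. Qed.
Let oM n m s : observable (below s) (rM n m s).
Proof. by apply: measurable_funM => //; exact: observable_M. Qed.
Let mW m s : measurable_fun [set: Om] (rW m s).
Proof. exact: (observable_measurable (@oW m s)). Qed.
Let mM n m s : measurable_fun [set: Om] (rM n m s).
Proof. exact: (observable_measurable (@oM n m s)). Qed.

Let invZ V : law_invariant (P := P) V -> law_invariant (P := P) (fun s w => r * V s w).
Proof.
move=> IV phi s s' mphi phi0; apply: (IV (fun v => phi (r * v))) => //.
by apply: measurableT_comp => //; exact: measurable_funM.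
Qed.

Let iW m : law_invariant (P := P) (rW m).
Proof. exact: invZ (law_invariant_W Xi_law Xi_indep m). Qed.
Let iM n m : law_invariant (P := P) (rM n m).
Proof. exact: invZ (law_invariant_M Xi_law Xi_indep n m). Qed.

Lemma scaled_ex_W k m s x : shape k -> ex k (rW m s) x = ex k (rW m [::]) x.
Proof. by move=> sk; apply: ex_law_invariant. Qed.

Lemma ex_weighted_W k m s i x : shape k ->
  ex k (weighted (rcons s i) (rW m (rcons s i))) x = avg (ex k (rW m [::])) x.
Proof.
move=> sk; have E : ex k (rW m (rcons s i)) = ex k (rW m [::]).
  by apply/funext => y; exact: scaled_ex_W.
by rewrite (ex_weighted x sk (@oW m (rcons s i))) E.
Qed.

Lemma ex_weighted_M k n m s i x : shape k ->
  ex k (weighted (rcons s i) (rM n m (rcons s i))) x = avg (ex k (rM n m [::])) x.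
Proof.
move=> sk.
have E : ex k (rM n m (rcons s i)) = ex k (rM n m [::]).
  by apply/funext => y; exact: ex_law_invariant.
by rewrite (ex_weighted x sk (@oM n m (rcons s i))) E.
Qed.

(* The factor [expR x] turns the plain average [avg] into [step]. *)
Definition tilted n (V : Om -> R) (x : R) : \bar R := ((expR x)%:E * ex (fun y => clip y ^+ n)%R V x)%E.

Lemma nnm_tilted n (V : Om -> R) : measurable_fun setT V -> nnm (tilted n V).
Proof.
move=> mV; have [mf f0] := nnm_ex (shape_clip n) mV; split.
  apply: emeasurable_funM => //; apply/measurable_EFinP; exact: measurable_expR.
by move=> x; rewrite mule_ge0// lee_fin expR_ge0.
Qed.

Lemma tilted_le n (V : Om -> R) x : measurable_fun setT V -> (tilted n V x <= (expR x)%:E)%E.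
Proof.
move=> mV; rewrite -[leRHS]mule1 lee_wpmul2l ?lee_fin ?expR_ge0//.
rewrite -(integral_cst_probability P 1%E); apply: ge0_le_integral => //.
- by move=> w _; rewrite lee_fin; have [_ h] := shape_clip n; exact: h.
- exact: ex_measurable (shape_clip n) mV.
- move=> w _; rewrite lee_fin; set y := _ * _; have /andP[c0 c1] := clip01 y.
  exact: exprn_ile1.
Qed.

Lemma tilted_step n (V : Om -> R) x : measurable_fun setT V ->
  (step xi (tilted n V) x = (2 * expR x)%:E * avg (ex (fun y => clip y ^+ n)%R V) x)%E.
Proof. by move=> mV; exact: step_exp (nnm_ex (shape_clip n) mV). Qed.

Lemma tilted_W0 x : (tilted 1 (rW 0 [::]) x <= r%:E)%E.
Proof.
rewrite /tilted /ex /rW/=.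
under eq_integral do rewrite mulr1.
rewrite integral_cst_probability -EFinM lee_fin expr1.
have := clip_le (mulr_ge0 (expR_ge0 (- x)) r0) => /(ler_wpM2l (expR_ge0 x)).
by move=> /le_trans; apply; rewrite mulrA -expRD subrr expR0 mul1r.
Qed.

Lemma tilted2_W0 x : (tilted 2 (rW 0 [::]) x <= (r ^+ 2 * expR (- x))%:E)%E.
Proof.
rewrite /tilted /ex /rW/=.
under eq_integral do rewrite mulr1.
rewrite integral_cst_probability -EFinM lee_fin.
have e0 := expR_ge0 (- x).
have h := clip_le (mulr_ge0 e0 r0); have /andP[c0 _] := clip01 (expR (- x) * r).
apply: (@le_trans _ _ (expR x * (expR (- x) * r) ^+ 2)).
  by rewrite ler_wpM2l ?expR_ge0// lerXn2r ?nnegrE ?mulr_ge0.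
rewrite (_ : expR x * _ = expR x * expR (- x) * (r ^+ 2 * expR (- x))); last by ring.
by rewrite -expRD subrr expR0 mul1r.
Qed.

Lemma tilted_WS m x :
  (tilted 1 (rW m.+1 [::]) x <= step xi (tilted 1 (rW m [::])) x)%E.
Proof.
rewrite tilted_step// (mulrC 2) EFinM -muleA lee_wpmul2l ?lee_fin ?expR_ge0//.
set k := fun y => clip y ^+ 1; have sk : shape k := shape_clip 1.
have E i : ex k (weighted (rcons [::] i) (rW m (rcons [::] i))) x = avg (ex k (rW m [::])) x.
  exact: ex_weighted_W.
rewrite (_ : 2%:E = 1 + 1)%E// ge0_muleDl// mul1e -{1}(E false) -(E true).
have mw i : measurable_fun setT (weighted (rcons [::] i) (rW m (rcons [::] i))).
  exact: (observable_measurable (observable_weighted (@oW m _))).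
rewrite /ex -ge0_integralD//.
- apply: ge0_le_integral => //.
  + by move=> w _; rewrite lee_fin; have [_ h] := sk; exact: h.
  + exact: ex_measurable.
  + by apply: emeasurable_funD; exact: ex_measurable.
  + move=> w _; rewrite -EFinD lee_fin /k !expr1 /rW/= mulrDr !(weightedZ _ r) mulrDr.
    by apply: clipD; rewrite !mulr_ge0 ?expR_ge0 ?W_ge0.
- by move=> w _; rewrite lee_fin; have [_ h] := sk; exact: h.
- exact: ex_measurable.
- by move=> w _; rewrite lee_fin; have [_ h] := sk; exact: h.
- exact: ex_measurable.
Qed.

(** As [clip] is subadditive, the square of the sum leaves two squares and twice the product of the
    children. By independence the product has mean the square of an average, and each average is
    [expR (- x) / 2] times a [step]. *)
Lemma tilted2_WS m x :
  (tilted 2 (rW m.+1 [::]) x <= step xi (tilted 2 (rW m [::])) x +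
     (expR (- x) / 2)%:E * (step xi (tilted 1 (rW m [::])) x * step xi (tilted 1 (rW m [::])) x))%E.
Proof.
set k1 := fun y => clip y ^+ 1; have s1 : shape k1 := shape_clip 1.
set k2 := fun y => clip y ^+ 2; have s2 : shape k2 := shape_clip 2.
rewrite !tilted_step// -/k1 -/k2.
have E k i : shape k ->
    ex k (weighted (rcons [::] i) (rW m (rcons [::] i))) x = avg (ex k (rW m [::])) x.
  exact: ex_weighted_W.
have mw i : measurable_fun setT (weighted (rcons [::] i) (rW m (rcons [::] i))).
  exact: (observable_measurable (observable_weighted (@oW m _))).
have prod := ex_siblings x s1 s1 (@oW m (rcons [::] false)) (@oW m (rcons [::] true)).
have E1 i : avg (ex k1 (rW m (rcons [::] i))) x = avg (ex k1 (rW m [::])) x.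
  have E2 := funext (fun y => scaled_ex_W m (rcons [::] i) y s1).
  exact: (congr1 (avg^~ x) E2).
have {}prod := etrans prod (f_equal2 *%E (E1 false) (E1 true)).
set a := avg (ex k1 _) x in prod *.
have -> : ((expR (- x) / 2)%:E * ((2 * expR x)%:E * a * ((2 * expR x)%:E * a)) =
    (2 * expR x)%:E * (a * a))%E.
  rewrite muleACA !muleA -!EFinM; congr (_%:E * _ * _)%E.
  by rewrite -[X in _ = X]mul1r -[X in _ = X * _](expR0 R) -(subrr x) addrC expRD; field.
rewrite !(mulrC 2) !EFinM -!muleA -ge0_muleDr; last 2 first.
- by rewrite mule_ge0// avg_ge0//; exact: nnm_ex.
- by rewrite !mule_ge0// avg_ge0//; exact: nnm_ex.
rewrite lee_wpmul2l ?lee_fin ?expR_ge0// -prod.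
rewrite {1}(_ : 2%:E = 1 + 1)%E// ge0_muleDl// mul1e -{1}(E _ false s2) -(E _ true s2).
rewrite /ex -ge0_integralZl//; first last.
- by move=> w _; rewrite lee_fin mulr_ge0//; apply s1.
- apply/measurable_EFinP; apply: measurable_funM;
    by apply/measurable_EFinP; exact: ex_measurable.
have k2_ge0 y : 0 <= k2 y by apply s2.
have k1_ge0 y : 0 <= k1 y by apply s1.
have m2 i := ex_measurable x s2 (mw i).
have m1 i := ex_measurable x s1 (mw i).
have m11 : measurable_fun [set: Om] (fun w => (k1 (expR (- x) *
    weighted (rcons [::] false) (rW m (rcons [::] false)) w) *
    k1 (expR (- x) * weighted (rcons [::] true) (rW m (rcons [::] true)) w))%:E).
  by apply/measurable_EFinP; apply: measurable_funM; apply/measurable_EFinP; exact: m1.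
rewrite -!ge0_integralD//.
- apply: ge0_le_integral => //.
  + by move=> w _; rewrite lee_fin; exact: k2_ge0.
  + exact: (ex_measurable x s2 (mW m.+1 [::])).
  + apply: emeasurable_funD; last exact: measurable_funeM.
    exact: emeasurable_funD (m2 false) (m2 true).
  + move=> w _; rewrite -EFinM -!EFinD lee_fin /k2 /k1 !expr1 /rW/= mulrDr !(weightedZ _ r) mulrDr.
    set u := expR _ * _; set v := expR _ * _.
    have uv : clip (u + v) <= clip u + clip v.
      by apply: clipD; rewrite !mulr_ge0 ?expR_ge0 ?W_ge0.
    have /andP[c0 _] := clip01 (u + v).
    have := lerXn2r 2 _ _ uv; rewrite !nnegrE => /(_ c0 (le_trans c0 uv)).
    by move=> /le_trans; apply; rewrite le_eqVlt; apply/orP; left; apply/eqP; ring.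
- by move=> w _; rewrite -EFinD lee_fin addr_ge0//; exact: k2_ge0.
- exact: emeasurable_funD (m2 false) (m2 true).
- by move=> w _; rewrite -EFinM lee_fin !mulr_ge0//; exact: k1_ge0.
- exact: measurable_funeM.
- by move=> w _; rewrite lee_fin; exact: k2_ge0.
- by move=> w _; rewrite lee_fin; exact: k2_ge0.
Qed.

(** Unlike a sum, a maximum produces no cross term, so the recursion has no source. *)
Lemma tilted2_MS n m x :
  (tilted 2 (rM n.+1 m [::]) x <= step xi (tilted 2 (rM n m [::])) x)%E.
Proof.
rewrite tilted_step// (mulrC 2) EFinM -muleA lee_wpmul2l ?lee_fin ?expR_ge0//.
set k := fun y => clip y ^+ 2; have sk : shape k := shape_clip 2.
have E i : ex k (weighted (rcons [::] i) (rM n m (rcons [::] i))) x = avg (ex k (rM n m [::])) x.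
  exact: ex_weighted_M.
rewrite (_ : 2%:E = 1 + 1)%E// ge0_muleDl// mul1e -{1}(E false) -(E true).
have mw i : measurable_fun setT (weighted (rcons [::] i) (rM n m (rcons [::] i))).
  exact: (observable_measurable (observable_weighted (@oM n m _))).
have k0 y : 0 <= k y by apply sk.
rewrite /ex -ge0_integralD//.
- apply: ge0_le_integral => //.
  + by move=> w _; rewrite lee_fin; exact: k0.
  + exact: ex_measurable.
  + by apply: emeasurable_funD; exact: ex_measurable.
  + move=> w _; rewrite -EFinD lee_fin /rM/= maxr_pMr// !(weightedZ _ r) maxr_pMr ?expR_ge0//.
    exact: clip_max.
- by move=> w _; rewrite lee_fin; exact: k0.
- exact: ex_measurable.
- by move=> w _; rewrite lee_fin; exact: k0.
- exact: ex_measurable.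
Qed.

End scaled.
End tree_expectations.

Lemma measurable_bool_set d (T : measurableType d) (b : T -> bool) :
  measurable_fun setT b -> measurable [set w | b w].
Proof. by move=> mb; have := mb measurableT [set true]; rewrite setTI; apply. Qed.

Lemma probability_bool d (T : measurableType d) (R : realType) (P : probability T R)
    (b : T -> bool) : measurable_fun setT b ->
  P [set w | b w] = (\int[P]_w ((b w)%:R)%:E)%E.
Proof.
move=> mb; rewrite -[X in P X]setIT -integral_indic//; last exact: measurable_bool_set.
apply: eq_integral => w _; rewrite indicE; congr (_%:R)%:E.
by congr nat_of_bool; apply/idP/idP; rewrite inE.
Qed.

Lemma measurable_boolR d (T : measurableType d) (R : realType) (b : T -> bool) :
  measurable_fun setT b -> measurable_fun setT (fun w => (b w)%:R : R).
Proof.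
move=> mb; rewrite (_ : (fun w => _) = (fun w => if b w then 1 else 0)).
  exact: measurable_fun_ifT.
by apply/funext => w; case: (b w).
Qed.

(** * The largest mass of a word *)

Section mass_bounds.
Context {d0} {Om0 : measurableType d0} {d} {Om : measurableType d} {R : realType}.
Context {P0 : probability Om0 R} {P : probability Om R}.
Variables (xi : {RV P0 >-> R}) (Xi : seq bool -> {RV P >-> R}).
Hypothesis Xi_law : forall s, s <> [::] -> same_law (Xi s) xi.
Hypothesis Xi_indep : mutually_independent [set s | s <> [::]] Xi.
Hypothesis xi_mean : ('E_P0[(fun w => expR (xi w))%R] = (2^-1)%:E)%E.
Hypothesis xi_crit : ('E_P0[(fun w => xi w * expR (xi w))%R] = 0)%E.
Hypothesis xi_pos : exists2 h : R, 0 < h &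
  ('E_P0[(fun w => expR ((1 + h) * xi w))%R] < +oo)%E.

Local Notation W := (W Xi).
Local Notation M := (M Xi).

Lemma walk_constants : exists dl c kh : R, [/\ 0 < dl, dl <= 2^-1, 0 < c,
  kappa xi (2 * dl) = kh%:E &
  forall t, 0 <= t -> ((1 + c * t ^+ 2)%:E <= kappa xi t)%E].
Proof.
have [c c0 Hc] := kappa_quad xi_mean xi_crit.
have [h /andP[h0 h1] Hh] := kappa_fin xi_mean xi_pos.
exists (h / 2), c, (fine (kappa xi h)); split => //.
- by rewrite divr_gt0.
- by rewrite ler_pdivrMr// mulVf.
- by rewrite mulrC divfK// fineK.
Qed.

Lemma measurable_W m s : measurable_fun [set: Om] (W m s).
Proof. exact: (observable_measurable (@observable_W _ _ _ _ Xi m s)). Qed.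

Lemma measurable_M n m s : measurable_fun [set: Om] (M n m s).
Proof. exact: (observable_measurable (@observable_M _ _ _ _ Xi n m s)). Qed.

(** Markov's inequality for the clipped square, which equals [1] on the event; [maximum_bound] is
    applied to the tilted moments. *)
Lemma max_mass_upper : exists2 C : R, 0 < C &
  forall (n : nat) (a s e : R) (m0 : nat), (0 < n)%N -> 0 <= a -> 0 <= s -> 0 < e ->
  exists2 m, (m0 <= m)%N &
  ((expR (a - s))%:E *
     P [set w | expR (a - s)%R <= Num.sqrt (n + m)%:R * M n m [::] w]%R <=
   (expR (- s) + e + C * (1 + a) / Num.sqrt n.+1%:R)%:E)%E.
Proof.
have [dl [c [kh [dl0 dl1 c0 kdl kge]]]] := walk_constants.
have [C1 C10 H1] := maximum_bound xi_mean dl0 dl1 c0 kdl kge.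
have [C2 C20 H2] := surv_le xi_mean dl0 c0 kdl kge.
exists (C1 * C2) => [|n a s e m0 n0 a0 s0 e0]; first by rewrite mulr_gt0.
have [m mm Hm] := H1 n a s e m0 n0 a0 s0 e0; exists m => //.
set r := Num.sqrt (n + m)%:R; have r0 : 0 <= r by exact: sqrtr_ge0.
have mZ (V : Om -> R) : measurable_fun setT V -> measurable_fun setT (fun w => r * V w).
  by move=> mV; exact: measurable_funM.
pose h k := tilted (P := P) 1 (fun w => r * W k [::] w).
pose D k := tilted (P := P) 2 (fun w => r * W k [::] w).
pose B k := tilted (P := P) 2 (fun w => r * M k m [::] w).
have := Hm h D B.
have r2 : r ^+ 2 = (n + m)%:R by rewrite sqr_sqrtr.
move=> /(_ (fun k => nnm_tilted 1 (mZ _ (measurable_W k [::])))).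
move=> /(_ (fun k x => tilted_le 1 x (mZ _ (measurable_W k [::])))).
move=> /(_ (tilted_W0 Xi r0)).
move=> /(_ (tilted_WS Xi_law Xi_indep r0)).
move=> /(_ (fun k => nnm_tilted 2 (mZ _ (measurable_W k [::])))).
move=> /(_ (fun k x => tilted_le 2 x (mZ _ (measurable_W k [::])))).
have D0 x : (D 0%N x <= ((n + m)%:R * expR (- x))%:E)%E.
  by rewrite -r2; exact: tilted2_W0.
move=> /(_ D0 (tilted2_WS Xi_law Xi_indep r0)).
move=> /(_ (fun k => nnm_tilted 2 (mZ _ (measurable_M k m [::])))).
move=> /(_ (fun k x => tilted_le 2 x (mZ _ (measurable_M k m [::])))).
move=> /(_ (fun x => lexx _)).
move=> /(_ (fun k => tilted2_MS Xi_law Xi_indep r0 k m)) hB.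
apply: (@le_trans _ _ (B n (a - s))).
  rewrite /B /tilted lee_wpmul2l ?lee_fin ?expR_ge0//.
  set x := a - s; rewrite probability_bool; last first.
    by apply: measurable_fun_ler => //; exact: mZ (measurable_M n m [::]).
  apply: ge0_le_integral => //.
  - apply/measurable_EFinP/measurable_boolR.
    by apply: measurable_fun_ler => //; exact: mZ (measurable_M n m [::]).
  - exact: ex_measurable (shape_clip 2) (mZ _ (measurable_M n m [::])).
  - move=> w _; rewrite lee_fin; have [h1|h1] := leP (expR x) (r * M n m [::] w); last exact: sqr_ge0.
    by rewrite clip1 ?expr1n// expRN mulrC ler_pdivlMr ?expR_gt0// mul1r.
apply: (le_trans hB); rewrite [leRHS]EFinD leeD2l//.
have C1e : (0 <= C1%:E)%E by rewrite lee_fin ltW.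
apply: le_trans (lee_wpmul2l C1e (H2 n a a0)) _.
by rewrite -EFinM lee_fin !mulrA.
Qed.

Let below1 (y : R) : R := ((y <= 1)%R)%:R.
Let above1 (y : R) : R := ((1 < y)%R)%:R.

Let shape_below1 : shape below1.
Proof.
by split => [|y]; [apply: measurable_boolR; exact: measurable_fun_ler|exact: ler0n].
Qed.

Let shape_above1 : shape above1.
Proof.
by split => [|y]; [apply: measurable_boolR; exact: measurable_fun_ltr|exact: ler0n].
Qed.

Let below_above (y : R) : below1 y + above1 y = 1.
Proof. by rewrite /below1 /above1 ltNge; case: (y <= 1); rewrite ?addr0 ?add0r. Qed.

Let ex_compl (V : Om -> R) x : measurable_fun setT V ->
  (ex (P := P) below1 V x + ex (P := P) above1 V x = 1)%E.
Proof.
move=> mV; rewrite /ex -ge0_integralD//.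
- under eq_integral do rewrite -EFinD below_above.
  exact: integral_cst_probability.
- by move=> w _; rewrite lee_fin ler0n.
- exact: ex_measurable.
- by move=> w _; rewrite lee_fin ler0n.
- exact: ex_measurable.
Qed.

Let m_avg f (x : R) : nnm f -> measurable_fun setT (fun w => f (x - xi w)%R).
Proof. by move=> [mf _]; apply: measurableT_comp => //; exact: measurable_funB. Qed.

Let avg_compl (V : Om -> R) x : measurable_fun setT V ->
  (avg xi (ex (P := P) below1 V) x + avg xi (ex (P := P) above1 V) x = 1)%E.
Proof.
move=> mV.
have nb := nnm_ex (P := P) shape_below1 mV; have na := nnm_ex (P := P) shape_above1 mV.
rewrite /avg -ge0_integralD//.
- under eq_integral do rewrite ex_compl//.
  exact: integral_cst_probability.
- by move=> w _; apply nb.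
- exact: m_avg.
- by move=> w _; apply na.
- exact: m_avg.
Qed.

Let fin_split (a b : \bar R) : (0 <= a)%E -> (0 <= b)%E -> (a + b = 1)%E ->
  exists v : R, [/\ 0 <= v <= 1, b = v%:E & a = (1 - v)%:E].
Proof.
case: a => [a||]; case: b => [b||]//; rewrite !lee_fin => a0 b0 [ab].
by exists b; split => //; [lra|congr EFin; lra].
Qed.

(** The maxima over the two subtrees are independent, so the probabilities multiply and the
    exponents add; [min (u + v) 1 <= min u 1 + min v 1] restores the shape of the bound. The error
    [e] doubles at each generation, whence [2 ^+ n * e]. *)
Lemma no_large_mass (x0 p : R) (m1 : nat) : 0 < p ->
  (forall m, (m1 <= m)%N ->
     (p%:E <= P [set w | (expR x0 < Num.sqrt m%:R * W m [::] w)%R])%E) ->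
  exists2 C : R, 0 < C & forall e : R, 0 < e -> exists m0 : nat,
  forall m n x, (m0 <= m)%N ->
  (P [set w | (Num.sqrt (n + m)%:R * M n m [::] w <= expR x)%R] <=
   \int[P]_w (expR (- (C * (Num.min (expR (x0 - x) * W n [::] w) 1 -
     2 ^+ n * e))))%:E)%E.
Proof.
move=> p0 Hp.
have [dl [c [kh [dl0 dl1 c0 kdl kge]]]] := walk_constants.
have [C C0 HC] := tail_lower_bound xi_mean dl0 dl1 c0 kdl kge p0.
exists C => // e e0; have [j0 Hj0] := HC e e0.
have mZ (r : R) (V : Om -> R) : measurable_fun setT V -> measurable_fun setT (fun w => r * V w).
  by move=> mV; exact: measurable_funM.
pose V m w := Num.sqrt m%:R * W m [::] w.
have mV m : measurable_fun setT (V m) by exact: mZ (measurable_W m [::]).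
have ex0 k U x : shape k -> (0 <= ex (P := P) k U x)%E.
  by move=> [_ k0]; apply: integral_ge0 => w _; rewrite lee_fin.
have fs m x : exists v : R, [/\ 0 <= v <= 1, ex (P := P) above1 (V m) x = v%:E &
    ex (P := P) below1 (V m) x = (1 - v)%:E].
  by apply: fin_split; [exact: ex0|exact: ex0|exact: ex_compl].
have scale_inv r k m i x : shape k ->
    ex (P := P) k (fun w => r * W m (rcons [::] i) w) x = ex (P := P) k (fun w => r * W m [::] w) x.
  move=> sk; apply: (ex_law_invariant (V := fun s w => r * W m s w)) => //.
  move=> phi s s' mphi phi0.
  apply: (law_invariant_W Xi_law Xi_indep m (phi := fun v => phi (r * v))) => //.
  by apply: measurableT_comp => //; exact: measurable_funM.
have oZ r m s : observable Xi (below s) (fun w => r * W m s w).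
  by apply: measurable_funM => //; exact: observable_W.
have oZM r n m s : observable Xi (below s) (fun w => r * M n m s w).
  by apply: measurable_funM => //; exact: observable_M.
(* The shifts by [m1] and [x0] place the known lower bound [p] at all [j] and all [x <= 0], as
   [tail_lower_bound] requires. *)
pose G j x := fine (ex (P := P) above1 (V (m1 + j)%N) (x + x0)%R).
have GE j x : ex (P := P) above1 (V (m1 + j)%N) (x + x0)%R = (G j x)%:E.
  by have [v [_ E _]] := fs (m1 + j)%N (x + x0)%R; rewrite /G E.
have Gbelow j x : ex (P := P) below1 (V (m1 + j)%N) (x + x0)%R = (1 - G j x)%:E.
  by have [v [_ E1 E2]] := fs (m1 + j)%N (x + x0)%R; rewrite /G E1 E2.
have HG := Hj0 G.
have G1 j : measurable_fun setT (G j).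
  have [mE _] := nnm_ex (P := P) shape_above1 (mV (m1 + j)%N).
  have mE' : measurable_fun setT (fun x : R => ex (P := P) above1 (V (m1 + j)%N) (x + x0)%R).
    by apply: measurableT_comp => //; exact: measurable_funD.
  by apply/measurable_EFinP; apply: eq_measurable_fun mE' => x _; rewrite GE.
have G2 j x : 0 <= G j x <= 1.
  by have [v [v01 E1 _]] := fs (m1 + j)%N (x + x0)%R; rewrite /G E1.
have G3 j x : x <= 0 -> p <= G j x.
  move=> xle; rewrite -lee_fin -GE; apply: le_trans (Hp _ (leq_addr j m1)) _.
  rewrite probability_bool; last by apply: measurable_fun_ltr => //; exact: mV.
  apply: ge0_le_integral => //.
  - apply/measurable_EFinP/measurable_boolR.
    by apply: measurable_fun_ltr => //; exact: mV.
  - exact: ex_measurable.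
  - move=> w _; rewrite lee_fin ler_nat /V; have [h|h] := ltP (expR x0) (Num.sqrt (m1 + j)%:R * W (m1 + j) [::] w) => //=.
    rewrite expRN mulrC ltr_pdivlMr ?expR_gt0// mul1r.
    by rewrite (le_lt_trans _ h)// ler_expR gerDr.
have G4 j x : exists2 v : R, (\int[P0]_w (G j (x - xi w))%:E = v%:E)%E &
    1 - (1 - v) ^+ 2 <= G j.+1 x.
  set k := (m1 + j)%N.
  have [v [v01 E1 E2]] := fin_split (avg_ge0 xi (x + x0)%R (nnm_ex (P := P) shape_below1 (mV k)))
    (avg_ge0 xi (x + x0)%R (nnm_ex (P := P) shape_above1 (mV k))) (avg_compl (x + x0)%R (mV k)).
  exists v.
    rewrite -E1; apply: eq_integral => w _; rewrite -GE; congr ex; ring.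
  suff : (ex (P := P) below1 (V (m1 + j.+1)%N) (x + x0)%R <= ((1 - v) ^+ 2)%:E)%E.
    rewrite Gbelow lee_fin; lra.
  pose s := Num.sqrt (k%:R : R).
  have := ex_siblings Xi_law Xi_indep (x + x0)%R shape_below1 shape_below1
    (oZ s k (rcons [::] false)) (oZ s k (rcons [::] true)).
  have E i : avg xi (ex (P := P) below1 (fun w => s * W k (rcons [::] i) w)) (x + x0)%R = (1 - v)%:E.
    have Ef : ex (P := P) below1 (fun w => s * W k (rcons [::] i) w) = ex (P := P) below1 (V k).
      exact: funext (fun y => scale_inv s below1 k i y shape_below1).
    by rewrite Ef.
  rewrite !E -EFinM -expr2 => <-; apply: ge0_le_integral => //.
  - by move=> w _; rewrite lee_fin ler0n.
  - exact: ex_measurable.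
  - apply/measurable_EFinP; apply: measurable_funM; apply/measurable_EFinP;
      apply: ex_measurable => //;
      exact: (observable_measurable (observable_weighted (oZ _ _ _))).
  move=> w _; rewrite lee_fin /below1 -natrM mulnb ler_nat /V.
  have -> : (m1 + j.+1 = k.+1)%N by rewrite addnS.
  set t := expR _; have t0 : 0 <= t by exact: expR_ge0.
  (* Lowering the normalisation from order [k.+1] to order [k] only enlarges the event of staying
     below the level. *)
  have sk : s <= Num.sqrt k.+1%:R by rewrite ler_wsqrtr// ler_nat.
  have [h|h] := leP (t * (Num.sqrt k.+1%:R * W k.+1 [::] w)) 1 => //; rewrite -!(weightedZ Xi _ s).
  have w0 i : 0 <= weighted Xi (rcons [::] i) (W k (rcons [::] i)) w.
    by rewrite mulr_ge0 ?expR_ge0 ?W_ge0.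
  have hi i : t * (s * weighted Xi (rcons [::] i) (W k (rcons [::] i)) w) <= 1.
    apply: le_trans h; rewrite ler_wpM2l//.
    apply: ler_pM => //; first exact: sqrtr_ge0.
    by rewrite /=; have := w0 false; have := w0 true; case: i => /=; lra.
  by rewrite !hi.
have {}HG := HG G1 G2 G3 G4.
exists (m1 + j0)%N => m n x mm.
set r := Num.sqrt (n + m)%:R; have r0 : 0 <= r by exact: sqrtr_ge0.
pose kk j y := expR (- (C * (Num.min (expR x0 * y) 1 - 2 ^+ j * e))).
have skk j : shape (kk j).
  split => [|y]; last exact: expR_ge0.
  apply: measurableT_comp; first exact: measurable_expR.
  apply: measurable_funN; apply: measurable_funM => //; apply: measurable_funB => //.
  by apply: measurable_minr => //; exact: measurable_funM.
have main j y : (ex (P := P) below1 (fun w => r * M j m [::] w)%R y <=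
    ex (P := P) (kk j) (W j [::]) y)%E.
  elim: j y => [|j IH] y.
    have mj : (m1 + (m - m1) = m)%N.
      by rewrite subnKC//; apply: leq_trans mm; exact: leq_addr.
    apply: (@le_trans _ _ (ex (P := P) below1 (V m) y)).
      apply: ge0_le_integral => //.
      + by move=> w _; rewrite lee_fin ler0n.
      + apply: ex_measurable => //; exact: mZ (measurable_M 0 m [::]).
      + exact: ex_measurable.
      move=> w _; rewrite lee_fin ler_nat /V; have [h|h] := leP (expR (- y) * (r * W m [::] w)) 1 => //.
      suff -> : expR (- y) * (Num.sqrt m%:R * W m [::] w) <= 1 by [].
      apply: le_trans h; rewrite ler_wpM2l ?expR_ge0// ler_wpM2r ?W_ge0//.
      by rewrite ler_wsqrtr// ler_nat leq_addl.
    have := Gbelow (m - m1)%N (y - x0); rewrite mj subrK => ->.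
    rewrite /ex /=; under eq_integral do rewrite mulr1.
    rewrite integral_cst_probability lee_fin /kk expr0 mul1r -expRD.
    have jj : (j0 <= m - m1)%N by rewrite leq_subRL// (leq_trans (leq_addr _ _) mm).
    have := HG (m - m1)%N (y - x0) jj; rewrite opprB => h.
    apply: le_trans (expR_ge1Dx _); rewrite lerD2l lerN2.
    exact: h.
  have E k i (U : seq bool -> Om -> R) z : shape k -> law_invariant (P := P) U ->
      ex (P := P) k (U (rcons [::] i)) z = ex (P := P) k (U [::]) z.
    by move=> sk iU; exact: ex_law_invariant.
  have iM : law_invariant (P := P) (fun s w => r * M j m s w).
    move=> phi s s' mphi phi0.
    apply: (law_invariant_M Xi_law Xi_indep j m (phi := fun v => phi (r * v))) => //.
    by apply: measurableT_comp => //; exact: measurable_funM.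
  have iW := law_invariant_W Xi_law Xi_indep j.
  have p1 := ex_siblings Xi_law Xi_indep y shape_below1 shape_below1
    (oZM r j m (rcons [::] false)) (oZM r j m (rcons [::] true)).
  have p2 := ex_siblings Xi_law Xi_indep y (skk j) (skk j)
    (@observable_W _ _ _ _ Xi j (rcons [::] false)) (@observable_W _ _ _ _ Xi j (rcons [::] true)).
  have A1 i : avg xi (ex (P := P) below1 (fun w => r * M j m (rcons [::] i) w)%R) y =
      avg xi (ex (P := P) below1 (fun w => r * M j m [::] w)%R) y.
    have Ef := funext (fun z => E below1 i (fun s w => r * M j m s w) z shape_below1 iM).
    exact: (congr1 (fun f => avg xi f y) Ef).
  have A2 i : avg xi (ex (P := P) (kk j) (W j (rcons [::] i))) y =
      avg xi (ex (P := P) (kk j) (W j [::])) y.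
    have Ef := funext (fun z => E (kk j) i (W j) z (skk j) iW).
    exact: (congr1 (fun f => avg xi f y) Ef).
  have {}p1 := etrans p1 (f_equal2 *%E (A1 false) (A1 true)).
  have {}p2 := etrans p2 (f_equal2 *%E (A2 false) (A2 true)).
  have nM : nnm (ex (P := P) below1 (fun w => r * M j m [::] w)%R).
    by apply: nnm_ex => //; exact: mZ (measurable_M j m [::]).
  have nW : nnm (ex (P := P) (kk j) (W j [::])).
    by apply: nnm_ex => //; exact: measurable_W.
  have le1 := le_avg xi y nM nW IH.
  have mwM i : measurable_fun [set: Om]
      (weighted Xi (rcons [::] i) (fun w => r * M j m (rcons [::] i) w)%R).
    exact: (observable_measurable (observable_weighted (oZM _ _ _ _))).
  have mwW i : measurable_fun [set: Om] (weighted Xi (rcons [::] i) (W j (rcons [::] i))).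
    exact: (observable_measurable (observable_weighted (@observable_W _ _ _ _ Xi j _))).
  apply: (@le_trans _ _ (\int[P]_w
      (below1 (expR (- y) * weighted Xi (rcons [::] false) (fun w => r * M j m (rcons [::] false) w)%R w) *
       below1 (expR (- y) * weighted Xi (rcons [::] true) (fun w => r * M j m (rcons [::] true) w)%R w))%:E)%E).
    apply: ge0_le_integral => //.
    + by move=> w _; rewrite lee_fin ler0n.
    + apply: ex_measurable => //; exact: mZ (measurable_M j.+1 m [::]).
    + by apply/measurable_EFinP; apply: measurable_funM; apply/measurable_EFinP; exact: ex_measurable.
    move=> w _; rewrite lee_fin /below1 -natrM mulnb ler_nat -!(weightedZ Xi _ r) /=.
    rewrite maxr_pMr// maxr_pMr ?expR_ge0// ge_max.
    by case: (_ <= _) => //=; case: (_ <= _).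
  rewrite p1; apply: (le_trans (lee_pmul (avg_ge0 _ _ nM) (avg_ge0 _ _ nM) le1 le1)).
  rewrite -p2; apply: ge0_le_integral => //.
  - by move=> w _; rewrite lee_fin mulr_ge0//; apply skk.
  - by apply/measurable_EFinP; apply: measurable_funM; apply/measurable_EFinP; exact: ex_measurable.
  - by apply: ex_measurable => //; exact: measurable_W.
  move=> w _; rewrite lee_fin /kk -expRD ler_expR /=.
  pose A i := weighted Xi [:: i] (W j [:: i]) w.
  pose u := expR x0 * (expR (- y) * A false).
  pose v := expR x0 * (expR (- y) * A true).
  rewrite -/(A false) -/(A true) -/u -/v.
  have -> : expR x0 * (expR (- y) * (A false + A true)) = u + v by rewrite /u /v; ring.
  have u0 : 0 <= u by rewrite !mulr_ge0 ?expR_ge0 ?W_ge0.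
  have v0 : 0 <= v by rewrite !mulr_ge0 ?expR_ge0 ?W_ge0.
  have uv : Num.min (u + v) 1 <= Num.min u 1 + Num.min v 1.
    have [hu|hu] := leP u 1; have [hv|hv] := leP v 1; rewrite ge_min ?lexx//;
      apply/orP; right; lra.
  have := ler_wpM2l (ltW C0) uv; rewrite exprS.
  move: (Num.min u 1) (Num.min v 1) (Num.min (u + v) 1) => a b ab; lra.
have mrM := mZ r _ (measurable_M n m [::]).
rewrite probability_bool; last by apply: measurable_fun_ler.
apply: (@le_trans _ _ (ex (P := P) below1 (fun w => r * M n m [::] w)%R x)).
  apply: ge0_le_integral => //.
  - by apply/measurable_EFinP/measurable_boolR; apply: measurable_fun_ler.
  - exact: (ex_measurable x shape_below1 mrM).
  - move=> w _; rewrite lee_fin ler_nat; have [h|h] := leP (r * M n m [::] w) (expR x) => //.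
    by rewrite expRN mulrC ler_pdivrMr ?expR_gt0// mul1r h.
apply: le_trans (main n x) _; rewrite le_eqVlt; apply/orP; left; apply/eqP.
by apply: eq_integral => w _; rewrite /kk mulrA -expRD.
Qed.

End mass_bounds.

(** * The critical measure on dyadic intervals *)

Section words.

(** A list of plain sequences rather than of tuples, so that words can be cut at a given length
    without casts. *)
Fixpoint words (n : nat) : seq (seq bool) :=
  if n is n'.+1 then [seq false :: t | t <- words n'] ++ [seq true :: t | t <- words n']
  else [:: [::]].

Lemma mem_words n t : (t \in words n) = (size t == n).
Proof.
elim: n t => [|n IH] [|b t] //=.
  by rewrite mem_cat; apply/negbTE; rewrite negb_or; apply/andP; split;
    apply/mapP => -[].
rewrite eqSS -IH mem_cat; apply/orP/idP => [[|] /mapP[u ut [_ ->]]//|tn].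
by case: b; [right|left]; rewrite map_f.
Qed.

Lemma uniq_words n : uniq (words n).
Proof.
elim: n => //= n IH; rewrite cat_uniq !map_inj_uniq// ?IH ?andbT/=; last 2 first.
- by move=> ? ? [].
- by move=> ? ? [].
by apply/hasPn => _ /mapP[u _ ->]; apply/mapP => -[].
Qed.

Lemma perm_tuple_words n : perm_eq (map val (enum {: n.-tuple bool})) (words n).
Proof.
apply: uniq_perm; [|exact: uniq_words|].
  by rewrite map_inj_uniq ?enum_uniq//; exact: val_inj.
move=> t; rewrite mem_words; apply/mapP/idP => [[u _ ->]|tn].
  by rewrite size_tuple.
by exists (Tuple tn) => //; rewrite mem_enum.
Qed.

Lemma sum_tuple_words (R : nmodType) n (F : seq bool -> R) :
  \sum_(t : n.-tuple bool) F t = \sum_(t <- words n) F t.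
Proof.
by rewrite -(perm_big _ (perm_tuple_words n))/= big_map big_enum.
Qed.

Lemma sum_words_cat (R : nmodType) n m (F : seq bool -> R) :
  \sum_(t <- words (n + m)) F t = \sum_(s <- words n) \sum_(t <- words m) F (s ++ t).
Proof.
elim: n F => [|n IH] F /=; first by rewrite big_seq1.
by rewrite !big_cat/= !big_map !IH.
Qed.

Fixpoint nval_rec (k : nat) (s : seq bool) : nat :=
  if s is b :: s' then nval_rec (b + k.*2) s' else k.

(* The integer with binary expansion [s], most significant digit first. *)
Definition nval s := nval_rec 0 s.

Lemma nval_rcons s b : nval (rcons s b) = (b + (nval s).*2)%N.
Proof. by rewrite /nval; elim: s 0%N => //= c s IH k; rewrite IH. Qed.

Lemma nval_inj s t : size s = size t -> nval s = nval t -> s = t.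
Proof.
elim/last_ind: s t => [|s b IH] t; first by case: t.
case/lastP: t => [|t c]; first by rewrite size_rcons.
rewrite !size_rcons !nval_rcons => -[st] e.
have bc : b = c by have := congr1 odd e; rewrite !oddD !odd_double !addbF !oddb.
rewrite bc in e *; congr rcons; apply: IH => //.
by move/eqP: e; rewrite eqn_add2l -!muln2 eqn_pmul2r// => /eqP.
Qed.

Lemma nval_lt s : (nval s < 2 ^ size s)%N.
Proof.
elim/last_ind: s => // s b IH; rewrite nval_rcons size_rcons expnS.
by case: b; rewrite -muln2; lia.
Qed.

End words.

Section dyadic.
Variable R : realType.
Implicit Types s t : seq bool.

Lemma word_left_rcons s b :
  @word_left R (rcons s b) = @word_left R s + b%:R * 2^-1 ^+ (size s).+1.
Proof.
rewrite /word_left size_rcons big_nat_recr//= nth_rcons ltnn eqxx; congr (_ + _).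
by apply: eq_big_nat => k /andP[_ ks]; rewrite nth_rcons ks.
Qed.

Lemma word_leftE s : @word_left R s = (nval s)%:R * 2^-1 ^+ size s.
Proof.
elim/last_ind: s => [|s b IH]; first by rewrite /word_left big_nil mul0r.
rewrite word_left_rcons IH nval_rcons size_rcons natrD -muln2 natrM exprS.
by field.
Qed.

Lemma word_itvP s x : @word_itv R s x <->
  ((nval s)%:R <= x * 2 ^+ size s) /\ (x * 2 ^+ size s < (nval s)%:R + 1).
Proof.
rewrite /word_itv /= in_itv/= word_leftE.
have p0 : 0 < 2 ^+ size s :> R by exact: exprn_gt0.
rewrite exprVn; set q := 2 ^+ size s in p0 *.
have e1 : q^-1 * q = 1 by rewrite mulVf// gt_eqF.
rewrite -(ler_pM2r p0) -(ltr_pM2r p0) mulrDl -mulrA e1 mulr1.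
by split => [/andP[]|[-> ->]].
Qed.

Lemma word_itv_rcons s b : @word_itv R (rcons s b) `<=` @word_itv R s.
Proof.
move=> x /word_itvP[]; rewrite nval_rcons size_rcons natrD -muln2 natrM exprS => h1 h2.
apply/word_itvP; have b0 : 0 <= b%:R :> R by [].
have b1 : b%:R <= 1 :> R by case: b {h1 h2 b0}.
split; lra.
Qed.

Lemma word_itv_cat s t : @word_itv R (s ++ t) `<=` @word_itv R s.
Proof.
elim/last_ind: t => [|t b IH]; first by rewrite cats0.
by rewrite -rcons_cat; apply: subset_trans IH; exact: word_itv_rcons.
Qed.

Lemma lebesgue_word_itv s :
  lebesgue_measure (@word_itv R s) = (2^-1 ^+ size s)%:E.
Proof.
rewrite /word_itv lebesgue_measure_itv/= lte_fin ltrDl exprn_gt0// ?invr_gt0//.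
by rewrite -EFinB addrAC subrr add0r.
Qed.

Lemma measurable_word_itv s : measurable (@word_itv R s).
Proof. exact: measurable_itv. Qed.

End dyadic.

Section cascade_measure.
Context {d} {Om : measurableType d} {R : realType} {P : probability Om R}.
Variable Xi : seq bool -> {RV P >-> R}.
Local Notation W := (W Xi).
Local Notation M := (M Xi).

Lemma branch_sum_rcons s b w :
  branch_sum Xi (rcons s b) w = branch_sum Xi s w + Xi (rcons s b) w.
Proof.
rewrite /branch_sum size_rcons big_nat_recr//= -{2}(size_rcons s b) take_size.
congr (_ + _); apply: eq_big_nat => k /andP[_ ks]; congr (Xi _ _).
by rewrite -cats1 takel_cat.
Qed.

Lemma branch_sum_nil w : branch_sum Xi [::] w = 0.
Proof. by rewrite /branch_sum big_geq. Qed.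

Lemma sum_branch_W m s w :
  \sum_(t <- words m) expR (branch_sum Xi (s ++ t) w) = expR (branch_sum Xi s w) * W m s w.
Proof.
elim: m s => [|m IH] s /=; first by rewrite big_seq1 cats0 mulr1.
rewrite big_cat/= !big_map.
under eq_bigr do rewrite -cat_rcons.
under [X in _ + X]eq_bigr do rewrite -cat_rcons.
rewrite !IH !branch_sum_rcons !expRD /weighted; ring.
Qed.

Lemma critical_massE n w : critical_mass Xi n w = Num.sqrt n%:R * W n [::] w.
Proof.
rewrite /critical_mass (sum_tuple_words n (fun s => expR (branch_sum Xi s w))).
by have := sum_branch_W n [::] w; rewrite branch_sum_nil expR0 mul1r => <-.
Qed.

Lemma M_ub n m s t w : size t = n ->
  expR (branch_sum Xi (s ++ t) w) * W m (s ++ t) w <= expR (branch_sum Xi s w) * M n m s w.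
Proof.
elim: n s t => [|n IH] s [|b t]//=; first by rewrite cats0.
move=> [tn]; rewrite -cat_rcons; apply: le_trans (IH _ _ tn) _.
rewrite branch_sum_rcons expRD -mulrA ler_wpM2l ?expR_ge0//.
by rewrite le_max; case: b; rewrite /weighted lexx ?orbT.
Qed.

Lemma M_attained n m s w : exists2 t, size t = n &
  expR (branch_sum Xi s w) * M n m s w = expR (branch_sum Xi (s ++ t) w) * W m (s ++ t) w.
Proof.
elim: n s => [|n IH] s /=; first by exists [::]; rewrite ?cats0.
have [b ->] : exists b, Num.max (weighted Xi (rcons s false) (M n m (rcons s false)) w)
    (weighted Xi (rcons s true) (M n m (rcons s true)) w) =
    weighted Xi (rcons s b) (M n m (rcons s b)) w.
  by case: leP => _; [exists true|exists false].
have [t tn E] := IH (rcons s b); exists (b :: t); first by rewrite /= tn.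
by rewrite -cat_rcons -E branch_sum_rcons expRD /weighted mulrA.
Qed.

Lemma critical_measureE n w (A : set (measurableTypeR R)) : measurable A ->
  critical_measure Xi n w A = (\sum_(t <- words n)
    (Num.sqrt n%:R * expR (branch_sum Xi t w) * 2 ^+ n)%:E *
    lebesgue_measure (@word_itv R t `&` A))%E.
Proof.
move=> mA; rewrite /critical_measure.
pose c t := Num.sqrt n%:R * expR (branch_sum Xi t w) * 2 ^+ n.
have c0 t : 0 <= c t by rewrite !mulr_ge0 ?sqrtr_ge0 ?expR_ge0 ?exprn_ge0.
transitivity (\int[lebesgue_measure]_(x in A)
   (\sum_(t <- words n) (c t)%:E * (\1_(@word_itv R t) x)%:E))%E.
  apply: eq_integral => x _; rewrite /critical_density.
  rewrite (sum_tuple_words n (fun s => Num.sqrt n%:R * expR (branch_sum Xi s w) *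
    2 ^+ n * \1_(@word_itv R s) x)) -sumEFin.
  by apply: eq_bigr => t _; rewrite EFinM.
have mi t : measurable_fun A (fun x => (\1_(@word_itv R t) x)%:E : \bar R).
  by apply/measurable_EFinP; apply: measurable_indic; exact: measurable_itv.
rewrite ge0_integral_sum//.
- apply: eq_bigr => t _; rewrite ge0_integralZl//.
  + by rewrite integral_indic//; exact: measurable_word_itv.
  + by rewrite lee_fin.
- by move=> t; exact: measurable_funeM.
- by move=> t x _; rewrite -EFinM lee_fin mulr_ge0.
Qed.

Let mass n m w s := Num.sqrt (n + m)%:R * (expR (branch_sum Xi s w) * W m s w).

(** The part of the critical measure of order [n + m] carried by the words that extend [s]. *)
Let piece n m w s (A : set (measurableTypeR R)) : \bar R := (\sum_(t <- words m)
  (Num.sqrt (n + m)%:R * expR (branch_sum Xi (s ++ t) w) * 2 ^+ (n + m))%:E *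
    lebesgue_measure (@word_itv R (s ++ t) `&` A))%E.

Let piece_ge0 n m w s A : (0 <= piece n m w s A)%E.
Proof.
by apply: sume_ge0 => t _; rewrite mule_ge0// lee_fin.
Qed.

Let piece_full n m w s : size s = n -> (piece n m w s (@word_itv R s) = (mass n m w s)%:E)%E.
Proof.
move=> sn; rewrite /mass -sum_branch_W mulr_sumr -sumEFin /piece.
rewrite big_seq [RHS]big_seq; apply: eq_bigr => t; rewrite mem_words => /eqP tm.
rewrite (setIidl (@word_itv_cat _ _ _)) lebesgue_word_itv size_cat sn tm -EFinM.
by rewrite exprVn mulfK// gt_eqF// exprn_gt0.
Qed.

Let piece_le n m w s A : size s = n -> measurable A -> (piece n m w s A <= (mass n m w s)%:E)%E.
Proof.
move=> sn mA; rewrite -(piece_full m w sn) /piece; apply: lee_sum => t _.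
rewrite lee_wpmul2l//.
rewrite (setIidl (@word_itv_cat _ _ _)); apply: le_measure; rewrite ?inE.
- by apply: measurableI => //; exact: measurable_word_itv.
- exact: measurable_word_itv.
- exact: subIsetl.
Qed.

Lemma critical_measure_split n m w (A : set (measurableTypeR R)) : measurable A ->
  critical_measure Xi (n + m) w A = (\sum_(s <- words n) piece n m w s A)%E.
Proof. by move=> mA; rewrite critical_measureE// sum_words_cat. Qed.

Lemma critical_measure_word_itv n m w s : size s = n ->
  ((Num.sqrt (n + m)%:R * (expR (branch_sum Xi s w) * W m s w))%:E <=
   critical_measure Xi (n + m) w (@word_itv R s))%E.
Proof.
move=> sn; rewrite critical_measure_split; last exact: measurable_word_itv.
have sw : s \in words n by rewrite mem_words sn.
rewrite (big_rem _ sw)/= piece_full// leeDl// sume_ge0// => t _; exact: piece_ge0.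
Qed.

(** In units of [2^-n], points within [2] of [k] lie in words with value from [k - 2] to [k + 1],
    and each of these four carries at most the largest mass. *)
Lemma critical_measure_le n m w (lam : R) (k : nat) (A : set (measurableTypeR R)) :
  measurable A -> 0 <= lam ->
  (forall x, A x -> `|x * 2 ^+ n - k%:R| < 2) ->
  Num.sqrt (n + m)%:R * M n m [::] w <= lam ->
  (critical_measure Xi (n + m) w A <= (4 * lam)%:E)%E.
Proof.
move=> mA lam0 Ak Ml; rewrite critical_measure_split//.
pose near s := (k <= (nval s).+2)%N && (nval s < k + 2)%N.
have far s : s \in words n -> ~~ near s -> piece n m w s A = 0%E.
  rewrite mem_words => /eqP sn /negP ns; rewrite /piece big1// => t _.
  rewrite (_ : _ `&` _ = set0) ?measure0 ?mule0//.
  apply/seteqP; split => // x [/word_itv_cat/word_itvP[h1 h2] /Ak].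
  rewrite sn in h1 h2; rewrite ltr_norml => /andP[h3 h4]; apply: ns.
  have h5 : k%:R < (nval s)%:R + 3 :> R by lra.
  have h6 : (nval s)%:R < k%:R + 2 :> R by lra.
  by rewrite /near; move: h5 h6; rewrite -!natrD !ltr_nat addn3 ltnS => -> ->.
rewrite big_seq (bigID near)/= [X in (_ + X)%E]big1 ?adde0; last first.
  by move=> s /andP[sw /(far _ sw)].
have each s : s \in words n -> (piece n m w s A <= lam%:E)%E.
  rewrite mem_words => /eqP sn; apply: le_trans (piece_le m w sn mA) _.
  rewrite lee_fin; apply: le_trans Ml; rewrite ler_wpM2l ?sqrtr_ge0//.
  have := @M_ub n m [::] s w sn; rewrite branch_sum_nil expR0 mul1r.
  exact.
apply: (@le_trans _ _ (\sum_(s <- words n | (s \in words n) && near s) lam%:E)%E).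
  by apply: lee_sum => s /andP[sw _]; exact: each.
rewrite sumEFin lee_fin big_const_seq iter_addr addr0 -[leLHS]mulr_natl ler_wpM2r//.
rewrite ler_nat -size_filter.
set S := seq.filter _ _.
have uS : uniq (map nval S).
  rewrite map_inj_in_uniq ?filter_uniq ?uniq_words// => s t.
  rewrite !mem_filter !mem_words => /andP[_ /eqP ss] /andP[_ /eqP tt].
  by apply: nval_inj; rewrite ss tt.
(* For [k < 2] the truncated subtraction starts the window at [0], which still covers all admissible
   values. *)
rewrite -(size_map nval) -(size_iota (k - 2) 4); apply: uniq_leq_size => // j.
move=> /mapP[s]; rewrite mem_filter /near mem_iota => /andP[/andP[_ /andP[h1 h2]] _] ->.
by apply/andP; split; lia.
Qed.

End cascade_measure.

(** * Tent functions at dyadic points *)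

Section tent.
Variable R : realType.
Let J : set (measurableTypeR R) := `[0, 1]%classic.

(** In units of [2^-n], the plateau has half-width [1], so that every interval of length at most
    [2^-n] in [[0, 1]] lies under some plateau, and the support has half-width [2]. *)
Definition tent (n k : nat) (x : R) : R := clip (2 - `|x * 2 ^+ n - k%:R|).

Lemma tent01 n k x : 0 <= tent n k x <= 1.
Proof. exact: clip01. Qed.

Lemma tent_eq1 n k x : `|x * 2 ^+ n - k%:R| <= 1 -> tent n k x = 1.
Proof. by move=> h; apply: clip1; lra. Qed.

Lemma tent_eq0 n k x : 2 <= `|x * 2 ^+ n - k%:R| -> tent n k x = 0.
Proof.
move=> h; apply/max_idPr; rewrite ge_min; apply/orP; left; lra.
Qed.

Lemma continuous_tent n k : continuous (tent n k).
Proof.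
move=> x; apply: (@continuous_max R R (fun x => Num.min (2 - `|x * 2 ^+ n - k%:R|) 1) (fun=> 0)).
  apply: (@continuous_min R R (fun x => 2 - `|x * 2 ^+ n - k%:R|) (fun=> 1)).
    apply: (@cvgB _ R^o); first exact: cvg_cst.
    apply: (@cvg_norm _ R^o); apply: (@cvgB _ R^o); last exact: cvg_cst.
    by apply: (@cvgM R); [exact: cvg_id|exact: cvg_cst].
  exact: cvg_cst.
exact: cvg_cst.
Qed.

Lemma measurable_tent n k : measurable_fun [set: measurableTypeR R] (tent n k).
Proof. exact: continuous_measurable_fun (@continuous_tent n k). Qed.

Lemma measurable_tent_in n k (D : set (measurableTypeR R)) :
  measurable_fun D (EFin \o tent n k).
Proof.
by apply/measurable_EFinP; apply: measurable_funS (@measurable_tent n k).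
Qed.

Lemma measurable_unit_itv : measurable J.
Proof. exact: measurable_itv. Qed.
Hint Resolve measurable_unit_itv : core.

Lemma measurable_near_node n k :
  measurable ([set x | (`|x * 2 ^+ n - k%:R| < 2)%R] : set (measurableTypeR R)).
Proof.
pose g := fun x : R => `|x * 2 ^+ n - k%:R|.
have cg : continuous g.
  move=> x; apply: (@cvg_norm _ R^o); apply: (@cvgB _ R^o); last exact: cvg_cst.
  by apply: (@cvgM R); [exact: cvg_id|exact: cvg_cst].
have := continuous_measurable_fun cg measurableT (measurable_itv `]-oo, 2[).
by rewrite setTI.
Qed.

Variable nu : {measure set (measurableTypeR R) -> \bar R}.
Hypothesis nuJ : (nu J < +oo)%E.

Lemma integral_tent_le n k :
  (\int[nu]_(x in J) (tent n k x)%:E <=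
   nu (J `&` [set x | (`|x * 2 ^+ n - k%:R| < 2)%R]))%E.
Proof.
set A := [set x | _]; have mA : measurable A := measurable_near_node n k.
rewrite setIC -integral_indic//.
apply: ge0_le_integral => //.
- by move=> x _; rewrite lee_fin; have /andP[] := tent01 n k x.
- exact: measurable_tent_in.
- by apply/measurable_EFinP; exact: measurable_indic.
move=> x _; rewrite lee_fin indicE; case: (boolP (x \in A)) => [_|].
  by have /andP[] := tent01 n k x.
rewrite notin_setE /A/= => /negP; rewrite -leNgt => h.
by rewrite tent_eq0.
Qed.

Lemma integral_tentE n k :
  (((\int[nu]_(x in J) tent n k x)%R)%:E = \int[nu]_(x in J) (tent n k x)%:E)%E.
Proof.
rewrite fineK// ge0_fin_numE.
  apply: le_lt_trans nuJ; apply: le_trans (integral_tent_le n k) _.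
  apply: le_measure; rewrite ?inE//.
  by apply: measurableI => //; exact: measurable_near_node.
by apply: integral_ge0 => x _; rewrite lee_fin; have /andP[] := tent01 n k x.
Qed.

Lemma Rintegral_tent_ge n k (A : set (measurableTypeR R)) : measurable A -> A `<=` J ->
  (forall x, A x -> `|x * 2 ^+ n - k%:R| <= 1) ->
  (nu A <= ((\int[nu]_(x in J) tent n k x)%R)%:E)%E.
Proof.
move=> mA AJ A1; rewrite integral_tentE -[A in nu A](setIidl AJ) -integral_indic//.
apply: ge0_le_integral => //.
- by apply/measurable_EFinP; exact: measurable_indic.
- exact: measurable_tent_in.
move=> x _; rewrite lee_fin indicE; case: (boolP (x \in A)) => [/set_mem/A1/tent_eq1->//|_].
by have /andP[] := tent01 n k x.
Qed.

Lemma Rintegral_tent_ge0 n k : 0 <= (\int[nu]_(x in J) tent n k x)%R.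
Proof.
by apply: Rintegral_ge0 => x _; have /andP[] := tent01 n k x.
Qed.

End tent.

Lemma measurable_Rintegral_tent d (T : measurableType d) (R : realType)
    (l : T -> {measure set (measurableTypeR R) -> \bar R}) n k :
  (forall U, measurable U -> measurable_fun [set: T] (fun w => l w U)) ->
  measurable_fun [set: T] (fun w => (\int[l w]_(x in `[0%R, 1%R]) tent n k x)%R).
Proof.
move=> ml; apply: (@measurableT_comp _ _ _ _ _ _ (@fine R)) => //.
under eq_fun do rewrite integral_mkcond.
apply: (measurable_fun_integral_kernel ml).
  by move=> x; rewrite patchE; case: ifP => // _; rewrite lee_fin; have /andP[] := tent01 n k x.
apply/(measurable_restrictT _ _).1; first exact: measurable_itv.
exact: measurable_tent_in.
Qed.

(** * Passing to the limit measure *)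

Lemma cvge_near_lt (R : realType) (u : (\bar R)^nat) (l c : \bar R) :
  u @ \oo --> l -> (l < c)%E -> \forall n \near \oo, (u n < c)%E.
Proof.
move=> ul lc; apply: (ul [set y | (y < c)%E]).
by apply: open_nbhs_nbhs; split => //; exact: open_ereal_lt_ereal.
Qed.

Section transfer.
Context {d} {Om : measurableType d} {R : realType} {P : probability Om R}.
Variable Xi : seq bool -> {RV P >-> R}.
Variable mu1 : R.-ftker Om ~> measurableTypeR R.
Hypothesis mu1_cvg : cvg_weakly_in_probability P
  (fun n w => critical_measure Xi n w) mu1.
Local Notation M := (M Xi).

(* A tent rather than an indicator, as weak convergence needs a continuous
   test function. *)
Definition node_mass (nu : {measure set (measurableTypeR R) -> \bar R}) n k : R :=
  \int[nu]_(x in `[0%R, 1%R]) tent n k x.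

Local Notation Y n k := (fun w => node_mass (mu1 w) n k).
Local Notation Z N n k := (fun w => node_mass (critical_measure Xi N w) n k).

Lemma measurable_critical_measure N (U : set (measurableTypeR R)) : measurable U ->
  measurable_fun [set: Om] (fun w => critical_measure Xi N w U).
Proof.
move=> mU; under eq_fun do rewrite critical_measureE//.
apply: emeasurable_sum => t; apply: emeasurable_funM => //.
apply/measurable_EFinP; apply: measurable_funM => //; apply: measurable_funM => //.
apply: measurableT_comp => //.
by apply: measurable_sum => k.
Qed.

Lemma measurable_mu1_node n k : measurable_fun [set: Om] (Y n k).
Proof. by apply: measurable_Rintegral_tent => U; exact: measurable_kernel. Qed.

Lemma measurable_critical_node N n k : measurable_fun [set: Om] (Z N n k).
Proof. by apply: measurable_Rintegral_tent => U; exact: measurable_critical_measure. Qed.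

Definition high n lam : set Om :=
  \big[setU/set0]_(k < (2 ^ n).+1) [set w | (lam <= Y n k w)%R].

Lemma measurable_high n lam : measurable (high n lam).
Proof.
apply: bigsetU_measurable => k _; apply: measurable_bool_set.
by apply: measurable_fun_ler => //; exact: measurable_mu1_node.
Qed.

Lemma highP n lam w : high n lam w <-> exists2 k : nat, (k <= 2 ^ n)%N & lam <= Y n k w.
Proof.
rewrite /high -(bigcup_mkord _ (fun k : nat => [set w : Om | (lam <= Y n k w)%R])); split => [[k /= kn h]|[k kn h]].
  by exists k.
by exists k.
Qed.

Let gap N n lam : set Om :=
  \big[setU/set0]_(k < (2 ^ n).+1) [set w | (lam <= `|Z N n k w - Y n k w|)%R].

Let gapP N n lam w : gap N n lam w <->
  exists2 k : nat, (k <= 2 ^ n)%N & lam <= `|Z N n k w - Y n k w|.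
Proof.
rewrite /gap -(bigcup_mkord _ (fun k : nat => [set w : Om | (lam <= `|Z N n k w - Y n k w|)%R])); split => [[k /= kn h]|[k kn h]]; by exists k.
Qed.

Let measurable_gap1 N n k lam :
  measurable [set w | (lam <= `|Z N n k w - Y n k w|)%R].
Proof.
apply: measurable_bool_set; apply: measurable_fun_ler => //.
apply: measurableT_comp => //; apply: measurable_funB.
  exact: measurable_critical_node.
exact: measurable_mu1_node.
Qed.

Let measurable_gap N n lam : measurable (gap N n lam).
Proof. by apply: bigsetU_measurable => k _; exact: measurable_gap1. Qed.

(** At fixed [n] there are finitely many nodes, so convergence in probability at each node and a
    union bound suffice. *)
Let small_gap n lam dl : 0 < lam -> 0 < dl ->
  exists m0, forall N, (m0 <= N)%N -> (P (gap N n lam) <= dl%:E)%E.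
Proof.
move=> lam0 dl0; set K := (2 ^ n).+1; have K0 : 0 < K%:R :> R by [].
have ev : \forall N \near \oo, forall k : 'I_K,
    (P [set w | (lam <= `|Z N n k w - Y n k w|)%R] <= (dl / K%:R)%:E)%E.
  apply: filter_forall => k.
  have := mu1_cvg (continuous_subspaceT (@continuous_tent R n k)) lam0.
  move=> /cvge_near_lt-/(_ (dl / K%:R)%:E) H.
  have dK : (0 < (dl / K%:R)%:E)%E by rewrite lte_fin divr_gt0.
  by apply: filterS (H dK) => N /ltW.
case: ev => m0 _ ev; exists m0 => N mN; apply: (@le_trans _ _ (\sum_(k < K) P [set w | (lam <= `|Z N n k w - Y n k w|)%R])%E).
  apply: (@Boole_inequality _ _ _ P (fun k => [set w | (lam <= `|Z N n k w - Y n k w|)%R])).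
  by move=> k _; exact: measurable_gap1.
apply: le_trans (lee_sum _ (fun k _ => ev N mN k)) _.
by rewrite sumEFin lee_fin sumr_const card_ord -[leLHS]mulr_natr divfK// gt_eqF.
Qed.

Let critical_measure_fin N w (A : set (measurableTypeR R)) : measurable A ->
  (critical_measure Xi N w A < +oo)%E.
Proof.
move=> mA; rewrite critical_measureE//.
apply: lte_sum_pinfty => t _; rewrite lte_mul_pinfty//.
apply: (@le_lt_trans _ _ (lebesgue_measure (@word_itv R t))).
  apply: le_measure; rewrite ?inE; last exact: subIsetl.
    by apply: measurableI => //; exact: measurable_word_itv.
  exact: measurable_word_itv.
by rewrite lebesgue_word_itv ltry.
Qed.

Let node_le n m k w lam : 0 <= lam ->
  Num.sqrt (n + m)%:R * M n m [::] w <= lam -> Z (n + m) n k w <= 4 * lam.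
Proof.
move=> lam0 Ml; rewrite -lee_fin /node_mass integral_tentE; last first.
  by apply: critical_measure_fin; exact: measurable_itv.
apply: le_trans (integral_tent_le _ _ _) _.
apply: (@critical_measure_le _ _ _ _ _ n m w lam k) => //.
  by apply: measurableI; [exact: measurable_itv|exact: measurable_near_node].
by move=> x [].
Qed.

Let node_ge n m w lam : lam < Num.sqrt (n + m)%:R * M n m [::] w ->
  exists2 k, (k <= 2 ^ n)%N & lam < Z (n + m) n k w.
Proof.
have [s sn] := M_attained Xi n m [::] w.
rewrite branch_sum_nil expR0 mul1r/= => -> h.
have ns := nval_lt s; rewrite sn in ns.
exists (nval s); first exact: ltnW.
apply: lt_le_trans h _; rewrite -lee_fin.
apply: le_trans (critical_measure_word_itv Xi m w sn) _.
apply: Rintegral_tent_ge.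
- by apply: critical_measure_fin; exact: measurable_itv.
- exact: measurable_word_itv.
- move=> x /word_itvP[h1 h2]; rewrite sn in h1 h2.
  have p0 : 0 < 2 ^+ n :> R by exact: exprn_gt0.
  have h3 : (nval s)%:R + 1 <= 2 ^+ n :> R by rewrite natr1 -natrX ler_nat.
  rewrite /= in_itv/= -(ler_pM2r p0) mul0r -[X in _ && X](ler_pM2r p0) mul1r.
  by rewrite (le_trans _ h1)//= (le_trans (ltW h2)).
- by move=> x /word_itvP[]; rewrite sn => h1 h2; rewrite ler_norml; apply/andP; split; lra.
Qed.

(** Of the factor [5], four parts come from the words near a node and one from the gap between the
    cascade and its limit. As the gap is small at every large order, a single large [m] is
    enough. *)
Lemma high_upper n lam be dl : 0 < lam -> 0 < dl ->
  (forall m0, exists2 m, (m0 <= m)%N &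
    (P [set w | (lam <= Num.sqrt (n + m)%:R * M n m [::] w)%R] <= be%:E)%E) ->
  (P (high n (5 * lam)%R) <= (be + dl)%:E)%E.
Proof.
move=> lam0 dl0 hb; have [m0 hg] := small_gap n lam0 dl0.
have [m mm hm] := hb m0.
set A := [set w | _] in hm; have mA : measurable A.
  apply: measurable_bool_set; apply: measurable_fun_ler => //.
  by apply: measurable_funM => //; exact: measurable_M.
rewrite EFinD; apply: le_trans (leeD hm (hg (n + m)%N (leq_trans mm (leq_addl _ _)))).
apply: le_trans (measureU2 _ mA (measurable_gap _ _ _)).
apply: le_measure; rewrite ?inE.
- exact: measurable_high.
- by apply: measurableU.
move=> w /highP[k kn hk]; have [h|h] := boolP (lam <= Num.sqrt (n + m)%:R * M n m [::] w).
  by left.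
right; apply/gapP; exists k => //.
move: h; rewrite -ltNge => /ltW /(node_le k (ltW lam0)) h.
by rewrite ler_normr; apply/orP; right; lra.
Qed.

(** The word of largest mass lies under the plateau of a node; the factor [2] leaves [lam] for the
    gap to the limit. *)
Lemma high_lower n lam be dl : 0 < lam -> 0 < dl ->
  (exists m0, forall m, (m0 <= m)%N ->
    (P [set w | (Num.sqrt (n + m)%:R * M n m [::] w <= 2 * lam)%R] <= be%:E)%E) ->
  (P (~` high n lam) <= (be + dl)%:E)%E.
Proof.
move=> lam0 dl0 [m1 hb]; have [m0 hg] := small_gap n lam0 dl0.
pose m := maxn m0 m1; have hm := hb m (leq_maxr _ _).
set A := [set w | _] in hm; have mA : measurable A.
  apply: measurable_bool_set; apply: measurable_fun_ler => //.
  by apply: measurable_funM => //; exact: measurable_M.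
rewrite EFinD; apply: le_trans (leeD hm (hg (n + m)%N (leq_trans (leq_maxl _ _) (leq_addl _ _)))).
apply: le_trans (measureU2 _ mA (measurable_gap _ _ _)).
apply: le_measure; rewrite ?inE.
- by apply: measurableC; exact: measurable_high.
- by apply: measurableU.
move=> w /highP nh; have [h|h] := boolP (Num.sqrt (n + m)%:R * M n m [::] w <= 2 * lam).
  by left.
right; apply/gapP; move: h; rewrite -ltNge => /node_ge[k kn h]; exists k => //.
have h' : Y n k w < lam by rewrite ltNge; apply/negP => h'; apply: nh; exists k.
by rewrite ler_normr; apply/orP; left; lra.
Qed.

End transfer.

(** * Comparison of lengths with dyadic scales *)

Section modulus_scale.
Variable R : realType.
Implicit Types (t gamma : R) (n : nat).

(** The doubled exponent allows [n] to run over powers of two only: all lengths between [2^-2n] and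
    [2^-n] share the scale [n]. *)
Lemma log_le_scale t n : 0 < t -> (0 < n)%N -> 1 < t * 2 ^+ n.*2 ->
  ln (1 + t^-1) <= 4 * n%:R.
Proof.
move=> t0 n0 tn; have n1 : 1 <= n%:R :> R by rewrite ler1n.
have p0 : 1 <= 2 ^+ n.*2 :> R by rewrite exprn_ege1// ler1n.
have it : t^-1 < 2 ^+ n.*2 by rewrite invf_plt ?posrE// ?exprn_gt0// -[X in X < _]mul1r ltr_pdivrMr ?exprn_gt0.
have l2 : ln 2 <= 1 :> R.
  by rewrite (_ : 2 = 1 + 1)// le_ln1Dx.
apply: (@le_trans _ _ (ln (2 ^+ n.*2.+1))).
  by rewrite ler_ln ?posrE ?exprn_gt0// ?addr_gt0 ?invr_gt0// exprS; lra.
rewrite lnXn// -[leLHS]mulr_natl; apply: (@le_trans _ _ (n.*2.+1)%:R).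
  by rewrite -[leRHS]mulr1 ler_wpM2l.
by rewrite -natrM ler_nat; lia.
Qed.

(** The length [4 * 2^-n] is that of the support of a tent. The [1/4] comes from [ln 2 >= 1/2] and
    from [n - 2 >= n / 2]. *)
Lemma log_ge_scale t n : 0 < t -> (4 <= n)%N -> t * 2 ^+ n <= 4 ->
  n%:R / 4 <= ln (1 + t^-1).
Proof.
move=> t0 n4 tn.
have p0 : 0 < 2 ^+ n :> R by rewrite exprn_gt0.
have l2 : 2^-1 <= ln 2 :> R.
  rewrite -[leLHS]expRK ler_ln ?posrE ?expR_gt0//.
  have h : 2^-1 <= expR (- 2^-1) :> R by apply: le_trans (expR_ge1Dx _); lra.
  by rewrite expRN in h; rewrite -[leLHS]invrK invf_ple ?posrE ?invr_gt0 ?expR_gt0.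
apply: (@le_trans _ _ (ln (2 ^+ (n - 2)))); last first.
  rewrite ler_ln ?posrE ?exprn_gt0// ?addr_gt0 ?invr_gt0//.
  have h : 2 ^+ n <= 4 * t^-1 by rewrite ler_pdivlMr// mulrC.
  have h' : 2 ^+ n = 4 * 2 ^+ (n - 2) :> R.
    by rewrite -{1}(subnK (_ : 2 <= n)%N) 1?mulrC ?exprD; [congr (_ * _); ring|lia].
  rewrite h' in h; lra.
rewrite lnXn// -[leRHS]mulr_natl; apply: (@le_trans _ _ ((n - 2)%:R * 2^-1)).
  have h4 : 4 <= n%:R :> R by rewrite ler_nat.
  by rewrite natrB; [lra|lia].
by apply: ler_wpM2l.
Qed.

Lemma powRN_scale gamma t n : 0 < gamma -> 0 < t -> (0 < n)%N ->
  1 < t * 2 ^+ n.*2 ->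
  expR (- (gamma * ln n%:R)) <= expR (gamma * ln 4) * ln (1 + t^-1) `^ (- gamma).
Proof.
move=> g0 t0 n0 tn; have l0 : 0 < ln (1 + t^-1) by rewrite ln_gt0// ltrDl invr_gt0.
rewrite /powR gt_eqF// -expRD ler_expR.
have n0' : 0 < n%:R :> R by rewrite ltr0n.
have : ln (ln (1 + t^-1)) <= ln (4 * n%:R).
  by rewrite ler_ln ?posrE ?mulr_gt0//; exact: log_le_scale.
rewrite lnM ?posrE// => /(ler_wpM2l (ltW g0)); lra.
Qed.

Lemma powRN_scale_le gamma t n : 0 < gamma -> 0 < t -> (4 <= n)%N ->
  t * 2 ^+ n <= 4 ->
  ln (1 + t^-1) `^ (- gamma) <= expR (gamma * ln 4) * expR (- (gamma * ln n%:R)).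
Proof.
move=> g0 t0 n4 tn; have n0 : (0 < n)%N by exact: leq_trans n4.
have l0 : 0 < ln (1 + t^-1) by rewrite ln_gt0// ltrDl invr_gt0.
rewrite /powR gt_eqF// -expRD ler_expR.
have n0' : 0 < n%:R :> R by rewrite ltr0n.
have : ln (n%:R / 4) <= ln (ln (1 + t^-1)).
  by rewrite ler_ln ?posrE ?divr_gt0//; exact: log_ge_scale.
rewrite (@ln_div _ n%:R 4) ?posrE// => /(ler_wpM2l (ltW g0)); lra.
Qed.

End modulus_scale.

(** * The modulus for exponents below one half *)

Section upper_tail.
Context {d0} {Om0 : measurableType d0} {d} {Om : measurableType d} {R : realType}.
Context {P0 : probability Om0 R} {P : probability Om R}.
Variables (xi : {RV P0 >-> R}) (Xi : seq bool -> {RV P >-> R}).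
Hypothesis Xi_law : forall s, s <> [::] -> same_law (Xi s) xi.
Hypothesis Xi_indep : mutually_independent [set s | s <> [::]] Xi.
Hypothesis xi_mean : ('E_P0[(fun w => expR (xi w))%R] = (2^-1)%:E)%E.
Hypothesis xi_crit : ('E_P0[(fun w => xi w * expR (xi w))%R] = 0)%E.
Hypothesis xi_pos : exists2 h : R, 0 < h &
  ('E_P0[(fun w => expR ((1 + h) * xi w))%R] < +oo)%E.
Local Notation M := (M Xi).

(** [max_mass_upper] with [a = ep * ln n] and [s = (gamma + ep) * ln n]. The factor [1 + a] costs at
    most [n] to the power [ep], and [ep] is chosen so that [gamma + ep - 1/2 = - ep]. *)
Lemma max_mass_tail gamma : gamma < 2^-1 -> 0 < gamma ->
  exists K ep : R, [/\ 0 < K, 0 < ep & forall n m0, (0 < n)%N ->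
  exists2 m, (m0 <= m)%N &
  (P [set w | (expR (- (gamma * ln n%:R)) <= Num.sqrt (n + m)%:R * M n m [::] w)%R]
   <= (K * expR (- (ep * ln n%:R)))%:E)%E].
Proof.
move=> g2 g0; have [C C0 H] := max_mass_upper Xi_law Xi_indep xi_mean xi_crit xi_pos.
pose ep := (2^-1 - gamma) / 2; have ep0 : 0 < ep by rewrite /ep; lra.
exists (2 + C), ep; split => //; first by rewrite addr_gt0.
move=> n m0 n0; have n1 : 1 <= n%:R :> R by rewrite ler1n.
set L := ln n%:R; have L0 : 0 <= L by rewrite ln_ge0.
have [|||m mm] := H n (ep * L) ((gamma + ep) * L) (expR (- ((gamma + ep) * L))) m0 n0.
- by rewrite mulr_ge0// ltW.
- by rewrite mulr_ge0// addr_ge0// ltW.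
- exact: expR_gt0.
rewrite (_ : ep * L - (gamma + ep) * L = - (gamma * L)); last by ring.
set A := [set w | _] => hm; exists m => //.
apply: le_trans (_ : (expR (gamma * L))%:E * ((expR (- (gamma * L)))%:E * P A) <= _)%E.
  by rewrite muleA -EFinM -expRD subrr expR0 mul1e.
apply: le_trans (lee_wpmul2l _ hm) _; first by rewrite lee_fin expR_ge0.
rewrite -EFinM lee_fin.
have sq : (Num.sqrt n.+1%:R)^-1 <= expR (- (2^-1 * L)).
  rewrite expRN lef_pV2 ?posrE ?expR_gt0 ?sqrtr_gt0//.
  apply: (@le_trans _ _ (Num.sqrt n%:R)); last by rewrite ler_wsqrtr// ler_nat.
  by rewrite -powR12_sqrt// /powR gt_eqF// ltr0n.
have -> : expR (- (ep * L)) = expR (gamma * L) * expR (- ((gamma + ep) * L)).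
  by rewrite -expRD; congr expR; ring.
rewrite mulrCA ler_wpM2l ?expR_ge0//; set x := expR (- ((gamma + ep) * L)).
rewrite (_ : (2 + C) * x = x + x + C * x) ?lerD2l; last by ring.
rewrite -mulrA ler_wpM2l ?(ltW C0)//.
have -> : x = expR (ep * L) * expR (- (2^-1 * L)).
  by rewrite -expRD; congr expR; rewrite /ep; field.
by rewrite ler_pM ?expR_ge1Dx// ?invr_ge0 ?sqrtr_ge0// addr_ge0// mulr_ge0// ltW.
Qed.
End upper_tail.

Section modulus.
Context {d0} {Om0 : measurableType d0} {d} {Om : measurableType d} {R : realType}.
Context {P0 : probability Om0 R} {P : probability Om R}.
Variables (xi : {RV P0 >-> R}) (Xi : seq bool -> {RV P >-> R}).
Hypothesis Xi_law : forall s, s <> [::] -> same_law (Xi s) xi.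
Hypothesis Xi_indep : mutually_independent [set s | s <> [::]] Xi.
Hypothesis xi_mean : ('E_P0[(fun w => expR (xi w))%R] = (2^-1)%:E)%E.
Hypothesis xi_crit : ('E_P0[(fun w => xi w * expR (xi w))%R] = 0)%E.
Hypothesis xi_pos : exists2 h : R, 0 < h &
  ('E_P0[(fun w => expR ((1 + h) * xi w))%R] < +oo)%E.
Variable mu1 : R.-ftker Om ~> measurableTypeR R.
Hypothesis mu1_cvg : cvg_weakly_in_probability P
  (fun n w => critical_measure Xi n w) mu1.
Local Notation Y n k := (fun w => node_mass (mu1 w) n k).

Let sc (gamma : R) (j : nat) : R := expR (- (gamma * ln (2 ^ j)%:R)).

Lemma mu1_unit_lty w : (mu1 w (`[0%R, 1%R]%classic : set (measurableTypeR R)) < +oo)%E.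
Proof.
have mJ : measurable (`[0%R, 1%R]%classic : set (measurableTypeR R)) by exact: measurable_itv.
by have := kernel_finite_transition (s := mu1) w _ mJ; rewrite ge0_fin_numE.
Qed.

Let pow2E (x : R) j : expR (- (x * ln (2 ^ j)%:R)) = expR (- (x * ln 2)) ^+ j.
Proof.
by rewrite -expRM_natl natrX lnXn// -[ln 2 *+ j]mulr_natl; congr expR; ring.
Qed.

(** Along [n = 2 ^ j] a negative power of [n] is geometric in [j], and the error of the passage to
    the limit is chosen to be [r ^+ j] as well. *)
Lemma high_io_null gamma : 0 < gamma -> gamma < 2^-1 ->
  P (lim_sup_set (fun j => high mu1 (2 ^ j) (5 * sc gamma j))) = 0%E.
Proof.
move=> g0 g2.
have [K [ep [K0 ep0 H]]] := max_mass_tail Xi_law Xi_indep xi_mean xi_crit xi_pos g2 g0.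
pose r := expR (- (ep * ln 2)) : R.
have r0 : 0 < r by exact: expR_gt0.
have r1 : r < 1 by rewrite -expR0 ltr_expR oppr_lt0 mulr_gt0// ln_gt0// ltr1n.
apply: lim_sup_set_cvg0 => [j|]; first exact: measurable_high.
have hj j : (P (high mu1 (2 ^ j) (5 * sc gamma j)%R) <= ((K + 1) * r ^+ j)%:E)%E.
  rewrite (_ : (K + 1) * r ^+ j = K * r ^+ j + r ^+ j); last by rewrite mulrDl mul1r.
  apply: (@high_upper _ _ _ _ Xi mu1 mu1_cvg (2 ^ j) (sc gamma j) (K * r ^+ j) (r ^+ j)).
  - exact: expR_gt0.
  - by rewrite exprn_gt0.
  move=> m0; have [|m mm hm] := H (2 ^ j)%N m0; first by rewrite expn_gt0.
  by exists m => //; rewrite -pow2E.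
apply: (@le_lt_trans _ _ ((K + 1) / (1 - r))%:E); last exact: ltry.
apply: lime_le; first by apply: is_cvg_nneseries.
apply: nearW => n; apply: le_trans (lee_sum _ (fun j _ => hj j)) _.
rewrite sumEFin lee_fin.
have := @geometric_seriesE R (K + 1) r; rewrite lt_eqF// => /(_ erefl).
move/(congr1 (fun u => u n)); rewrite /series /= => ->.
rewrite ler_wpM2r ?invr_ge0 ?subr_ge0 ?(ltW r1)// -[leRHS]mulr1 ler_wpM2l//; last first.
  by rewrite lerBlDr lerDl exprn_ge0// ltW.
by rewrite addr_ge0// ltW.
Qed.

(** For the least admissible [j > 0], failure at [j - 1] is the second condition, because doubling
    [2 ^ (j - 1)] gives [2 ^ j]. *)
Lemma dyadic_scale (t : R) : 0 < t -> t <= 1 -> exists2 j : nat,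
  1 < t * 2 ^+ (2 ^ j).*2 & (j = 0%N \/ t * 2 ^+ (2 ^ j) <= 1).
Proof.
move=> t0 t1.
have ex : exists j, 1 < t * 2 ^+ (2 ^ j).*2.
  exists (Num.truncn t^-1).+1; rewrite mulrC -ltr_pdivrMr// div1r.
  apply: lt_le_trans (truncnS_gt _) _; rewrite -natrX ler_nat.
  set N := _.+1; rewrite ltnW//; apply: leq_trans (ltn_expl N (isT : 1 < 2)%N) _.
  rewrite leq_exp2l//; apply: leq_trans (ltnW (ltn_expl N (isT : 1 < 2)%N)) _.
  by rewrite -addnn leq_addr.
case: (ex_minnP ex) => j hj jmin; exists j => //.
case: j hj jmin => [|j] hj jmin; [by left|right].
rewrite leNgt; apply/negP => h; have := jmin j.
by rewrite ltnn expnS mul2n in h * => /(_ h).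
Qed.

Lemma modulus_exists gamma : 0 < gamma -> gamma < 2^-1 -> log_modulus P mu1 gamma.
Proof.
move=> g0 g2.
(* The constant is a supremum over all scales and nodes, hence measurable; the value [0] pads the
   indices that are not nodes. *)
pose h j k w : \bar R := if (k <= 2 ^ 2 ^ j)%N then (expR (gamma * ln (2 ^ j)%:R) * Y (2 ^ j) k w)%:E else 0%E.
pose G j w := esups (h j ^~ w) 0%N.
(* The total mass is added for the scale [n = 1], where the interval may be too long for a
   plateau. *)
pose D w := (esups (G ^~ w) 0%N + mu1 w [set: _])%E.
have mh j k : measurable_fun [set: Om] (h j k).
  rewrite /h; case: (k <= _)%N => //; apply/measurable_EFinP; apply: measurable_funM => //.
  exact: measurable_mu1_node.
have mG j : measurable_fun [set: Om] (G j) by exact: measurable_fun_esups.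
have mD : measurable_fun [set: Om] D.
  by apply: emeasurable_funD; [exact: measurable_fun_esups|exact: measurable_kernel].
have hG j k w : (h j k w <= G j w)%E by apply: ereal_sup_ubound; exists k.
have GD j w : (G j w <= esups (G ^~ w) 0%N)%E by apply: ereal_sup_ubound; exists j.
have mass_fin w : mu1 w [set: measurableTypeR R] \is a fin_num.
  exact: (kernel_finite_transition (s := mu1)).
have Y0 n k w : 0 <= Y n k w by exact: Rintegral_tent_ge0.
have S0 w : (0 <= esups (G ^~ w) 0%N)%E.
  apply: le_trans (le_trans (hG 0%N 0%N w) (GD 0%N w)).
  by rewrite /h; case: (0 <= _)%N => //; rewrite lee_fin mulr_ge0 ?expR_ge0.
exists (fun w => (expR (gamma * ln 4))%:E * D w)%E; split.
- by apply: emeasurable_funM.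
- exists (lim_sup_set (fun j => high mu1 (2 ^ j) (5 * sc gamma j))); split.
  + apply: bigcap_measurable => [|n _]; first by exists 0%N.
    by apply: bigcup_measurable => j _; exact: measurable_high.
  + exact: high_io_null.
  move=> w /= nfin; apply: contrapT => nio; apply: nfin.
  suff : (esups (G ^~ w) 0%N < +oo)%E.
    by move=> Sfin; rewrite fin_numM// fin_numD mass_fin andbT ge0_fin_numE.
  (* Off the null event only the finitely many scales below [j0] can exceed [5], and these are
     bounded through the total mass. *)
  have [j0 hj0] : exists j0, forall j, (j0 <= j)%N -> ~ high mu1 (2 ^ j) (5 * sc gamma j) w.
    apply: contrapT => nex; apply: nio => n _; apply: contrapT => nn; apply: nex.
    by exists n => j nj hw; apply: nn; exists j.
  pose B := fine (mu1 w [set: measurableTypeR R]).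
  have B0 : 0 <= B by rewrite fine_ge0.
  have YB n k : Y n k w <= B.
    rewrite -lee_fin /node_mass integral_tentE ?mu1_unit_lty// fineK//.
    apply: le_trans (integral_tent_le _ _ _) _.
    apply: le_measure; rewrite ?inE//.
    by apply: measurableI; [exact: measurable_itv|exact: measurable_near_node].
  have bound j k : (h j k w <= (5 + expR (gamma * ln (2 ^ j0)%:R) * B)%:E)%E.
    rewrite /h; case: (boolP (k <= _)%N) => [kj|_]; rewrite lee_fin; last first.
      by rewrite addr_ge0// mulr_ge0// expR_ge0.
    have [jj|jj] := leqP j0 j.
      apply: (@le_trans _ _ 5); last by rewrite lerDl mulr_ge0// expR_ge0.
      have /highP nh := hj0 _ jj.
      have : Y (2 ^ j)%N k w < 5 * sc gamma j.
        by rewrite ltNge; apply/negP => h'; apply: nh; exists k.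
      by rewrite /sc expRN ltr_pdivlMr ?expR_gt0// mulrC => /ltW.
    apply: ler_wpDl => //; rewrite ler_pM ?expR_ge0// ler_expR ler_wpM2l ?(ltW g0)//.
    rewrite ler_ln ?posrE ?ltr0n ?expn_gt0// ler_nat leq_exp2l//; exact: ltnW.
  apply: le_lt_trans (ltry (5 + expR (gamma * ln (2 ^ j0)%:R) * B)).
  apply: ge_ereal_sup => _ [j _ <-]; apply: ge_ereal_sup => _ [k _ <-].
  exact: bound.
- apply: aeW => w a b ba bb a0 ab b1.
  set I : set (measurableTypeR R) := [set` _].
  have Iab x : I x -> a <= x <= b.
    by rewrite /I /= in_itv/= => /andP[/lteifW -> /lteifW ->].
  have t0 : 0 < b - a by rewrite subr_gt0.
  have t1 : b - a <= 1 by lra.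
  have [j j1 j2] := dyadic_scale t0 t1; set n := (2 ^ j)%N in j1 j2.
  have n0 : (0 < n)%N by rewrite expn_gt0.
  have := powRN_scale g0 t0 n0 j1; set l := ln _ `^ _ => hl.
  have IJ : I `<=` `[0, 1]%classic.
    by move=> x /Iab /andP[h1 h2]; rewrite /= in_itv/= (le_trans a0 h1) (le_trans h2 b1).
  have mI : measurable I by exact: measurable_itv.
  rewrite muleAC -EFinM.
  apply: (@le_trans _ _ ((expR (- (gamma * ln n%:R)))%:E * D w)%E); last first.
    by rewrite lee_wpmul2r ?lee_fin// adde_ge0.
  case: j2 => [j0|tn].
    rewrite /n j0 ln1 mulr0 oppr0 expR0 mul1e /D.
    apply: le_trans (leeDr _ (S0 w)).
    by apply: le_measure; rewrite ?inE.
  (* The node just to the right of [a]: an interval from [a] of length at most [2^-n] stays within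
     one unit of it. *)
  pose k := (Num.truncn (a * 2 ^+ n)).+1.
  have p0 : 0 < 2 ^+ n :> R by rewrite exprn_gt0.
  have an0 : 0 <= a * 2 ^+ n by rewrite mulr_ge0// ltW.
  have kn : (k <= 2 ^ n)%N.
    rewrite /k truncn_lt_nat// natrX -[ltRHS]mul1r ltr_pM2r//.
    exact: lt_le_trans ab b1.
  have /andP[ka ak] := truncn_itv an0; rewrite -/k in ak.
  apply: (@le_trans _ _ (Y n k w)%:E).
    apply: Rintegral_tent_ge => //; first exact: mu1_unit_lty.
    move=> x /Iab /andP[]; rewrite -(ler_pM2r p0) => h1; rewrite -(ler_pM2r p0) => h2.
    move: ak; rewrite /k -natr1 => ak; rewrite ler_norml; apply/andP; split; lra.
  rewrite expRN lee_pdivlMl ?expR_gt0// -EFinM.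
  apply: (@le_trans _ _ (h j k w)); first by rewrite /h kn.
  by apply: le_trans (hG j k w) (le_trans (GD j w) _); rewrite /D leeDl.
Qed.

End modulus.

(** * Failure of exponents above one half *)

Section sharpness.
Context {d0} {Om0 : measurableType d0} {d} {Om : measurableType d} {R : realType}.
Context {P0 : probability Om0 R} {P : probability Om R}.
Variables (xi : {RV P0 >-> R}) (Xi : seq bool -> {RV P >-> R}).
Hypothesis Xi_law : forall s, s <> [::] -> same_law (Xi s) xi.
Hypothesis Xi_indep : mutually_independent [set s | s <> [::]] Xi.
Hypothesis xi_mean : ('E_P0[(fun w => expR (xi w))%R] = (2^-1)%:E)%E.
Hypothesis xi_crit : ('E_P0[(fun w => xi w * expR (xi w))%R] = 0)%E.
Hypothesis xi_pos : exists2 h : R, 0 < h &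
  ('E_P0[(fun w => expR ((1 + h) * xi w))%R] < +oo)%E.
Variable Y1 : {RV P >-> R}.
Hypothesis Y1_cvg : cvg_in_probability P (critical_mass Xi) Y1.
Hypothesis Y1_pos : {ae P, forall w, 0 < Y1 w}.
Variable mu1 : R.-ftker Om ~> measurableTypeR R.
Hypothesis mu1_cvg : cvg_weakly_in_probability P
  (fun n w => critical_measure Xi n w) mu1.
Local Notation M := (M Xi).
Local Notation W := (W Xi).

Let crit n w : R := Num.sqrt n%:R * W n [::] w.

Let measurable_crit n : measurable_fun [set: Om] (crit n).
Proof. by apply: measurable_funM => //; exact: measurable_W. Qed.

Lemma ae_measure_lt (f : Om -> R) (ep : R) : measurable_fun [set: Om] f ->
  {ae P, forall w, 0 < f w} -> 0 < ep ->
  exists2 eta : R, 0 < eta & (P [set w | (f w <= eta)%R] < ep%:E)%E.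
Proof.
move=> mf f0 ep0; pose F n := [set w | (f w <= n.+1%:R^-1)%R].
have mF n : measurable (F n) by apply: measurable_bool_set; exact: measurable_fun_ler.
have cF : P \o F @ \oo --> P (\bigcap_n F n).
  apply: nonincreasing_cvg_mu => //.
  - by apply: le_lt_trans (probability_le1 _ (mF _)) (ltry _).
  - exact: bigcap_measurable.
  - move=> n m nm; apply/subsetPset => w /= h; apply: le_trans h _.
    by rewrite lef_pV2 ?posrE// ler_nat.
have F0 : P (\bigcap_n F n) = 0%E.
  case: f0 => A [mA A0 fA]; apply: subset_measure0 A0 => //.
    exact: bigcap_measurable.
  move=> w Fw; apply: fA => /= fw.
  have := Fw (Num.truncn (f w)^-1) I; rewrite /F/= leNgt => /negP; apply.
  by rewrite invf_plt ?posrE// truncnS_gt.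
rewrite F0 in cF.
have /(cvge_near_lt cF) : (0 < ep%:E)%E by [].
by case=> n _ /(_ n (leqnn n)) h; exists n.+1%:R^-1.
Qed.

(** The positivity of [Y1] enters here; half of its lower bound and half of [ep] pay for the
    convergence in probability. *)
Lemma crit_lower (ep : R) : 0 < ep -> exists2 eta : R, 0 < eta & exists m1, forall m,
  (m1 <= m)%N -> (P [set w | (crit m w <= eta)%R] <= ep%:E)%E.
Proof.
move=> ep0; have ep2 : 0 < ep / 2 by rewrite divr_gt0.
have [eta eta0 heta] := ae_measure_lt (measurable_funPT Y1) Y1_pos ep2.
have eta2 : 0 < eta / 2 by rewrite divr_gt0.
exists (eta / 2) => //.
have /cvge_near_lt-/(_ (ep / 2)%:E) := Y1_cvg eta2.
rewrite lte_fin => /(_ ep2)[m1 _ hm]; exists m1 => m mm.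
have {hm} := hm m mm; set A := [set w | _] in heta; set B := [set w | _] => hB.
have mA : measurable A by apply: measurable_bool_set; exact: measurable_fun_ler.
have mB : measurable B.
  apply: measurable_bool_set; apply: measurable_fun_ler => //.
  apply: measurableT_comp => //; apply: measurable_funB => //.
  rewrite (_ : critical_mass Xi m = crit m); first exact: measurable_crit.
  by apply/funext => w; exact: critical_massE.
rewrite (splitr ep) EFinD; apply: le_trans (leeD (ltW heta) (ltW hB)).
apply: le_trans (measureU2 _ mA mB); apply: le_measure; rewrite ?inE.
- by apply: measurable_bool_set; exact: measurable_fun_ler.
- exact: measurableU.
move=> w /= h; have [|h'] := leP (Y1 w) eta; first by left.
right; rewrite /B/= critical_massE -/(crit m w) ler_normr; apply/orP; right; lra.
Qed.

(** [crit_lower] is used twice: with [1/2] it supplies the probability [p] of [no_large_mass], with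
    [ep] it makes the minimum in the resulting exponent equal to [1] outside a small event. *)
Lemma high_likely gamma : 2^-1 < gamma -> exists2 rho : R, 0 < rho &
  exists n1, forall n, (n1 <= n)%N ->
  (P (~` high mu1 n (expR (- (gamma * ln n%:R)))) <= (1 - rho)%:E)%E.
Proof.
move=> g2.
have [C C0 HC] : exists2 C : R, 0 < C & exists x0, forall e, 0 < e ->
    exists m0 : nat, forall m n x, (m0 <= m)%N ->
  (P [set w | (Num.sqrt (n + m)%:R * M n m [::] w <= expR x)%R] <=
   \int[P]_w (expR (- (C * (Num.min (expR (x0 - x) * W n [::] w) 1 -
     2 ^+ n * e))))%:E)%E.
  have [//|eta eta0 [m1 hm]] := @crit_lower 2^-1 _.
  have [||C C0 H] := @no_large_mass _ _ _ _ _ _ _ _ _ Xi_law Xi_indep xi_mean xi_crit xi_pos (ln eta) 2^-1 m1.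
  - by [].
  - move=> m mm; rewrite lnK ?posrE//.
    rewrite (_ : [set w | _] = ~` [set w | (crit m w <= eta)%R]); last first.
      by apply/seteqP; split => w /=; rewrite ltNge => /negP.
    rewrite probability_setC; last by apply: measurable_bool_set; exact: measurable_fun_ler.
    rewrite leeBrDr ?fin_num_measure//; last first.
      by apply: measurable_bool_set; exact: measurable_fun_ler.
    apply: le_trans (leeD2l _ (hm m mm)) _; rewrite -EFinD lee_fin; lra.
  - by exists C => //; exists (ln eta).
case: HC => x0 HC.
(* The value of the integrand when the minimum is [1] and the error [2 ^+ n * e] is set to [1/4]. *)
pose q := expR (- (C * (3 / 4))).
have q1 : q < 1 by rewrite -expR0 ltr_expR oppr_lt0 mulr_gt0.
have q0 : 0 < q by exact: expR_gt0.
(* Three shares of [1 - q]: the event of small critical mass, the gap to the limit, and the final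
   margin. On the first event the integrand is at most [expR (C / 4)], which [ep] compensates. *)
pose rho := (1 - q) / 3; have rho0 : 0 < rho by rewrite /rho; lra.
pose ep := rho * expR (- (C / 4)); have ep0 : 0 < ep by rewrite mulr_gt0 ?expR_gt0.
have [eta eta0 [m1 hm1]] := crit_lower ep0.
exists rho => //.
(* Once [ln n] exceeds [X], the surplus power [gamma - 1/2] of [n] outweighs the constants and the
   minimum is [1]. *)
pose X := (ln 2 - x0 - ln eta) / (gamma - 2^-1).
exists (maxn m1 (Num.truncn (expR X)).+1) => n; rewrite geq_max => /andP[m1n Xn].
have n0 : (0 < n)%N by exact: leq_trans Xn.
have n0' : 0 < n%:R :> R by rewrite ltr0n.
set L := ln n%:R.
have XL : X <= L.
  rewrite -[leLHS]expRK ler_ln ?posrE ?expR_gt0//.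
  by apply: le_trans (ltW (truncnS_gt _)) _; rewrite ler_nat.
rewrite (_ : 1 - rho = (q + rho) + rho); last by rewrite /rho; lra.
apply: (high_lower mu1_cvg) => //; first exact: expR_gt0.
have e0 : 0 < 4^-1 / 2 ^+ n :> R by rewrite divr_gt0// exprn_gt0.
have [m0 hm0] := HC _ e0; exists m0 => m mm.
have E2 : 2 * expR (- (gamma * L)) = expR (ln 2 - gamma * L).
  by rewrite expRD lnK// posrE.
rewrite E2; apply: le_trans (hm0 m n _ mm) _.
rewrite mulrCA divff ?mulr1; last by rewrite gt_eqF// exprn_gt0.
pose b w := crit n w <= eta.
have mb : measurable_fun [set: Om] b by exact: measurable_fun_ler.
apply: (@le_trans _ _ (\int[P]_w (q%:E + (expR (C / 4))%:E * ((b w)%:R)%:E))%E).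
  apply: ge0_le_integral => //.
  - apply/measurable_EFinP; apply: measurableT_comp => //; apply: measurableT_comp => //.
    apply: measurable_funM => //; apply: measurable_funB => //.
    by apply: measurable_minr => //; apply: measurable_funM => //; exact: measurable_W.
  - apply: emeasurable_funD => //; apply: emeasurable_funM => //.
    by apply/measurable_EFinP; exact: measurable_boolR.
  move=> w _; rewrite -EFinM -EFinD lee_fin /b.
  have [h|h] := leP (crit n w) eta.
    apply: ler_wpDl; first exact: ltW.
    rewrite mulr1 ler_expR -mulrN ler_wpM2l ?(ltW C0)//.
    have : 0 <= Num.min (expR (x0 - (ln 2 - gamma * L)) * W n [::] w) 1.
      by rewrite le_min ler01 mulr_ge0 ?expR_ge0 ?W_ge0.
    lra.
  rewrite mulr0 addr0 (min_idPr _); first by rewrite ler_expR lerN2 ler_wpM2l ?(ltW C0)//; lra.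
  have sq : Num.sqrt n%:R = expR (2^-1 * L).
    by rewrite -powR12_sqrt ?ltW// /powR gt_eqF.
  have h1 : 1 <= eta^-1 * crit n w by rewrite ler_pdivlMl// mulr1 ltW.
  apply: le_trans h1 _; rewrite /crit mulrA ler_wpM2r ?W_ge0// sq.
  rewrite -{1}[eta]lnK ?posrE// -expRN -expRD ler_expR.
  by move: XL; rewrite /X ler_pdivrMr ?subr_gt0//; lra.
rewrite ge0_integralD//; last 2 first.
- by move=> w _; rewrite lee_fin ltW.
- apply: emeasurable_funM => //.
  by apply/measurable_EFinP; exact: measurable_boolR.
rewrite integral_cst_probability ge0_integralZl//; last first.
  by apply/measurable_EFinP; exact: measurable_boolR.
rewrite -probability_bool// EFinD leeD2l//.
apply: le_trans (lee_wpmul2l _ (hm1 n m1n)) _; first by rewrite lee_fin expR_ge0.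
by rewrite -EFinM lee_fin /ep mulrCA -expRD subrr expR0 mulr1.
Qed.

Lemma node_mass_le_itv (nu : {measure set (measurableTypeR R) -> \bar R}) n k :
  (nu `[0%R, 1%R]%classic < +oo)%E -> (k <= 2 ^ n)%N ->
  exists a b : R, [/\ 0 <= a, a < b, b <= 1, (b - a) * 2 ^+ n <= 4 &
    ((node_mass nu n k)%:E <= nu `[a, b]%classic)%E].
Proof.
move=> nuJ kn; have p0 : 0 < 2 ^+ n :> R by rewrite exprn_gt0.
(* The support of the tent cut down to [[0, 1]]. *)
pose a : R := Num.max 0 ((k%:R - 2) / 2 ^+ n); pose b : R := Num.min 1 ((k%:R + 2) / 2 ^+ n).
have kn' : k%:R <= 2 ^+ n :> R by rewrite -natrX ler_nat.
have k0 : 0 <= k%:R :> R by [].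
have ha : (k%:R - 2) / 2 ^+ n <= a by rewrite le_max lexx orbT.
have hb : b <= (k%:R + 2) / 2 ^+ n by rewrite ge_min lexx orbT.
exists a, b; split.
- by rewrite le_max lexx.
- have h1 : (k%:R - 2) / 2 ^+ n < 1 :> R by rewrite ltr_pdivrMr// mul1r; lra.
  have h2 : (k%:R - 2) / 2 ^+ n < (k%:R + 2) / 2 ^+ n :> R.
    by rewrite ltr_pM2r ?invr_gt0//; lra.
  have h3 : 0 < (k%:R + 2) / 2 ^+ n :> R by rewrite divr_gt0//; lra.
  by rewrite gt_max !lt_min ltr01 h1 h2 h3.
- by rewrite ge_min lexx.
- by move: ha hb; rewrite ler_pdivrMr// ler_pdivlMr// => ha hb; lra.
rewrite /node_mass integral_tentE//; apply: le_trans (integral_tent_le _ _ _) _.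
apply: le_measure; rewrite ?inE.
- by apply: measurableI; [exact: measurable_itv|exact: measurable_near_node].
- exact: measurable_itv.
move=> x [/=]; rewrite !in_itv/= => /andP[x0 x1]; rewrite ltr_norml => /andP[h1 h2].
rewrite ge_max le_min x0 x1/= ler_pdivrMr// ler_pdivlMr//; apply/andP; split; lra.
Qed.

(** With an intermediate exponent [g'], a node of mass [n] to the power [- g'] forces the constant
    above a multiple of [n] to the power [gamma - g']. An almost surely finite constant stays below
    a fixed [N] off an event of probability less than [rho], against [high_likely]. *)
Lemma no_modulus gamma : 2^-1 < gamma -> ~ log_modulus P mu1 gamma.
Proof.
move=> g2 [C [mC Cfin Cmod]].
pose g' := (gamma + 2^-1) / 2; have g'2 : 2^-1 < g' by rewrite /g'; lra.
have gg' : 0 < gamma - g' by rewrite /g'; lra.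
have g0 : 0 < gamma by lra.
have [rho rho0 [n1 hn1]] := high_likely g'2.
pose F N := [set w | (N%:R%:E <= C w)%E].
have mF N : measurable (F N).
  by rewrite /F -[X in measurable X]setTI; exact: emeasurable_fun_c_infty.
have cF : P \o F @ \oo --> P (\bigcap_n F n).
  apply: nonincreasing_cvg_mu => //.
  - by apply: le_lt_trans (probability_le1 _ (mF _)) (ltry _).
  - exact: bigcap_measurable.
  - move=> n m nm; apply/subsetPset => w /= h; apply: le_trans h.
    by rewrite lee_fin ler_nat.
have F0 : P (\bigcap_n F n) = 0%E.
  case: Cfin => A [mA A0 fA]; apply: subset_measure0 A0 => //.
    exact: bigcap_measurable.
  move=> w Fw; apply: fA => /= Cw.
  have := Fw (Num.truncn (fine (C w))).+1 I; rewrite /F/= -(fineK Cw) lee_fin leNgt.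
  by rewrite truncnS_gt.
rewrite F0 in cF.
have /(cvge_near_lt cF) : (0 < rho%:E)%E by [].
case=> N _ /(_ N (leqnn N)) /= hN.
case: Cmod => A [mA A0 hA].
(* [N.+1] rather than [N], since its logarithm is taken and [N] may be [0]. *)
pose X := (ln N.+1%:R + gamma * ln 4) / (gamma - g').
pose n := maxn (maxn n1 4) (Num.truncn (expR X)).+1.
have n1n : (n1 <= n)%N by rewrite /n -maxnA leq_maxl.
have n4 : (4 <= n)%N by rewrite /n maxnAC leq_maxr.
have Xn : (Num.truncn (expR X) < n)%N by rewrite /n leq_maxr.
have n0' : 0 < n%:R :> R by rewrite ltr0n; exact: leq_trans n4.
set L := ln (n%:R : R).
have XL : X <= L.
  rewrite -[leLHS]expRK ler_ln ?posrE ?expR_gt0//.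
  by apply: le_trans (ltW (truncnS_gt _)) _; rewrite ler_nat.
set H := high mu1 n (expR (- (g' * L))).
have mH : measurable H by exact: measurable_high.
have HFA : H `<=` F N `|` A.
  move=> w /highP[k kn hk]; have [Aw|nAw] := pselect (A w); [by right|left].
  have := contra_not (hA w) nAw => /= /contrapT hw.
  have [a [b [a0 ab b1 abn hab]]] := node_mass_le_itv (mu1_unit_lty mu1 w) kn.
  have t0 : 0 < b - a by rewrite subr_gt0.
  have := powRN_scale_le g0 t0 n4 abn; set l := ln _ `^ _ => hl.
  have l0 : 0 < l.
    by rewrite powR_gt0// ln_gt0// ltrDl invr_gt0.
  have := le_trans hab (hw a b true false a0 ab b1).
  rewrite -/l -lee_pdivrMr// -EFinM => hC.
  apply: le_trans hC; rewrite lee_fin ler_pdivlMr//.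
  apply: le_trans hk; apply: le_trans (ler_wpM2l _ hl) _ => //.
  apply: (@le_trans _ _ (N.+1%:R * (expR (gamma * ln 4) * expR (- (gamma * L))))).
    by rewrite ler_wpM2r ?mulr_ge0 ?expR_ge0// ler_nat.
  rewrite -{1}[N.+1%:R]lnK ?posrE// -!expRD ler_expR.
  move: XL; rewrite /X ler_pdivrMr// => XL; rewrite addrA lerBlDr.
  by apply: le_trans XL _; rewrite mulrBr addrC (mulrC L) (mulrC L).
have hH := hn1 n n1n.
have : (1 <= P H + P (~` H))%E.
  by rewrite -(@probability_setT _ _ _ P) -(setUv H) measureU2//; exact: measurableC.
have : (P H + P (~` H) < 1)%E.
  have PH : (P H < rho%:E)%E.
    apply: le_lt_trans hN; rewrite -[leRHS]adde0 -A0.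
    apply: le_trans (measureU2 _ (mF N) mA); apply: le_measure; rewrite ?inE//.
    exact: measurableU.
  rewrite (_ : 1%E = (rho%:E + (1 - rho)%:E)%E); last first.
    by rewrite -EFinD; congr EFin; ring.
  by apply: lte_leD => //; rewrite fin_num_measure//; exact: measurableC.
by move=> /lt_le_trans h /h; rewrite ltxx.
Qed.

End sharpness.

Theorem theorem3 (R : realType)
    (d0 : measure_display) (Omega0 : measurableType d0)
    (P0 : probability Omega0 R) (xi : {RV P0 >-> R})
    (hxi_mean : ('E_P0[(fun w => expR (xi w))%R] = (2^-1)%:E)%E)
    (hxi_crit : ('E_P0[(fun w => xi w * expR (xi w))%R] = 0)%E)
    (hxi_pos : exists2 h : R, 0 < h &
       ('E_P0[(fun w => expR ((1 + h) * xi w))%R] < +oo)%E)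
    (hxi_neg : exists2 h : R, 0 < h &
       ('E_P0[(fun w => expR (- h * xi w))%R] < +oo)%E)
    (d : measure_display) (Omega : measurableType d)
    (P : probability Omega R) (Xi : seq bool -> {RV P >-> R})
    (hXi_law : forall s, s <> [::] -> same_law (Xi s) xi)
    (hXi_indep : mutually_independent [set s | s <> [::]] Xi)
    (Y1 : {RV P >-> R})
    (hY1_cvg : cvg_in_probability P (critical_mass Xi) Y1)
    (hY1_pos : {ae P, forall w, 0 < Y1 w})
    (mu1 : R.-ftker Omega ~> measurableTypeR R)
    (hmu1_supp : forall w, mu1 w (~` `[0, 1]) = 0%E)
    (hmu1_cvg : cvg_weakly_in_probability P
       (fun n w => critical_measure Xi n w) mu1) :
  (forall gamma : R, 0 < gamma -> gamma < 2^-1 -> log_modulus P mu1 gamma) /\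
  (forall gamma : R, 2^-1 < gamma -> ~ log_modulus P mu1 gamma).
Proof.
split => gamma.
  exact: (modulus_exists hXi_law hXi_indep hxi_mean hxi_crit hxi_pos hmu1_cvg).
exact: (no_modulus hXi_law hXi_indep hxi_mean hxi_crit hxi_pos hY1_cvg hY1_pos hmu1_cvg).
Qed.
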